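(* Let $q\geq 3$ be a prime power and let $\mathcal K$ be a set of $q^2+2q+1$ points in $\mathrm{PG}(4,q)$ such that every 3-space $\Pi$ of $\mathrm{PG}(4,q)$ meets $\mathcal K$ in either one line, two lines, three lines, a line and a non-degenerate conic, or a twisted cubic. Then there is a 3-space $\Sigma_\infty$ of $\mathrm{PG}(4,q)$ and a regular spread $\mathcal S$ in $\Sigma_\infty$ such that, in the corresponding Bruck-Bose plane $\mathcal P(\mathcal S)\cong\mathrm{PG}(2,q^2)$, the set of points corresponding to $\mathcal K$ forms a Baer subplane of $\mathrm{PG}(2,q^2)$ which is tangent to $\ell_\infty$.
   Context: Lines, conics and twisted cubics are regarded as point sets. ''Meets $\mathcal K$ in'' one of the listed configurations means that the set $\Pi\cap\mathcal K$ equals such a configuration: one line; the union of two, respectively three, distinct lines; the union of a line and a non-degenerate conic of some plane; or a twisted cubic, i.e. a set of $q+1$ points of the 3-space projectively equivalent to $\{(1,t,t^2,t^3)\,|\,t\in\mathbb F_q\}\cup\{(0,0,0,1)\}$. A (line) spread of a 3-space $\Sigma_\infty\cong\mathrm{PG}(3,q)$ is a set of $q^2+1$ lines partitioning its points; it is regular if for any three of its lines the regulus they determine is contained in the spread. Bruck-Bose plane: let $\Sigma_\infty$ be a hyperplane of $\mathrm{PG}(4,q)$ and $\mathcal S$ a regular line spread of $\Sigma_\infty$. $\mathcal P(\mathcal S)$ is the incidence structure whose points are the points of $\mathrm{PG}(4,q)\setminus\Sigma_\infty$ and the lines of $\mathcal S$; whose lines are the planes of $\mathrm{PG}(4,q)$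 not contained in $\Sigma_\infty$ that contain an element of $\mathcal S$, together with a line at infinity $\ell_\infty$ whose points are the lines of $\mathcal S$; and whose incidence is induced by incidence in $\mathrm{PG}(4,q)$. Then $\mathcal P(\mathcal S)\cong\mathrm{PG}(2,q^2)$. For a set $\mathcal X$ of points of $\mathcal P(\mathcal S)$, $[\mathcal X]$ denotes the corresponding set of points in $\mathrm{PG}(4,q)$: the points of $\mathcal X$ that are points of $\mathrm{PG}(4,q)\setminus\Sigma_\infty$, together with all points on the spread lines belonging to $\mathcal X$. The set of points corresponding to $\mathcal K$ is the set $\mathcal X$ with $[\mathcal X]=\mathcal K$. A Baer subplane of $\mathrm{PG}(2,q^2)$ is a subplane of order $q$, i.e. an image of $\mathrm{PG}(2,q)$ under a projectivity of $\mathrm{PG}(2,q^2)$; it is tangent to $\ell_\infty$ if it meets $\ell_\infty$ in exactly one point. *)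

(* Defs.v *)
From HB Require Import structures.
From mathcomp Require Import all_boot all_order all_algebra all_field.

Set Implicit Arguments.
Unset Strict Implicit.
Unset Printing Implicit Defensive.

Import GRing.Theory.

Local Open Scope ring_scope.

(* PG(n, q) is the projective space of 'rV[F]_n.+1 with #|F| = q: the
   subspaces of projective dimension k are the U : {vspace 'rV[F]_n.+1} with
   \dim U = k.+1, and incidence is containment.  A point is a subspace of
   (vector space) dimension 1, and a set of points is a
   {set {vspace 'rV[F]_n.+1}} all of whose elements have dimension 1. *)

Import (canonicals) VectorInternalTheory.

HB.instance Definition _ (F : finFieldType) (V : vectType F) :=
  [Finite of {vspace V} by <:].

Section ProjectiveSpace.

Variables (F : finFieldType) (V : vectType F).
Implicit Types (U L P : {vspace V}) (A C : {set {vspace V}}).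

Definition points_of U : {set {vspace V}} :=
  [set P : {vspace V} | (\dim P == 1%N) && (P <= U)%VS].

(* Two subspaces have a common point. *)
Definition meets U1 U2 : bool := (U1 :&: U2 != 0)%VS.

Definition is_line A : Prop :=
  exists L, \dim L = 2%N /\ A = points_of L.

Definition is_two_lines A : Prop :=
  exists L1 L2, [/\ \dim L1 = 2%N, \dim L2 = 2%N, L1 <> L2 &
    A = points_of L1 :|: points_of L2].

Definition is_three_lines A : Prop :=
  exists L1 L2 L3,
    [/\ \dim L1 = 2%N, \dim L2 = 2%N & \dim L3 = 2%N] /\
    [/\ L1 <> L2, L1 <> L3, L2 <> L3 &
        A = points_of L1 :|: points_of L2 :|: points_of L3].

(* Over any field, including characteristic 2, every ternary quadratic form
   is x |-> x *m B *m x^T for some (not necessarily symmetric) B. *)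
Definition qform (B : 'M[F]_3) (x : 'rV[F]_3) : F := (x *m B *m x^T) 0 0.

Definition polar_form (B : 'M[F]_3) (x y : 'rV[F]_3) : F :=
  qform B (x + y) - qform B x - qform B y.

(* No nonzero singular vector lies in the radical of the polar form.  In
   characteristic 2 the polar form of a ternary form always has a nontrivial
   radical, so the condition qform B v = 0 cannot be dropped. *)
Definition nondegenerate_qform (B : 'M[F]_3) : Prop :=
  forall v, qform B v = 0 -> (forall x, polar_form B v x = 0) -> v = 0.

(* The injective linear map f gives homogeneous coordinates on the plane
   limg f. *)
Definition is_nondegenerate_conic C : Prop :=
  exists (f : 'Hom('rV[F]_3, V)) (B : 'M[F]_3),
    [/\ lker f = 0%VS, nondegenerate_qform B &
        C = [set <[f x]>%VS | x : 'rV[F]_3 & (x != 0) && (qform B x == 0)]].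

Definition is_line_and_conic A : Prop :=
  exists L C, [/\ \dim L = 2%N, is_nondegenerate_conic C &
    A = points_of L :|: C].

(* A twisted cubic of the 3-space Pi: f induces a projectivity from PG(3, q)
   onto Pi. *)
Definition is_twisted_cubic (Pi : {vspace V}) A : Prop :=
  exists f : 'Hom('rV[F]_4, V),
    [/\ lker f = 0%VS, limg f = Pi &
        A = [set <[f (\row_(i < 4) t ^+ i)%R]>%VS | t : F]
            :|: [set <[f (delta_mx 0 ord_max)%R]>%VS]].

(* The regulus determined by three pairwise skew lines L1, L2, L3 of a
   3-space: all lines meeting every transversal of L1, L2, L3. *)
Definition regulus L1 L2 L3 : {set {vspace V}} :=
  [set L : {vspace V} | (\dim L == 2%N) &&
    [forall T : {vspace V},
       [&& \dim T == 2%N, meets T L1, meets T L2 & meets T L3]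
         ==> meets T L]].

Definition line_spread (Sigma : {vspace V}) (S : {set {vspace V}}) : Prop :=
  [/\ forall L, L \in S -> \dim L = 2%N /\ (L <= Sigma)%VS,
      #|S| = (#|F| ^ 2 + 1)%N &
      forall P, P \in points_of Sigma -> exists! L, L \in S /\ (P <= L)%VS].

Definition regular_spread (Sigma : {vspace V}) (S : {set {vspace V}}) : Prop :=
  line_spread Sigma S /\
  forall L1 L2 L3, L1 \in S -> L2 \in S -> L3 \in S ->
    L1 <> L2 -> L1 <> L3 -> L2 <> L3 -> regulus L1 L2 L3 \subset S.

(* The Bruck-Bose incidence structure of the spread S of the hyperplane Sigma.
   The line at infinity is represented by Sigma itself; as no affine point
   lies in Sigma, the points contained in Sigma are exactly the elements of S,
   so that incidence is containment for every point and every line. *)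
Definition bb_points (Sigma : {vspace V}) (S : {set {vspace V}}) :
    {set {vspace V}} :=
  (points_of fullv :\: points_of Sigma) :|: S.

Definition bb_lines (Sigma : {vspace V}) (S : {set {vspace V}}) :
    {set {vspace V}} :=
  Sigma |: [set U : {vspace V} |
    [&& \dim U == 3%N, ~~ (U <= Sigma)%VS & [exists L in S, (L <= U)%VS]]].

(* The set [X] of points of PG(V) corresponding to a set X of points of the
   Bruck-Bose structure; recall that points_of P = [set P] for an affine
   point P. *)
Definition bb_set (X : {set {vspace V}}) : {set {vspace V}} :=
  \bigcup_(U in X) points_of U.

End ProjectiveSpace.

(* Isomorphism between two incidence structures whose points and lines are
   subspaces and whose incidence is containment; f acts on points and g on
   lines. *)
Definition incidence_iso (F E : finFieldType) (V : vectType F) (W : vectType E)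
    (P L : {set {vspace V}}) (P' L' : {set {vspace W}})
    (f g : {vspace V} -> {vspace W}) : Prop :=
  [/\ {in P &, injective f} /\ f @: P = P',
      {in L &, injective g} /\ g @: L = L' &
      {in P & L, forall p l, (f p <= g l)%VS = (p <= l)%VS}].

Definition pg2_points (E : finFieldType) : {set {vspace 'rV[E]_3}} :=
  points_of fullv.

Definition pg2_lines (E : finFieldType) : {set {vspace 'rV[E]_3}} :=
  [set L : {vspace 'rV[E]_3} | \dim L == 2%N].

(* An image of PG(2, F), embedded in PG(2, E) through iota, under a
   projectivity of PG(2, E). *)
Definition baer_subplane (F E : finFieldType) (iota : {rmorphism F -> E})
    (B : {set {vspace 'rV[E]_3}}) : Prop :=
  exists2 M : 'M[E]_3, M \in unitmx &
    B = [set <[(map_mx iota v *m M)%R]>%VS | v : 'rV[F]_3 & v != 0].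

(* Main.v *)
Require Import Defs.
From HB Require Import structures.
From mathcomp Require Import all_boot all_order all_algebra all_field.
From mathcomp Require Import zify ring.

Set Implicit Arguments.
Unset Strict Implicit.
Unset Printing Implicit Defensive.

Import GRing.Theory.

Local Open Scope ring_scope.

(** The set K turns out to be a ruled cubic surface: a line (the directrix), a
    conic in a plane skew to it, and the lines (generators) joining
    corresponding points of the two under a projectivity.  In coordinates, K
    consists of the points (s a, s b, r a^2, r a b, r b^2) ([normal_form]).

    The tool for recognising it is one identity.  Since |K| = (q + 1)^2, the
    numbers by which the solids through a plane exceed q + 1 points of K add up
    to q times the number of points of K in the plane ([excess_sum]).
    Sections without lines have excess 0, so K contains a line; a study of the
    planes through a line of K shows that its lines are not pairwise skew
    ([skew_contradiction]).  Take two lines a and b of K that meet.  Their plane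
    contains no further point of K, every line of K meets a or b
    ([pair_dominates]), and no three lines of K are concurrent
    ([no_concurrent]).  It follows that one line of K, the directrix, meets all
    others, and that these, the generators, are pairwise skew
    ([exists_directrix], [gen_skew]).

    A solid through a generator but not through the directrix must cut out a
    conic, which has exactly one point on each generator and whose plane is skew
    to the directrix ([l_skew], [gens_bijection]).  Two such conics with a common
    point give the projectivity: the generators project the plane of the first
    conic along that of the second linearly onto the directrix, and the common
    point lowers the degree of the induced map of the conic from 2 to 1.

    Let E = F(w) be the quadratic extension and write t = a + b w, with conjugate
    t'.  The coordinates (s t, r t^2, r t t') identify the 4-space with the vectors
    of E^3 with last coordinate in F, and the E-points of the line at infinity
    form a regular spread; this is the Bruck-Bose representation
    ([spread_regular], [bb_iso]).  Dividing by t, one sees that K corresponds to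
    the Baer subplane of all (s, u, u') with s in F and u in E, which has only the
    point (1, 0, 0), that is the directrix, at infinity ([bb_set_baer]). *)

(** * Points of a subspace and normal rational curves *)

(** The cardinal of F under one fixed name: #|F| has several convertible forms
    that linear arithmetic would treat as different unknowns. *)
Definition field_order (F : finFieldType) : nat := #|F|.

Section Points.

Variables (F : finFieldType) (V : vectType F).
Implicit Types (U W L P : {vspace V}) (v w : V).

Lemma pointP P : \dim P = 1%N -> exists2 v, v != 0 & P = <[v]>%VS.
Proof.
move=> dimP; exists (vpick P); first by rewrite vpick0 -dimv_eq0 dimP.
by apply/esym/eqP; rewrite eqEdim -memvE memv_pick dimP dim_vline vpick0
  -dimv_eq0 dimP.
Qed.

Lemma in_points U P : P \in points_of U -> [/\ \dim P = 1%N & (P <= U)%VS].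
Proof. by rewrite inE => /andP[/eqP]. Qed.

Lemma points_pick U P : P \in points_of U -> exists v,
  [/\ v != 0, P = <[v]>%VS & v \in U].
Proof.
case/in_points => /pointP[v v0 ->] vU; exists v; split=> //.
Qed.

Lemma line_in_points v U : v != 0 -> (<[v]>%VS \in points_of U) = (v \in U).
Proof. by move=> v0; rewrite inE dim_vline v0. Qed.

Lemma points_cap U W : points_of (U :&: W)%VS = points_of U :&: points_of W.
Proof. by apply/setP=> P; rewrite !inE subv_cap; case: (\dim P == _). Qed.

Lemma points_sub U W : (points_of U \subset points_of W) = (U <= W)%VS.
Proof.
apply/subsetP/idP=> [sUW | sUW P].
  apply/subvP=> v vU; have [-> | v0] := eqVneq v 0; first exact: mem0v.
  by rewrite -(line_in_points _ v0) sUW // line_in_points.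
by case/in_points=> dP PU; rewrite inE dP eqxx (subv_trans PU).
Qed.

Lemma points0 : points_of (0 : {vspace V})%VS = set0.
Proof.
apply/setP=> P; rewrite !inE subv0; apply/negP => /andP[/eqP dP /eqP P0].
by move: dP; rewrite P0 dimv0.
Qed.

Lemma points1 P : \dim P = 1%N -> points_of P = [set P].
Proof.
move=> dP; apply/setP=> Q; rewrite !inE; apply/andP/eqP=> [[/eqP dQ QP] | ->].
  by apply/eqP; rewrite eqEdim QP dP dQ.
by rewrite dP.
Qed.

Lemma memv_line_sym v w : w != 0 -> w \in <[v]>%VS -> <[w]>%VS = <[v]>%VS.
Proof.
move=> w0 wv; apply/eqP; rewrite eqEdim -memvE wv !dim_vline w0.
by case: (v != 0).
Qed.

(** The projective line over F is represented by [option F], with [None] as the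
    point at infinity.  The images of this parametrisation for n = 1, 2, 3 are
    the lines, the conics and the twisted cubics. *)
Definition moment n (t : option F) : 'rV[F]_n.+1 :=
  if t is Some a then \row_i a ^+ i else delta_mx 0 ord_max.

Definition rncurve n (f : 'Hom('rV[F]_n.+1, V)) : {set {vspace V}} :=
  [set <[f (moment n t)]>%VS | t : option F].

Lemma moment_neq0 n t : moment n t != 0.
Proof.
apply/negP=> /eqP/rowP; case: t => [a|] /= m0.
  by have /eqP := m0 ord0; rewrite !mxE expr0 oner_eq0.
by have /eqP := m0 ord_max; rewrite !mxE !eqxx oner_eq0.
Qed.

(** All finite parameters give vectors with first coordinate 1, so two of them
    are proportional only if they are equal, and then the second coordinates
    are the parameters. *)
Lemma moment_line_inj n (f : 'Hom('rV[F]_n.+2, V)) : lker f = 0%VS ->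
  injective (fun t => <[f (moment n.+1 t)]>%VS).
Proof.
move=> kf s t eqst; have injf: injective f by apply/lker0P/eqP.
have /vlineP[k] : f (moment n.+1 s) \in <[f (moment n.+1 t)]>%VS
  by rewrite -eqst memv_line.
rewrite -linearZ => /injf /rowP {eqst}eqst.
have nz: moment n.+1 s != 0 by apply: moment_neq0.
case: s t eqst nz => [a|] [b|] eqst nz //.
- have := eqst 0; have := eqst (inord 1);
  rewrite !mxE /= !inordK // !expr1 !expr0 mulr1.
  by move=> -> <-; rewrite mul1r.
- have := eqst 0; rewrite !mxE /= expr0 => /eqP.
  by rewrite mulr0 oner_eq0.
- have /esym := eqst 0; rewrite !mxE /= expr0 mulr1 => k0.
  by case/negP: nz; apply/eqP/rowP=> i; rewrite eqst k0 !mxE mul0r.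
Qed.

Lemma moment_img_neq0 n (f : 'Hom('rV[F]_n.+1, V)) t : lker f = 0%VS ->
  f (moment n t) != 0.
Proof.
move=> kf; have injf: injective f by apply/lker0P/eqP.
by rewrite -(linear0 f) (inj_eq injf) moment_neq0.
Qed.

Lemma card_rncurve n (f : 'Hom('rV[F]_n.+2, V)) : lker f = 0%VS ->
  #|rncurve f| = (field_order F).+1.
Proof. by move=> kf; rewrite card_imset ?card_option //;
  apply: moment_line_inj. Qed.

Lemma rncurve_limg n (f : 'Hom('rV[F]_n.+1, V)) : lker f = 0%VS ->
  rncurve f \subset points_of (limg f).
Proof.
move=> kf; apply/subsetP=> P /imsetP[t _ ->].
by rewrite line_in_points ?memv_img ?memvf // moment_img_neq0.
Qed.

(** Project along U onto a complement and take a nonzero coordinate of the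
    image of v. *)
Lemma separating_form U v : v \notin U ->
  exists phi : 'Hom(V, F^o), (forall u, u \in U -> phi u = 0) /\ phi v != 0.
Proof.
move=> vU; set y := v - projv U v.
have y0: y != 0.
  apply: contra vU; rewrite subr_eq0 => /eqP ->; exact: memv_proj.
have yb := coord_vbasis (memvf y).
have [i ci] : exists i, coord (vbasis {:V}) i y != 0.
  apply/existsP; apply: contraNT y0; rewrite negb_exists => /forallP c0.
  rewrite yb big1 // => i _; move: (c0 i); rewrite negbK => /eqP ->;
    exact: scale0r.
exists (linfun (coord (vbasis {:V}) i : V -> F^o) \o (\1 - projv U))%VF.
have phiE x : (linfun (coord (vbasis {:V}) i : V -> F^o) \o (\1 - projv U))%VF x
    = coord (vbasis {:V}) i (x - projv U x).
  by rewrite comp_lfunE lfunE /= !lfun_simp.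
split=> [u uU|]; rewrite phiE //.
by rewrite projv_id // subrr linear0.
Qed.

(** A linear form that vanishes on U but not on the span of the curve becomes,
    along the parametrisation, a nonzero polynomial of degree at most n whose
    roots are the finite parameters of the common points; if the point at
    infinity is common too, the leading coefficient vanishes and the degree
    drops by one.  This is the only property of conics and twisted cubics that
    limits their intersections with lines and planes. *)
Lemma card_rncurve_cap n (f : 'Hom('rV[F]_n.+1, V)) U :
  lker f = 0%VS -> ~~ (limg f <= U)%VS ->
  (#|rncurve f :&: points_of U| <= n)%N.
Proof.
move=> kf /subvPn[v /memv_imgP[x _ ->] fxU].
have [phi [phiU phix]] := separating_form fxU.
pose c i := phi (f (delta_mx 0 i)).
have phif y : phi (f y) = \sum_(i < n.+1) y 0 i * c i.
  by rewrite {1}(row_sum_delta y) !linear_sum; apply: eq_bigr => i _;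
    rewrite !linearZ.
pose p := \poly_(i < n.+1) c (inord i).
have pE a : phi (f (moment n (Some a))) = p.[a].
  rewrite phif horner_poly; apply: eq_bigr => i _.
  by rewrite mxE inord_val mulrC.
have p0 : p != 0.
  apply: contra phix => /eqP p0; rewrite phif big1 // => i _.
  have := coef_poly n.+1 (fun i => c (inord i)) i;
    rewrite -/p p0 coef0 ltn_ord inord_val.
  by move=> <-; rewrite mulr0.
have pinf : phi (f (moment n None)) = p`_n.
  rewrite coef_poly ltnSn /c /=; congr (phi (f (delta_mx _ _))).
  by apply: val_inj; rewrite /= inordK.
pose S := [set t : option F | f (moment n t) \in U].
have leS : (#|rncurve f :&: points_of U| <= #|S|)%N.
  apply: leq_trans (leq_imset_card (fun t => <[f (moment n t)]>%VS) S).
  apply/subset_leq_card/subsetP=> P /setIP[/imsetP[t _ ->]].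
  rewrite line_in_points ?moment_img_neq0 // => tU.
  by apply: imset_f; rewrite inE.
apply: leq_trans leS _.
pose s := [seq a <- enum F | Some a \in S].
have rs : all (root p) s.
  apply/allP=> a; rewrite mem_filter inE => /andP[aU _].
  by rewrite /root -pE phiU.
have us : uniq s by rewrite filter_uniq ?enum_uniq.
have szs := max_poly_roots p0 rs us.
have cS : (#|S :\ None| <= size s)%N.
  rewrite -(card_uniqP us); apply: leq_trans (leq_imset_card Some (mem s)).
  apply/subset_leq_card/subsetP=> -[a|]; rewrite !inE //= => aS.
  by apply: imset_f; rewrite [_ \in _]mem_filter inE aS mem_enum.
rewrite (cardsD1 None); case: (boolP (None \in S)) => [NS | _].
  rewrite add1n; apply: leq_ltn_trans cS (leq_trans szs _).
  apply/leq_sizeP=> j; rewrite leq_eqVlt => /orP[/eqP<- | nj].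
    by rewrite -pinf phiU //; move: NS; rewrite /S in_set.
  by rewrite coef_poly ltnNge nj.
rewrite add0n -ltnS; apply: leq_ltn_trans cS (leq_trans szs _).
exact: size_poly.
Qed.

Definition lincomb n (X : n.-tuple V) (x : 'rV[F]_n) : V :=
  \sum_i x 0 i *: X`_i.

Lemma lincomb_is_linear n (X : n.-tuple V) : linear (lincomb X).
Proof.
move=> a x y; rewrite /lincomb scaler_sumr -big_split /=.
by apply: eq_bigr => i _; rewrite !mxE scalerDl scalerA.
Qed.

HB.instance Definition _ n (X : n.-tuple V) :=
  GRing.isLinear.Build F 'rV[F]_n V _ (lincomb X) (lincomb_is_linear X).

Lemma lincomb_lker n (X : n.-tuple V) : free X ->
  lker (linfun (lincomb X)) = 0%VS.
Proof.
move=> freeX; apply/eqP; rewrite -subv0; apply/subvP=> x.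
rewrite memv_ker lfunE memv0 => /eqP x0; apply/eqP/rowP=> i.
by rewrite mxE; move/freeP: freeX => /(_ (fun i => x 0 i)); apply.
Qed.

Lemma lincomb_limg n (X : n.-tuple V) : limg (linfun (lincomb X)) = <<X>>%VS.
Proof.
apply/eqP; rewrite eqEsubv; apply/andP; split; apply/subvP=> v.
  case/memv_imgP=> x _ ->; rewrite lfunE; apply: memv_suml => i _.
  by rewrite memvZ // memv_span // mem_nth ?size_tuple.
move=> /coord_span ->; apply/memv_imgP; exists (\row_i coord X i v);
  rewrite ?memvf //.
by rewrite lfunE; apply: eq_bigr => i _; rewrite mxE.
Qed.

Lemma line_moment (f : 'Hom('rV[F]_2, V)) (x : 'rV[F]_2) : x != 0 ->
  exists t, <[f x]>%VS = <[f (moment 1 t)]>%VS.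
Proof.
move=> x0.
suff [t [k k0 ->]] : exists t, exists2 k, k != 0 & x = k *: moment 1 t.
  by exists t; rewrite linearZ; apply/eqP;
    rewrite eqEsubv -!memvE memvZ ?memv_line // -[X in X \in _](scalerK k0)
    memvZ ?memv_line.
have [a0 | a0] := eqVneq (x 0 0) 0.
  exists None; exists (x 0 1).
    apply: contra x0 => /eqP b0; apply/eqP/rowP=> i; rewrite !mxE.
    by case: (unliftP 0 i) => [j|] ->; rewrite ?ord1 // -[RHS]b0; congr (x 0 _);
      apply: val_inj.
  apply/rowP=> i; rewrite !mxE /=.
  case: (unliftP 0 i) => [j|] ->; rewrite ?ord1 /= ?mulr1 ?mulr0 //.
  by congr (x 0 _); apply: val_inj.
exists (Some (x 0 1 / x 0 0)); exists (x 0 0) => //.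
apply/rowP=> i; rewrite !mxE /=.
case: (unliftP 0 i) => [j|] ->; rewrite ?ord1 /= ?expr0 ?expr1 ?mulr1 //.
by rewrite mulrC divfK //; congr (x 0 _); apply: val_inj.
Qed.

(** A line is the normal rational curve of degree 1 on any basis of it. *)
Lemma card_points2 L : \dim L = 2%N -> #|points_of L| = (field_order F).+1.
Proof.
move=> dL.
have [X freeX spanX] : exists2 X : 2.-tuple V, free X & <<X>>%VS = L.
  move: (vbasis L) (vbasisP L); rewrite dL => X XL; exists X.
    exact: basis_free XL.
  exact: span_basis XL.
rewrite -(card_rncurve (lincomb_lker freeX)); congr #|pred_of_set _|.
apply/eqP; rewrite eqEsubset -spanX -lincomb_limg rncurve_limg ?lincomb_lker //
  andbT.
apply/subsetP=> P /points_pick[v [v0 -> /memv_imgP[x _ vx]]].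
have /line_moment-/(_ (linfun (lincomb X)))[t xt] : x != 0.
  by apply: contraNneq v0 => x0; rewrite vx x0 linear0.
by rewrite vx xt; apply: imset_f.
Qed.

Lemma line_capP L U : \dim L = 2%N -> ~~ (L <= U)%VS -> (\dim (L :&: U) <= 1)%N.
Proof.
move=> dL LU; rewrite -ltnS -dL ltn_neqAle dimvS ?capvSl // andbT.
apply: contra LU => /eqP d; apply/capv_idPl/eqP;
  by rewrite eqEdim capvSl d leqnn.
Qed.

Lemma card_points_le1 U : (\dim U <= 1)%N -> (#|points_of U| <= 1)%N.
Proof.
rewrite leq_eqVlt => /orP[/eqP dU | ]; first by rewrite points1 // cards1.
by rewrite ltnS leqn0 dimv_eq0 => /eqP ->; rewrite points0 cards0.
Qed.

Lemma card_line_cap L U : \dim L = 2%N -> ~~ (L <= U)%VS ->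
  (#|points_of L :&: points_of U| <= 1)%N.
Proof. by move=> dL LU; rewrite -points_cap card_points_le1 // line_capP. Qed.

Lemma capv_point U P : \dim P = 1%N -> ~~ (P <= U)%VS -> (P :&: U = 0)%VS.
Proof.
move=> dP PU; apply/eqP; rewrite -dimv_eq0 -leqn0 -ltnS -dP ltn_neqAle dimvS
  ?capvSl // andbT.
apply: contra PU => /eqP d; apply/capv_idPl/eqP;
  by rewrite eqEdim capvSl d leqnn.
Qed.

End Points.

(** * Nondegenerate conics are normal rational curves *)

Section Conic.

Variables (F : finFieldType) (V : vectType F).

Implicit Types (B : 'M[F]_3) (x y z : 'rV[F]_3).

Definition bform (B : 'M[F]_3) (x y : 'rV[F]_3) : F := (x *m B *m y^T) 0 0.

Lemma bformDl B x y z : bform B (x + y) z = bform B x z + bform B y z.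
Proof. by rewrite /bform !mulmxDl mxE. Qed.

Lemma bformDr B x y z : bform B x (y + z) = bform B x y + bform B x z.
Proof. by rewrite /bform linearD mulmxDr mxE. Qed.

Lemma bformZl B k x z : bform B (k *: x) z = k * bform B x z.
Proof. by rewrite /bform -!scalemxAl mxE. Qed.

Lemma bformZr B k x z : bform B x (k *: z) = k * bform B x z.
Proof. by rewrite /bform linearZ -scalemxAr mxE. Qed.

Lemma polar_bform B x y : polar_form B x y = bform B x y + bform B y x.
Proof.
rewrite /polar_form /qform -!/(bform _ _ _) bformDl !bformDr.
ring.
Qed.

Lemma qform_bform B x : qform B x = bform B x x. Proof. by []. Qed.

Lemma qform_comb B (a b c : F) x y z :
  qform B (a *: x + b *: y + c *: z) =
  a ^+ 2 * qform B x + b ^+ 2 * qform B y + c ^+ 2 * qform B z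
  + a * b * polar_form B x y + a * c * polar_form B x z + b * c * polar_form B y
    z.
Proof.
rewrite !polar_bform !qform_bform !(bformDl, bformDr, bformZl, bformZr).
ring.
Qed.

Lemma qformZ B k x : qform B (k *: x) = k ^+ 2 * qform B x.
Proof. by rewrite !qform_bform bformZl bformZr; ring. Qed.

Lemma polarD B x y z : polar_form B x (y + z) = polar_form B x y + polar_form B
  x z.
Proof. rewrite !polar_bform bformDl bformDr; ring. Qed.

Lemma polarZ B x k z : polar_form B x (k *: z) = k * polar_form B x z.
Proof. rewrite !polar_bform bformZl bformZr; ring. Qed.

Lemma polarC B x y : polar_form B x y = polar_form B y x.
Proof. by rewrite !polar_bform addrC. Qed.

Lemma polarxx B x : polar_form B x x = qform B x *+ 2.
Proof. by rewrite polar_bform. Qed.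

(** A singular vector v0 is not in the radical of the polar form, hence has a
    partner w1, which can be made singular by adding a multiple of v0.  The
    vector w2 is orthogonal to both for the polar form; were it singular, it
    would contradict nondegeneracy.  No division by 2 occurs, so the normal form
    x z + d y^2 is reached in every characteristic. *)
Lemma hyperbolic_basis B v0 : nondegenerate_qform B -> v0 != 0 ->
  qform B v0 = 0 ->
  exists w1 w2 : 'rV[F]_3, [/\ free [:: w1; w2; v0], qform B w2 != 0 &
   forall a b c, qform B (a *: w1 + b *: w2 + c *: v0) = a * c + b ^+ 2 * qform
     B w2].
Proof.
move=> ndB v00 q0.
have [w pw] : exists w, polar_form B v0 w != 0.
  apply/existsP; apply: contraNT v00; rewrite negb_exists => /forallP p0.
  by apply/eqP/ndB => // x; apply/eqP; rewrite -[_ == _]negbK.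
pose w' := (polar_form B v0 w)^-1 *: w.
have pw' : polar_form B v0 w' = 1 by rewrite polarZ mulVf.
pose w1 := w' + (- qform B w') *: v0.
have p1 : polar_form B v0 w1 = 1.
  by rewrite polarD pw' polarZ polarxx q0 mul0rn mulr0 addr0.
have q1 : qform B w1 = 0.
  have := qform_comb B 1 (- qform B w') 0 w' v0 0.
  rewrite scale1r scaler0 addr0 -/w1 => ->;
    rewrite q0 [polar_form _ w' _]polarC pw'.
  ring.
clearbody w1; have [u uS] : exists u, u \notin <<[:: w1; v0]>>%VS.
  have /subvPn[u _ ?] : ~~ ({: 'rV[F]_3} <= <<[:: w1; v0]>>)%VS; last
    by exists u.
  apply/negP=> /dimvS; rewrite dimvf dim_matrix leqNgt => /negP; apply.
  by rewrite ltnS dim_span.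
pose w2 := u + (- polar_form B u w1) *: v0 + (- polar_form B u v0) *: w1.
have w2S : w2 \notin <<[:: w1; v0]>>%VS.
  have v0S : v0 \in <<[:: w1; v0]>>%VS by rewrite memv_span // !inE eqxx orbT.
  have w1S : w1 \in <<[:: w1; v0]>>%VS by rewrite memv_span // !inE eqxx.
  by rewrite /w2 rpredDr ?rpredDr // memvZ.
have p20 : polar_form B v0 w2 = 0.
  rewrite /w2 !(polarD, polarZ) polarxx q0 p1 [polar_form B v0 u]polarC.
  ring.
have p21 : polar_form B w1 w2 = 0.
  rewrite /w2 !(polarD, polarZ) polarxx q1 [polar_form B w1 v0]polarC p1
    [polar_form B w1 u]polarC.
  ring.
clearbody w2; have fr : free [:: w1; w2; v0].
  have /perm_free-> : perm_eq [:: w1; w2; v0] [:: w2; w1; v0].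
    by rewrite (perm_catCA [:: w1] [:: w2]).
  rewrite free_cons w2S free_cons seq1_free v00 andbT span_seq1.
  apply/negP=> /vlineP[k w1k]; move/eqP: p1;
    rewrite w1k polarZ polarxx q0 mul0rn mulr0.
  by rewrite eq_sym oner_eq0.
have qE a b c : qform B (a *: w1 + b *: w2 + c *: v0) = a * c + b ^+ 2 * qform B
  w2.
  rewrite qform_comb q1 q0 p21 [polar_form B w1 v0]polarC p1 [polar_form B w2
    v0]polarC p20.
  ring.
exists w1, w2; split=> //.
apply/negP=> /eqP q2; case/negP: w2S.
suff -> : w2 = 0 by rewrite mem0v.
apply: ndB => // x.
have /eqP fullS : <<[:: w1; w2; v0]>>%VS == fullv.
  rewrite eqEdim subvf dimvf dim_matrix.
  by move: fr; rewrite /free => /eqP ->.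
have xS : x \in <<[tuple w1; w2; v0]>>%VS by rewrite fullS memvf.
rewrite (coord_span xS) !big_ord_recl big_ord0 /= addr0 !(polarD,
  polarZ) polarxx q2.
rewrite [polar_form B w2 w1]polarC p21 [polar_form B w2 v0]polarC p20.
by rewrite mul0rn !mulr0 !addr0.
Qed.

(** In the coordinates of the previous lemma the conic x z + d y^2 = 0 is
    { w1 + t w2 - d t^2 v0 } together with v0.  That any point P of the conic
    can play the role of the point at infinity is what makes the normal form of
    the cubic surface accessible later. *)
Lemma conic_rncurve (C : {set {vspace V}}) P : is_nondegenerate_conic C ->
  P \in C ->
  exists g : 'Hom('rV[F]_3, V), [/\ lker g = 0%VS, C = rncurve g &
    P = <[g (moment 2 None)]>%VS].
Proof.
case=> f [B [kf ndB ->]] /imsetP[v0]; rewrite inE => /andP[v00 /eqP q0] ->.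
have [w1 [w2 [fr d0 qE]]] := hyperbolic_basis ndB v00 q0.
set d := qform B w2 in d0 qE.
have md0 : - d != 0 by rewrite oppr_eq0.
have injf : injective f by apply/lker0P/eqP.
have full3 (X : 3.-tuple 'rV[F]_3) : free X -> <<X>>%VS = fullv.
  move=> /eqP fX; apply/eqP; rewrite eqEdim subvf dimvf dim_matrix.
  by rewrite fX size_tuple.
have fr' : free [tuple w1; w2; - d *: v0].
  apply/freeP=> k; rewrite !big_ord_recl big_ord0 /= addr0 => k0.
  move/(@freeP _ _ _ [tuple w1; w2; v0])/(_ (fun i =>
    if i == ord_max then - d * k i else k i)): fr.
  rewrite !big_ord_recl big_ord0 /= addr0 -k0 => fr i.
  have /fr {}fr : k ord0 *: w1 + (k (lift ord0 ord0) *: w2 + (- d * k (lift ord0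
    (lift ord0 ord0))) *: v0)
    = k ord0 *: w1 + (k (lift ord0 ord0) *: w2 + k (lift ord0 (lift ord0 ord0))
      *: (- d *: v0)).
    by rewrite scalerA [k _ * - d]mulrC.
  have := fr i; case: ifP => // _ /eqP.
  by rewrite mulf_eq0 (negPf md0) => /eqP.
pose h := linfun (lincomb [tuple w1; w2; - d *: v0]).
have hE x : h x = x 0 0 *: w1 + x 0 1 *: w2 + (- d * x 0 ord_max) *: v0.
  rewrite lfunE /= /lincomb !big_ord_recl big_ord0 /= addr0 addrA scalerA [_ * -
    d]mulrC.
  by congr (x 0 _ *: _ + x 0 _ *: _ + (_ * x 0 _) *: _); apply: val_inj.
have kfh : lker (f \o h) = 0%VS.
  have injh : injective h by apply/lker0P/eqP/lincomb_lker.
  by apply/eqP/lker0P=> x y; rewrite !comp_lfunE => /injf/injh.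
have hS a : h (moment 2 (Some a)) = 1 *: w1 + a *: w2 + (- d * a ^+ 2) *: v0.
  by rewrite hE !mxE /= expr0 expr1.
have hN : h (moment 2 None) = - d *: v0.
  by rewrite hE !mxE /= !scale0r !add0r mulr1.
have line_eq (x y : 'rV[F]_3) k : k != 0 -> x = k *: y ->
  <[f x]>%VS = <[f y]>%VS.
  move=> k0 ->; rewrite linearZ; apply/eqP;
    rewrite eqEsubv -!memvE memvZ ?memv_line //.
  by rewrite -[X in X \in _](scalerK k0) memvZ ?memv_line.
exists (f \o h)%VF; split=> //; last first.
  by rewrite comp_lfunE hN; apply/esym/(line_eq _ _ (- d)).
apply/setP=> Q; apply/imsetP/imsetP=> [[x] | [[a|] _ ->]].
- rewrite inE => /andP[x0 /eqP qx] ->.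
  have xS : x \in <<[tuple w1; w2; v0]>>%VS by rewrite full3 ?memvf.
  move: (coord_span xS) qx; rewrite !big_ord_recl big_ord0 /= addr0 addrA.
  set a := coord _ _ _; set b := coord _ _ _; set c := coord _ _ _.
  move=> xE; rewrite xE qE => qx; clearbody a b c.
  have [a0 | a0] := eqVneq a 0.
    move: qx; rewrite a0 mul0r add0r => /eqP;
      rewrite mulf_eq0 (negPf d0) orbF sqrf_eq0 => /eqP b0.
    have c0 : c != 0 by apply: contraNneq x0 => c0;
      rewrite xE a0 b0 c0 !scale0r !addr0.
    exists None => //; rewrite comp_lfunE hN.
    apply: (line_eq _ _ (c / - d)); first by rewrite mulf_neq0 ?invr_eq0.
    by rewrite scalerA divfK // b0 !scale0r !add0r.
  exists (Some (b / a)) => //; rewrite comp_lfunE hS.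
  apply: (line_eq _ _ a) => //; rewrite !scalerDr !scalerA.
  have -> : c = - (b ^+ 2 * d) / a by apply/(mulIf a0); rewrite divfK // mulrC;
    apply/eqP; rewrite -addr_eq0 qx.
  congr (_ *: _ + _ *: _ + _ *: _); field => //.
- exists (h (moment 2 (Some a))); last by rewrite comp_lfunE.
  rewrite inE hS qE -/d -hS.
  have injh : injective h by apply/lker0P/eqP/lincomb_lker.
  rewrite -(linear0 h) (inj_eq injh) moment_neq0 /=; apply/eqP; ring.
exists (h (moment 2 None)); last by rewrite comp_lfunE.
have injh : injective h by apply/lker0P/eqP/lincomb_lker.
by rewrite inE hN qformZ q0 mulr0 eqxx -hN -(linear0 h) (inj_eq injh)
  moment_neq0.
Qed.

End Conic.

(** * The pencil of subspaces through a given one *)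

Section Pencil.

Variables (F : finFieldType) (V : vectType F).
Implicit Types (U W L P H : {vspace V}) (v w : V) (A : {set {vspace V}}).

Lemma dim_addv_line U v : v \notin U -> \dim (U + <[v]>)%VS = (\dim U).+1.
Proof.
move=> vU; rewrite dimv_disjoint_sum ?dim_vline.
  suff -> : v != 0 by rewrite addn1.
  by apply: contraNneq vU => ->; rewrite mem0v.
apply/eqP; rewrite -subv0; apply/subvP=> x; rewrite memv_cap memv0 =>
  /andP[xU /vlineP[k xk]].
have [k0 | k0] := eqVneq k 0; first by rewrite xk k0 scale0r.
by case/negP: vU; rewrite -(scalerK k0 v) -xk memvZ.
Qed.

Lemma dim_addv_point U P : \dim P = 1%N -> ~~ (P <= U)%VS ->
  \dim (U + P)%VS = (\dim U).+1.
Proof. by case/pointP=> v v0 ->; rewrite -memvE; apply: dim_addv_line. Qed.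

Definition pencil U : {set {vspace V}} :=
  [set H : {vspace V} | (\dim H == (\dim U).+1) && (U <= H)%VS].

Lemma pencilP U H : reflect (\dim H = (\dim U).+1 /\
  (U <= H)%VS) (H \in pencil U).
Proof. by rewrite inE; apply: (iffP andP) => -[/eqP ? ?]. Qed.

Lemma pencil_add U P : \dim P = 1%N -> ~~ (P <= U)%VS ->
  (U + P)%VS \in pencil U.
Proof. by move=> dP PU; apply/pencilP; rewrite dim_addv_point ?addvSl. Qed.

Lemma pencil_eq U H P : H \in pencil U -> \dim P = 1%N -> (P <= H)%VS ->
  ~~ (P <= U)%VS ->
  (U + P)%VS = H.
Proof.
case/pencilP=> dH UH dP PH PU; apply/eqP.
by rewrite eqEdim subv_add UH PH dH dim_addv_point /=.
Qed.

Lemma card_pencil U : \dim {:V} = (\dim U + 2)%N ->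
  #|pencil U| = (field_order F).+1.
Proof.
move=> dV; have dC : \dim U^C = 2%N by rewrite dimv_compl dV addKn.
have PE P : P \in points_of U^C -> P = ((U + P) :&: U^C)%VS.
  by case/in_points=> _ PU; rewrite addvC -vspace_modl // capv_compl addv0.
rewrite -(card_points2 dC) -(card_in_imset (f := fun P => (U + P)%VS) (D :=
  points_of U^C)); last first.
  move=> P Q PC QC eqPQ.
  by have := PE _ PC; rewrite eqPQ -(PE _ QC).
apply: eq_card => H; apply/idP/imsetP; last first.
  case=> P PC ->; have [dP PU] := in_points PC; apply: pencil_add => //.
  apply/negP=> PU'; have : (P <= U :&: U^C)%VS by rewrite subv_cap PU' PU.
  by rewrite capv_compl subv0 -dimv_eq0 dP.
case/pencilP=> dH UH.
have HE : (U + (U^C :&: H))%VS = H by rewrite vspace_modl // addv_complf capfv.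
exists (U^C :&: H)%VS => //; rewrite inE capvSl andbT.
have dd : (\dim U + \dim (U^C :&: H))%N = (\dim U).+1.
  rewrite -dH -[in RHS]HE dimv_disjoint_sum //.
  by apply/eqP; rewrite capvA capv_compl cap0v.
by rewrite -(eqn_add2l (\dim U)) dd addn1.
Qed.

(** Each point outside U lies in exactly one member of the pencil, namely its
    join with U. *)
Lemma pencil_count U A : A \subset points_of fullv ->
  #|A| = (#|A :&: points_of U| +
    \sum_(H in pencil U) #|(A :&: points_of H) :\: points_of U|)%N.
Proof.
move=> sA; rewrite -(cardsID (points_of U) A); congr addn.
rewrite -sum1_card (partition_big (fun P => (U + P)%VS) (mem (pencil U))) /=;
  last first.
  move=> P /setDP[/(subsetP sA)/in_points[dP _]]; rewrite inE dP eqxx => PU.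
  exact: pencil_add.
apply: eq_bigr => H HU; rewrite sum1dep_card; apply: eq_card => P.
rewrite !inE; case: (boolP (P \in A)) => [PA | ]; last by rewrite !andbF.
have [dP _] := in_points (subsetP sA _ PA); rewrite dP /= !andbT.
apply/andP/andP=> -[PU]; first by move/eqP <-; rewrite PU addvSr.
by move=> PH; rewrite PU (pencil_eq HU).
Qed.

End Pencil.

(** * Sections of the point set by solids *)

Section SolidSections.

Variables (F : finFieldType) (V : vectType F) (K : {set {vspace V}}).
Implicit Types (U W L M N P Q H pi : {vspace V}).
Local Notation q := (field_order F).

Hypothesis q_gt2 : (2 < q)%N.
Hypothesis dimV : \dim {:V} = 5%N.
Hypothesis K_points : K \subset points_of fullv.
Hypothesis cardK : #|K| = (q.+1 ^ 2)%N.
Hypothesis solid_sections : forall Pi : {vspace V}, \dim Pi = 4%N ->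
       is_line (points_of Pi :&: K) \/
       is_two_lines (points_of Pi :&: K) \/
       is_three_lines (points_of Pi :&: K) \/
       is_line_and_conic (points_of Pi :&: K) \/
       is_twisted_cubic Pi (points_of Pi :&: K).

Definition Kline L := (\dim L == 2%N) && (points_of L \subset K).
Definition Ksize U := #|K :&: points_of U|.

Lemma KlineP L : reflect (\dim L = 2%N /\ points_of L \subset K) (Kline L).
Proof. by apply: (iffP andP) => -[/eqP ? ?]. Qed.

Lemma Kline_dim L : Kline L -> \dim L = 2%N.
Proof. by case/KlineP. Qed.

Lemma Kline_sub L P : Kline L -> P \in points_of L -> P \in K.
Proof. by case/KlineP=> _ /subsetP; apply. Qed.

Lemma Kdim P : P \in K -> \dim P = 1%N.
Proof. by move=> PK; case: (in_points (subsetP K_points _ PK)). Qed.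

Lemma point_in P U : P \in K -> (P \in points_of U) = (P <= U)%VS.
Proof. by move=> PK; rewrite inE Kdim. Qed.

Lemma line_eq L M : \dim L = 2%N -> \dim M = 2%N -> (L <= M)%VS -> L = M.
Proof. by move=> dL dM LM; apply/eqP; rewrite eqEdim LM dL dM. Qed.

Lemma card_lines_cap L M : \dim L = 2%N -> \dim M = 2%N -> L != M ->
  (#|points_of L :&: points_of M| <= 1)%N.
Proof.
move=> dL dM LM; apply: card_line_cap => //; apply: contra LM => LM.
by apply/eqP/line_eq.
Qed.

Lemma card_cover2 (T : finType) (A B1 B2 : {set T}) : A \subset B1 :|: B2 ->
  (#|A| <= #|A :&: B1| + #|A :&: B2|)%N.
Proof.
move/setIidPl=> AB; rewrite -{1}AB setIUr; exact: leq_card_setU.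
Qed.

Lemma card_cover3 (T : finType) (A B1 B2 B3 : {set T}) :
  A \subset B1 :|: B2 :|: B3 ->
  (#|A| <= #|A :&: B1| + #|A :&: B2| + #|A :&: B3|)%N.
Proof.
move/card_cover2=> le; apply: leq_trans le _; rewrite leq_add2r setIUr.
exact: leq_card_setU.
Qed.

(** A line has at least four points, and three other lines cover at most three
    of them. *)
Lemma line_in_union L M N O : \dim L = 2%N -> \dim M = 2%N -> \dim N = 2%N ->
  \dim O = 2%N ->
  points_of L \subset points_of M :|: points_of N :|: points_of O ->
  [|| L == M, L == N | L == O].
Proof.
move=> dL dM dN dO /card_cover3; rewrite card_points2 //.
apply: contraTT; rewrite !negb_or => /and3P[LM LN LO]; rewrite -ltnNge ltnS.
have := card_lines_cap dL dM LM; have := card_lines_cap dL dN LN.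
have := card_lines_cap dL dO LO; lia.
Qed.

Lemma limg_dim n (f : 'Hom('rV[F]_n, V)) : lker f = 0%VS -> \dim (limg f) = n.
Proof. by move=> kf; rewrite limg_dim_eq ?kf ?capv0 // dimvf dim_matrix;
  exact: mul1n. Qed.

Lemma card_conic_line (g : 'Hom('rV[F]_3, V)) L : lker g = 0%VS ->
  \dim L = 2%N ->
  (#|rncurve g :&: points_of L| <= 2)%N.
Proof.
move=> kg dL; apply: card_rncurve_cap => //; apply/negP=> /dimvS.
by rewrite limg_dim // dL.
Qed.

(** Otherwise M and the conic cover at most 1 + 2 points of L, which has at least
    four. *)
Lemma line_in_conic (g : 'Hom('rV[F]_3, V)) L M : lker g = 0%VS ->
  \dim L = 2%N -> \dim M = 2%N ->
  points_of L \subset points_of M :|: rncurve g -> L = M.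
Proof.
move=> kg dL dM /card_cover2 le; apply/eqP; apply: contraTT le => LM.
rewrite -ltnNge card_points2 // ltnS setIC [points_of L :&: rncurve _]setIC.
have := card_conic_line kg dL; have := card_lines_cap dM dL; rewrite eq_sym =>
  /(_ LM); lia.
Qed.

Lemma twisted_rncurve H A : is_twisted_cubic H A ->
  exists f : 'Hom('rV[F]_4, V), [/\ lker f = 0%VS, limg f = H & A = rncurve f].
Proof.
case=> f [kf lf ->]; exists f; split=> //.
apply/setP=> P; apply/setUP/imsetP=>
  [[/imsetP[t _ ->] | /set1P ->] | [[t|] _ ->]].
- by exists (Some t).
- by exists None.
- by left; apply: imset_f.
by right; apply/set1P.
Qed.

Lemma line_in_twisted (f : 'Hom('rV[F]_4, V)) L : lker f = 0%VS ->
  \dim L = 2%N ->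
  ~~ (points_of L \subset rncurve f).
Proof.
move=> kf dL; apply/negP=> /setIidPr eqL.
have : (#|rncurve f :&: points_of L| <= 3)%N.
  by apply: card_rncurve_cap => //; apply/negP=> /dimvS; rewrite limg_dim // dL.
by rewrite eqL card_points2 // ltnS leqNgt q_gt2.
Qed.

Inductive section_spec H L : Prop :=
| OneLine of K :&: points_of H = points_of L
| TwoLines M of Kline M & (M <= H)%VS & M != L &
    K :&: points_of H = points_of L :|: points_of M
| ThreeLines M N of Kline M & Kline N & (M <= H)%VS & (N <= H)%VS &
    [/\ M != L, N != L & M != N] &
    K :&: points_of H = points_of L :|: points_of M :|: points_of N
| LineConic (g : 'Hom('rV[F]_3,
  V)) of lker g = 0%VS & is_nondegenerate_conic (rncurve g) &
    K :&: points_of H = points_of L :|: rncurve g.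

Lemma section_line H M : \dim M = 2%N ->
  points_of M \subset K :&: points_of H ->
  Kline M /\ (M <= H)%VS.
Proof. by move=> dM; rewrite subsetI points_sub => /andP[MK ?]; split=> //;
  apply/KlineP. Qed.

(** The first alternative also covers a quadratic form without zeros: the
    conic is then empty and the section is a single line.  A nonempty conic is
    replaced by its parametrisation. *)
Lemma solid_cases H : \dim H = 4%N ->
  (exists L, [/\ Kline L, (L <= H)%VS & section_spec H L]) \/
  exists f : 'Hom('rV[F]_4, V),
    [/\ lker f = 0%VS, limg f = H & K :&: points_of H = rncurve f].
Proof.
move=> dH; have [ | [ | [ | [ | ]]]] := solid_sections dH; rewrite setIC.
- case=> L [dL E]; left; exists L.
  have [] := @section_line H L dL; rewrite ?E // => LK LH; split=> //.
  exact: OneLine.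
- case=> L [M [dL dM LM E]]; left; exists L.
  have [] := @section_line H L dL; rewrite ?E ?subsetUl // => LK LH; split=> //.
  have [] := @section_line H M dM; rewrite ?E ?subsetUr // => MK MH.
  by apply: (TwoLines MK) => //; apply/eqP => ML; apply: LM.
- case=> L [M [N [[dL dM dN] [LM LN MN E]]]]; left; exists L.
  have [] := @section_line H L dL; rewrite ?E -?setUA ?subsetUl // => LK LH;
    split=> //.
  have [] := @section_line H M dM;
    rewrite ?E ?[_ :|: points_of M]setUC -?setUA ?subsetUl // => MK MH.
  have [] := @section_line H N dN; rewrite ?E ?subsetUr // => NK NH.
  apply: (ThreeLines MK NK) => //; split; apply/eqP=> // X;
    [exact: LM | exact: LN].
- case=> L [C [dL ndC E]]; left; exists L.
  have [] := @section_line H L dL; rewrite ?E ?subsetUl // => LK LH; split=> //.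
  have [C0 | [P PC]] := set_0Vmem C.
    by apply: OneLine; rewrite E C0 setU0.
  have [g [kg Cg _]] := conic_rncurve ndC PC.
  by apply: (@LineConic _ _ g) => //; rewrite -Cg.
by move/twisted_rncurve; right.
Qed.

Lemma line_section H L : \dim H = 4%N -> Kline L -> (L <= H)%VS ->
  section_spec H L.
Proof.
move=> dH LK LH; have dL := Kline_dim LK.
have LS : points_of L \subset K :&: points_of H.
  by rewrite subsetI points_sub LH andbT; case/KlineP: LK.
have [[L' [LK' LH' sp]] | [f [kf _ E]]] := solid_cases dH; last first.
  by case/negP: (line_in_twisted kf dL); rewrite -E.
have dL' := Kline_dim LK'.
have [<- // | neL] := eqVneq L' L.
case: sp => [E | M MK MH ML E | M N MK NK MH NH [ML NL MN] E | g kg ndg E].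
- move: LS; rewrite E points_sub => LL'.
  by case/eqP: neL; apply/esym/line_eq.
- have dM := Kline_dim MK.
  move: LS; rewrite E -[X in _ :|: X]setUid setUA => LS.
  have /or3P[] := line_in_union dL dL' dM dM LS => /eqP LE; first
    by rewrite LE eqxx in neL.
    by apply: (TwoLines LK') => //; rewrite E -LE setUC.
  by apply: (TwoLines LK') => //; rewrite E -LE setUC.
- have dM := Kline_dim MK; have dN := Kline_dim NK.
  move: LS; rewrite E => LS.
  have /or3P[] := line_in_union dL dL' dM dN LS => /eqP LE; first
    by rewrite LE eqxx in neL.
    rewrite LE; apply: (ThreeLines LK' NK) => //; first by rewrite LE in neL;
      split; rewrite // eq_sym.
    by rewrite E [_ :|: points_of M]setUC.
  rewrite LE; apply: (ThreeLines LK' MK) => //; first by rewrite LE in neL;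
    split; rewrite // eq_sym.
  by rewrite E setUC setUA.
move: LS; rewrite E => /(line_in_conic kg dL dL') LL'.
by rewrite LL' eqxx in neL.
Qed.

Lemma Ksize_setU U (A B : {set {vspace V}}) : K :&: points_of U = A :|: B ->
  (Ksize U + #|A :&: B| = #|A| + #|B|)%N.
Proof. by rewrite /Ksize => ->; rewrite cardsUI. Qed.

(** The value 2 q comes from a line and a conic with two common points; two or
    three lines have at least 2 q + 1 points. *)
Lemma Ksize_gap H : \dim H = 4%N -> Ksize H = q.+1 \/ (2 * q <= Ksize H)%N.
Proof.
move=> dH; have [[L [LK LH sp]] | [f [kf _ E]]] := solid_cases dH; last first.
  by left; rewrite /Ksize E card_rncurve.
have dL := Kline_dim LK; have cL := card_points2 dL.
have two M : Kline M -> M != L ->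
  points_of L :|: points_of M \subset K :&: points_of H ->
  (2 * q <= Ksize H)%N.
  move=> MK ML /subset_leq_card; apply: leq_trans.
  have dM := Kline_dim MK.
  have := cardsUI (points_of L) (points_of M); rewrite cL card_points2 //.
  by have := card_lines_cap dM dL ML; rewrite setIC; lia.
case: sp => [E | M MK MH ML E | M N MK NK MH NH [ML NL MN] E | g kg ndg E].
- by left; rewrite /Ksize E.
- by right; apply: (two M); rewrite ?E.
- by right; apply: (two M); rewrite ?E // subsetUl.
right; have := Ksize_setU E; rewrite cL card_rncurve //.
by have := card_conic_line kg dL; rewrite setIC; lia.
Qed.

Lemma Ksize_solid_ge H : \dim H = 4%N -> (q.+1 <= Ksize H)%N.
Proof. case/Ksize_gap; lia. Qed.

Lemma Ksize_pencil U H : H \in pencil U ->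
  Ksize H = (Ksize U + #|(K :&: points_of H) :\: points_of U|)%N.
Proof.
case/pencilP=> _ UH; rewrite /Ksize -(cardsID (points_of U) (K :&: points_of
  H)).
by congr addn; apply: eq_card => P; rewrite -setIA -points_cap (capv_idPr UH).
Qed.

Lemma card_pencil3 pi : \dim pi = 3%N -> #|pencil pi| = q.+1.
Proof. by move=> dpi; rewrite card_pencil // dimV dpi. Qed.

Lemma pencil_solid pi H : \dim pi = 3%N -> H \in pencil pi -> \dim H = 4%N.
Proof. by move=> dpi /pencilP[-> _]; rewrite dpi. Qed.

(** Since |K| = (q + 1)^2, counting K along the q + 1 solids through a plane gives
    this identity for the excesses of the solids over q + 1.  All the counting
    below consists of applications of it. *)
Lemma excess_sum pi : \dim pi = 3%N ->
  (\sum_(H in pencil pi) (Ksize H - q.+1) = q * Ksize pi)%N.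
Proof.
move=> dpi.
have S1 : (\sum_(H in pencil pi) Ksize H =
   \sum_(H in pencil pi) (Ksize H - q.+1) + q.+1 * q.+1)%N.
  rewrite -[X in (X * _)%N](card_pencil3 dpi) -sum_nat_const -big_split /=.
  by apply: eq_bigr => H /(pencil_solid dpi)/Ksize_solid_ge le; rewrite subnK.
have S2 : (\sum_(H in pencil pi) Ksize H = q * Ksize pi + #|K|)%N.
  rewrite (eq_bigr _ (Ksize_pencil (U :=
    pi))) big_split /= sum_nat_const card_pencil3 //.
  rewrite (pencil_count pi K_points) -/(Ksize pi) mulSn; ring.
by move: S2; rewrite S1 cardK -mulnn => /addIn.
Qed.

Lemma exists_between U k : (\dim U <= k <= 5)%N -> exists2 W,
  (U <= W)%VS & \dim W = k.
Proof.
case/andP=> /subnKC <-; elim: (k - _)%N => [|j IH] le5; first by exists U;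
  rewrite ?addn0.
have [|W UW dW] := IH; first by lia.
have /subvPn[v _ vW] : ~~ ({:V} <= W)%VS by apply/negP=> /dimvS;
  rewrite dimV dW; lia.
exists (W + <[v]>)%VS; first exact: subv_trans UW (addvSl _ _).
by rewrite dim_addv_line // dW addnS.
Qed.

(** If no section contained a line, all of them would be twisted cubics, with
    excess 0, and then no plane could contain a point of K. *)
Lemma exists_Kline : exists L, Kline L.
Proof.
have [P PK] : exists P, P \in K by apply/set0Pn; rewrite -card_gt0 cardK; lia.
have [|pi Ppi dpi] := @exists_between P 3; first by rewrite Kdim.
have [/existsP[L LK] | /existsPn noL] := boolP [exists L, Kline L]; first
  by exists L.
have := excess_sum dpi; rewrite big1 => [/esym/eqP | H Hpi].
  rewrite muln_eq0 -[Ksize pi == _]negbK -lt0n; case/orP=> [|/negP[]]; first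
    by lia.
  by apply/card_gt0P; exists P; rewrite inE PK point_in.
have [[L [LK _]] | [f [kf _ E]]] := solid_cases (pencil_solid dpi Hpi).
  by have := noL L; rewrite LK.
by rewrite /Ksize E card_rncurve // subnn.
Qed.

Lemma rncurve_span (g : 'Hom('rV[F]_3, V)) U : lker g = 0%VS ->
  (2 < #|rncurve g :&: points_of U|)%N -> (limg g <= U)%VS.
Proof. by move=> kg; apply: contraTT => gU;
  rewrite -leqNgt card_rncurve_cap. Qed.

Lemma gap_sum (I : finType) (A : pred I) (e : I -> nat) k :
  (forall i, A i -> e i = 0%N \/ k <= e i)%N ->
  (\sum_(i | A i) e i = 0)%N \/ (k <= \sum_(i | A i) e i)%N.
Proof.
move=> gap; have [/existsP[i /andP[iA ei]] | no] :=
  boolP [exists i, A i && (e i != 0%N)].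
  right; rewrite (bigD1 i) //=; case: (gap i iA) => [ei0 | ]; first
    by rewrite ei0 in ei.
  by move/leq_trans; apply; rewrite leq_addr.
left; apply: big1 => i iA; apply/eqP; apply: contraNT no => ei.
by apply/existsP; exists i; rewrite iA.
Qed.

Lemma card_conic_gt2 (g : 'Hom('rV[F]_3, V)) : lker g = 0%VS ->
  (2 < #|rncurve g|)%N.
Proof. by move=> kg; rewrite card_rncurve //; lia. Qed.

Lemma point_eq P Q : \dim P = 1%N -> \dim Q = 1%N -> (P <= Q)%VS -> P = Q.
Proof. by move=> dP dQ PQ; apply/eqP; rewrite eqEdim PQ dP dQ. Qed.

Lemma dim_two_points P Q : \dim P = 1%N -> \dim Q = 1%N -> P != Q ->
  \dim (P + Q)%VS = 2%N.
Proof.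
move=> dP dQ PQ; rewrite dim_addv_point ?dP //.
by apply: contra PQ => QP; apply/eqP/esym/point_eq.
Qed.

(** Suppose that a solid H meets K in a line L and a conic C of a plane s through L
    that has two points on L.  Then H has excess q - 1.  At a point R of L off C,
    the other q - 1 points of C leave some line t of s through R with no further
    point of K; a plane of H that meets s in t contains at most one point of K.
    For it the excesses add up to at most q, with q - 1 of it in H, while
    the other solids contribute 0 or at least q - 1: impossible for q > 2. *)
Lemma no_secant_conic H L (g : 'Hom('rV[F]_3, V)) : \dim H = 4%N -> Kline L ->
  (L <= H)%VS ->
  lker g = 0%VS -> K :&: points_of H = points_of L :|: rncurve g ->
  #|points_of L :&: rncurve g| = 2%N -> ~~ (L <= limg g)%VS.
Proof.
move=> dH LK LH kg E cLg; apply/negP=> Lg.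
have dL := Kline_dim LK; have cL := card_points2 dL; have cg := card_rncurve kg.
set s := limg g in Lg; have ds : \dim s = 3%N := limg_dim kg.
have gs : rncurve g \subset points_of s := rncurve_limg kg.
have gH : rncurve g \subset points_of H.
  by apply: (subset_trans (subsetUr (points_of L) _)); rewrite -E subsetIr.
have sH : (s <= H)%VS by apply: rncurve_span => //;
  rewrite (setIidPl gH) card_conic_gt2.
have [R RL Rg] : exists2 R, R \in points_of L & R \notin rncurve g.
  apply/subsetPn/negP=> /setIidPl; move: cLg => /[swap] ->; rewrite cL; lia.
have [dR RL'] := in_points RL.
have Rs : (R <= s)%VS := subv_trans RL' Lg.
pose m := (s :\: R)%VS.
have mR : (m :&: R = 0)%VS by rewrite capv_diff.
have ms : (m <= s)%VS := diffvSl _ _.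
have dm : \dim m = 2%N.
  by have := dimv_cap_compl s R; rewrite (capv_idPr Rs) dR ds -/m add1n => -[].
have Rm : ~~ (R <= m)%VS.
  by apply/negP=> /capv_idPr; rewrite mR => R0; move: dR; rewrite -R0 dimv0.
(* Projection of the points of s from R onto m; some point Q of m is not the
   image of a point of K in s other than R, so the line R + Q meets K in R only. *)
pose phi P := ((R + P) :&: m)%VS.
pose I := (L :&: m)%VS |: phi @: (rncurve g :\: points_of L).
have cI : (#|I| <= q)%N.
  rewrite /I cardsU1; have := leq_imset_card phi (rncurve g :\: points_of L).
  have := cardsID (points_of L) (rncurve g); rewrite setIC cLg cg.
  by move=> h1 h2; rewrite -ltnS -h1 ltnS; apply: leq_add (leq_b1 _) h2.
have [Q Qm QI] : exists2 Q, Q \in points_of m & Q \notin I.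
  by apply/subsetPn/negP=> /subset_leq_card; rewrite card_points2 // ltnNge cI.
have [dQ Qm'] := in_points Qm.
have RQ : R != Q by apply: contraNneq Rm => ->.
pose t := (R + Q)%VS.
have dt : \dim t = 2%N := dim_two_points dR dQ RQ.
have ts : (t <= s)%VS by rewrite subv_add Rs (subv_trans Qm' ms).
have /subvPn[v vH vs] : ~~ (H <= s)%VS by apply/negP=> /dimvS; rewrite dH ds.
have vt : v \notin t by apply: contra vs => /(subvP ts).
pose tau := (t + <[v]>)%VS.
have dtau : \dim tau = 3%N by rewrite dim_addv_line ?dt.
have taus : (tau :&: s = t)%VS.
  rewrite -vspace_modl // capv_point ?addv0 // ?dim_vline.
  by case: eqVneq vs => // ->; rewrite mem0v.
have tauH : (tau <= H)%VS by rewrite subv_add (subv_trans ts sH) -memvE.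
have ctau : (Ksize tau <= 1)%N.
  rewrite -(cards1 R); apply/subset_leq_card/subsetP=>
    P /setIP[PK /in_points[dP Ptau]].
  apply/set1P/eqP; have [// | PR] := eqVneq P R; case/negP: QI.
  have PH : P \in K :&: points_of H
    by rewrite inE PK point_in // (subv_trans Ptau).
  have Ps : (P <= s)%VS.
    move: PH; rewrite E inE =>
      /orP[/in_points[_ /subv_trans->] // | /(subsetP gs)/in_points[]//].
  have Pt : (P <= t)%VS by rewrite -taus subv_cap Ptau.
  have tE : (R + P)%VS = t.
    by apply: line_eq => //; rewrite ?dim_two_points // 1?eq_sym // subv_add
      addvSl Pt.
  have tm : \dim (t :&: m) = 1%N.
    apply/eqP; rewrite eqn_leq line_capP //= -?dQ ?dimvS ?subv_cap ?addvSr ?Qm'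
      //.
    by apply: contra Rm; apply: subv_trans; apply: addvSl.
  have tQ : Q = (t :&: m)%VS by apply: point_eq; rewrite // subv_cap addvSr.
  rewrite /I inE; have [PL | PL] := boolP (P \in points_of L).
    apply/orP; left; rewrite inE tQ; apply/eqP; congr capv; apply: line_eq =>
      //.
    by rewrite -tE subv_add RL'; case/in_points: PL.
  apply/orP; right; apply/imsetP; exists P; last by rewrite /phi tE.
  by move: PH; rewrite E !inE in PL * => /orP[]; rewrite ?(negPf PL) // => ->.
have Htau : H \in pencil tau by apply/pencilP; rewrite dtau.
have := excess_sum dtau; rewrite (bigD1 H) //=.
have -> : Ksize H = (2 * q)%N by have := Ksize_setU E; rewrite cL cg cLg;
  move: (Ksize H) => k; clear; lia.
have [||] := @gap_sum _ (fun H' => (H' \in pencil tau) && (H' != H)) (fun H' =>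
  Ksize H' - q.+1)%N q.-1.
- move=> H' /andP[/(pencil_solid dtau)/Ksize_gap e _]; move: e; clear -q_gt2;
  lia.
- move=> ->; move: ctau; case: (Ksize tau) => [|[|//]] _; clear -q_gt2; lia.
move: (\sum_(_ | _) _)%N ctau => S; case: (Ksize tau) => [|[|//]] _;
  clear -q_gt2; lia.
Qed.

Lemma dim_line_plane H pi M : \dim H = 4%N -> \dim pi = 3%N -> \dim M = 2%N ->
  (pi <= H)%VS -> (M <= H)%VS -> ~~ (M <= pi)%VS -> \dim (M :&: pi)%VS = 1%N.
Proof.
move=> dH dpi dM piH MH Mpi; apply/eqP; rewrite eqn_leq line_capP //=.
have := dimv_sum_cap M pi; have : (\dim (M + pi) <= 4)%N
  by rewrite -dH dimvS ?subv_add ?MH.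
rewrite dM dpi; move: (\dim _) (\dim _) => a b; clear; lia.
Qed.

Lemma coplanar_meet pi L M : \dim pi = 3%N -> \dim L = 2%N -> \dim M = 2%N ->
  (L <= pi)%VS -> (M <= pi)%VS -> (L :&: M != 0)%VS.
Proof.
move=> dpi dL dM Lpi Mpi; rewrite -dimv_eq0 -lt0n.
have := dimv_sum_cap L M; have : (\dim (L + M) <= 3)%N
  by rewrite -dpi dimvS ?subv_add ?Lpi.
rewrite dM dL; move: (\dim _) (\dim _) => a b; clear; lia.
Qed.

Lemma section_cut H pi L (X : {set {vspace V}}) : (L <= pi)%VS ->
  (pi <= H)%VS ->
  K :&: points_of H = points_of L :|: X ->
  K :&: points_of pi = points_of L :|: (X :&: points_of pi).
Proof.
move=> Lpi piH E; have sL : points_of L \subset points_of pi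
  by rewrite points_sub.
by rewrite -{1}(capv_idPr piH) points_cap setIA E setIUl (setIidPl sL).
Qed.

(** Inclusion and exclusion in the solid H and in a plane pi of H through L; the
    two counts have the same correction term because L lies in pi. *)
Lemma section_count H pi L (X : {set {vspace V}}) : Kline L -> (L <= pi)%VS ->
  (pi <= H)%VS ->
  K :&: points_of H = points_of L :|: X ->
  (Ksize H + #|points_of L :&: X| = q.+1 + #|X|)%N /\
  (Ksize pi + #|points_of L :&: X| = q.+1 + #|X :&: points_of pi|)%N.
Proof.
move=> LK Lpi piH E; have cL := card_points2 (Kline_dim LK).
have := Ksize_setU E; have := Ksize_setU (section_cut Lpi piH E); rewrite cL.
have sL : points_of L \subset points_of pi by rewrite points_sub.
by rewrite [X :&: _]setIC setIA (setIidPl sL).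
Qed.

(** ** Lines of K cannot be pairwise skew *)

Section Skew.

Hypothesis skew : forall L M, Kline L -> Kline M -> L != M -> (L :&: M = 0)%VS.

Lemma skew_points L M : Kline L -> Kline M -> L != M ->
  #|points_of L :&: points_of M| = 0%N.
Proof. by move=> LK MK LM; rewrite -points_cap skew // points0 cards0. Qed.

Lemma skew_plane_cut H pi L M : Kline L -> Kline M -> L != M -> \dim pi = 3%N ->
  \dim H = 4%N -> (L <= pi)%VS -> (pi <= H)%VS -> (M <= H)%VS ->
  #|points_of M :&: points_of pi| = 1%N.
Proof.
move=> LK MK LM dpi dH Lpi piH MH.
have Mpi : ~~ (M <= pi)%VS.
  apply/negP=> Mpi; have :=
    coplanar_meet dpi (Kline_dim LK) (Kline_dim MK) Lpi Mpi.
  by rewrite skew ?eqxx.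
by rewrite -points_cap points1 ?cards1 // (dim_line_plane dH) // Kline_dim.
Qed.

(** For a plane pi through a line L of K, the number of points of K in pi off L
    determines the possible excesses of the solids through pi.  In the last
    alternative the conic may lie in pi itself; then it does not have two points
    on L, by [no_secant_conic]. *)
Lemma skew_excess H pi L : Kline L -> \dim pi = 3%N -> (L <= pi)%VS ->
  H \in pencil pi ->
  [\/ Ksize pi = q.+1,
      Ksize pi = q.+2 /\ Ksize H = (2 * q.+1)%N /\
        (exists M, [/\ Kline M, M != L & K :&: points_of H = points_of L :|:
          points_of M]),
      Ksize pi = q.+3 /\ Ksize H = (3 * q.+1)%N |
      exists g : 'Hom('rV[F]_3, V),
        [/\ lker g = 0%VS, K :&: points_of H = points_of L :|: rncurve g &
        if limg g == pi then Ksize pi = Ksize H /\ (2 * q < Ksize pi)%N /\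
          (Ksize pi <= 2 * q.+1)%N
        else (Ksize pi + #|points_of L :&: rncurve g| <= q.+3)%N] ].
Proof.
move=> LK dpi Lpi Hpi; have [dH piH] := pencilP _ _ Hpi; rewrite dpi in dH.
have dL := Kline_dim LK; have LH := subv_trans Lpi piH.
have cut := skew_plane_cut LK _ _ dpi dH Lpi piH.
case: (line_section dH LK LH) =>
  [E | M MK MH ML E | M N MK NK MH NH [ML NL MN] E | g kg ndg E].
- constructor 1; move: E; rewrite -[X in _ = X]setU0 =>
  /section_cut-/(_ _ Lpi piH).
  by rewrite /Ksize set0I setU0 => ->; rewrite card_points2.
- have [cH cpi] := section_count LK Lpi piH E; constructor 2.
  move: cH cpi; rewrite skew_points 1?eq_sym //. rewrite cut 1?eq_sym //
    card_points2 ?Kline_dim //.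
  move=> cH cpi; split; first by move: cpi; clear; lia.
  split; first by move: cH; clear; lia.
  by exists M.
- move: E; rewrite -setUA => E; have [cH cpi] := section_count LK Lpi piH E;
  constructor 3.
  have := cardsUI (points_of M) (points_of N).
  have := cardsUI (points_of L :&: points_of M) (points_of L :&: points_of N).
  have := cardsUI (points_of M :&: points_of pi) (points_of N :&: points_of pi).
  have -> : points_of M :&: points_of pi :&: (points_of N :&: points_of pi) =
    set0.
    by apply/eqP; rewrite -subset0 -points0 -(skew MK NK MN) points_cap setISS
      ?subsetIl.
  rewrite -setIUl -setIUr (skew_points MK NK MN) !(skew_points LK) 1?[L ==
    _]eq_sym // !cut 1?[L == _]eq_sym //.
  rewrite cards0 !card_points2 ?Kline_dim // => e1 e2 e3; move: cH cpi e1 e2 e3.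
  set a := #|_ :|: _|; set b := #|_ :&: _|; set d := #|_ :&: _|; set e :=
    #|_ :&: _|.
  by clearbody a b d e; clear; lia.
have [cH cpi] := section_count LK Lpi piH E; constructor 4; exists g; split=>
  //.
have [gpi | gpi] := eqVneq (limg g) pi.
  have : rncurve g :&: points_of pi = rncurve g by apply/setIidPl;
    rewrite -gpi rncurve_limg.
  move=> Epi; move: cpi cH; rewrite Epi card_rncurve //.
  (* The conic lies in pi: the case of two points on L is the excluded one. *)
  have le2 : (#|points_of L :&: rncurve g| <= 2)%N
    by rewrite setIC card_conic_line.
  have ne2 : #|points_of L :&: rncurve g| != 2%N.
    by apply/eqP=> e2; have := no_secant_conic dH LK LH kg E e2;
      rewrite gpi Lpi.
  move: le2 ne2; set i := #|_ :&: _|; clearbody i; clear;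
    move: (Ksize pi) (Ksize H) (q) => a b q'; lia.
have : (#|rncurve g :&: points_of pi| <= 2)%N.
  apply: card_rncurve_cap => //; apply: contra gpi => gpi; apply/eqP.
  by apply/eqP; rewrite eqEdim gpi limg_dim // dpi.
move: cpi; set i := #|_ :&: _|; set j := #|_ :&: _|; clearbody i j; clear.
by move: (Ksize pi) => a; lia.
Qed.

(** With two extra points every excess would be divisible by q + 1, whereas their
    sum q (q + 3) is congruent to -2 modulo q + 1.  With more than two, every
    section would lie in pi, which would contain all of K, whereas a line and a
    conic have at most 2 q + 2 points. *)
Lemma plane_extra_le1 L pi : Kline L -> \dim pi = 3%N -> (L <= pi)%VS ->
  (Ksize pi <= q.+2)%N.
Proof.
move=> LK dpi Lpi; rewrite leqNgt; apply/negP=> gt.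
have ex := skew_excess LK dpi Lpi.
have [e3 | ne3] := eqVneq (Ksize pi) q.+3.
  have dv : (q.+1 %| \sum_(H in pencil pi) (Ksize H - q.+1))%N.
    apply: dvdn_sum => H HP; case: (ex H HP) =>
      [e | [e _] | [_ ->] | [g [kg E]]].
    - by move: gt; rewrite e; clear; lia.
    - by move: gt; rewrite e; clear; lia.
    - by rewrite -{3}(mul1n q.+1) -mulnBl dvdn_mull.
    case: ifP => [_ [_ [lt _]] | _ le]; first by move: lt; rewrite e3;
      clear -q_gt2; lia.
    have [piH LH] : (pi <= H)%VS /\ (L <= pi)%VS by have [] := pencilP _ _ HP.
    have [cH _] := section_count LK Lpi piH E; move: cH le;
      rewrite e3 card_rncurve //.
    move: #|_| => i cH le; have -> : (Ksize H - q.+1)%N = q.+1; last by [].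
    by move: cH le; clear; lia.
  move: dv; rewrite excess_sum // e3 => dv.
  have : (q.+1 %| q * q.+3 + 2)%N.
    by rewrite (_ : _ + 2 = q.+1 * q.+2)%N ?dvdn_mulr //; clear; ring.
  by rewrite dvdn_addr // => /dvdn_leq; clear -q_gt2; lia.
have := excess_sum dpi.
rewrite (eq_bigr (fun => Ksize pi - q.+1)%N); last first.
  move=> H HP; case: (ex H HP) => [e | [e _] | [e _] | [g [kg E]]].
  - by move: gt; rewrite e; clear; lia.
  - by move: gt; rewrite e; clear; lia.
  - by rewrite e eqxx in ne3.
  case: ifP => [_ [-> _] // | _ le]; move: le gt ne3; move: #|_| (Ksize pi) =>
    i a; clear; lia.
have le2 : (Ksize pi <= 2 * q.+1)%N.
  have [H HP] : exists H, H \in pencil pi by apply/card_gt0P;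
    rewrite card_pencil3.
  case: (ex H HP) => [-> | [-> _] | [-> _] | [g [kg E]]]; try by clear -q_gt2;
    lia.
  case: ifP => [_ [_ [_ h]] | _ h]; first exact: h.
  by move: h ne3 gt; move: #|_| (Ksize pi) => i a; clear -q_gt2; lia.
rewrite sum_nat_const card_pencil3 //; move: gt le2; move: (Ksize pi) => a;
  clear -q_gt2; nia.
Qed.

Lemma sub_K_plane U (A : {set {vspace V}}) : A \subset K ->
  A \subset points_of U -> (#|A| <= Ksize U)%N.
Proof. by move=> AK AU; apply/subset_leq_card; rewrite subsetI AK. Qed.

(** Take a plane pi spanned by L and a point P of K.  The excesses of the q + 1
    solids through pi are q or q + 1 and add up to q (q + 2), so that q of
    them are equal to q + 1.  Such a solid cuts out L with a skew line or with
    a conic disjoint from L.  The skew lines that occur pass through P, the only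
    point of K in pi off L, hence occur at most once. *)
Lemma exists_disjoint_conic : exists H L (g : 'Hom('rV[F]_3, V)),
  [/\ \dim H = 4%N, Kline L, (L <= H)%VS, lker g = 0%VS &
   K :&: points_of H = points_of L :|: rncurve g /\
     #|points_of L :&: rncurve g| = 0%N].
Proof.
have [L LK] := exists_Kline; have dL := Kline_dim LK.
have [P PK PL] : exists2 P, P \in K & P \notin points_of L.
  by apply/subsetPn/negP=> /subset_leq_card;
    rewrite cardK card_points2 // -mulnn; clear -q_gt2; nia.
have dP := Kdim PK.
pose pi := (L + P)%VS; have Lpi : (L <= pi)%VS := addvSl _ _.
have dpi : \dim pi = 3%N by rewrite dim_addv_point ?dL // -(point_in _ PK).
have cpi : Ksize pi = q.+2.
  apply/eqP; rewrite eqn_leq (plane_extra_le1 LK) //=.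
  rewrite -(card_points2 dL) -[_.+1]/(1 + _)%N -[1%N]/(nat_of_bool true) -PL
    -cardsU1.
  apply: sub_K_plane; rewrite subUset sub1set ?PK ?point_in // ?addvSr
    ?points_sub //=.
  by case/KlineP: LK.
have ex := skew_excess LK dpi Lpi.
pose two H := [exists M, [&& Kline M,
  M != L & K :&: points_of H == points_of L :|: points_of M]].
have [/existsP[H /and3P[HP /eqP cH ntwo]] | no] :=
  boolP [exists H, [&& H \in pencil pi, Ksize H == 2 * q.+1 & ~~ two H]]%N.
  have [dH piH] := pencilP _ _ HP; rewrite dpi in dH.
  have [e | [_ [_ [M [MK ML E]]]] | [e _] | [g [kg E]]] := ex H HP.
  - by move: cpi; rewrite e; clear; lia.
  - by case/negP: ntwo; apply/existsP; exists M; rewrite MK ML E eqxx.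
  - by move: cpi; rewrite e; clear; lia.
  case: ifP => [_ [_ [e _]] | _ _]; first by move: e; rewrite cpi; clear -q_gt2;
    lia.
  exists H, L, g; split=> //; first exact: subv_trans piH.
  split=> //; have [] := section_count LK Lpi piH E; rewrite cH card_rncurve //
    => e _.
  by move: e; move: #|_| => i; clear; lia.
(* There is at most one such solid; if there is none, any subspace will do. *)
have [H1 H1P] : exists H1, forall H, H \in pencil pi -> two H -> H = H1.
  have [/existsP[H1 /andP[H1P /existsP[M /and3P[MK ML /eqP E]]]] | no2] :=
    boolP [exists H, (H \in pencil pi) && two H]; last first.
    exists pi => H HP tH; case/negP: no2; apply/existsP; exists H;
      rewrite HP //.
  exists H1 => H HP /existsP[M' /and3P[MK' ML' /eqP E']].
  have PM X N : X \in pencil pi ->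
    K :&: points_of X = points_of L :|: points_of N -> P \in points_of N.
    case/pencilP=> _ piX EX; have : P \in K :&: points_of X.
      by rewrite inE PK point_in // (subv_trans _ piX) ?addvSr.
    by rewrite EX inE (negPf PL).
  have Heq X N : X \in pencil pi -> Kline N -> N != L ->
    K :&: points_of X = points_of L :|: points_of N ->
     X = (L + N)%VS.
    move=> XP NK NL EX; have dX := pencil_solid dpi XP; apply/esym/eqP;
      rewrite eqEdim.
    rewrite dimv_disjoint_sum ?(skew LK NK) 1?eq_sym // dL (Kline_dim NK) dX
      andbT.
    by rewrite subv_add -!points_sub -subUset -EX subsetIr.
  have MM : M = M'.
    apply/eqP; apply/negPn/negP => MM'.
    have : P \in points_of (M :&: M')%VS.
      by rewrite points_cap inE (PM _ _ H1P E) (PM _ _ HP E').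
    by rewrite skew // points0 inE.
  by rewrite (Heq _ _ HP MK' ML' E') (Heq _ _ H1P MK ML E) MM.
have bound H : H \in pencil pi -> (Ksize H - q.+1 <= q + (H == H1))%N.
  move=> HP; have le2 : (Ksize H <= 2 * q.+1)%N.
    have [e | [_ [-> _]] | [e _] | [g [kg E]]] := ex H HP => //.
    - by move: cpi; rewrite e; clear; lia.
    - by move: cpi; rewrite e; clear; lia.
    case: ifP => [_ [_ [e _]] | _ _]; first by move: e; rewrite cpi;
      clear -q_gt2; lia.
    have [_ piH] := pencilP _ _ HP; have [] := section_count LK Lpi piH E.
    by rewrite card_rncurve // => + _; move: #|_| (Ksize H) => i k; clear; lia.
  have [tH | tH] := boolP (two H).
    by rewrite (H1P H HP tH) eqxx; move: le2; rewrite (H1P H HP tH); clear; lia.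
  have : Ksize H != (2 * q.+1)%N.
    by apply: contraNneq no => cH; apply/existsP; exists H; rewrite HP cH eqxx.
  by move: le2; case: (H == H1); move: (Ksize H) => k; clear; lia.
have := excess_sum dpi; rewrite cpi => S.
have : (\sum_(H in pencil pi) (Ksize H - q.+1) <= \sum_(H in pencil pi) (q + (H
  == H1)))%N.
  exact: leq_sum.
have : (\sum_(H in pencil pi) (H == H1) <= 1)%N.
  rewrite big_mkcond /= (bigD1 H1) //= big1 ?addn0 => [|H /negPf->]; last
    by case: ifP.
  by case: ifP => // _; apply: leq_b1.
rewrite S big_split /= sum_nat_const card_pencil3 //.
by move: (\sum_(_ in _) _)%N => x; clear -q_gt2; nia.
Qed.

(** Let the conic C, of plane s, be disjoint from L and in a solid with it.  Each
    solid through s contains too many points of s to have more than one of its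
    components outside s, so it adds exactly the q points off s of one line.
    Hence s contains exactly q + 1 points of K; but it contains those of C and the
    point where it meets L. *)
Lemma skew_contradiction : False.
Proof.
have [H [L [g [dH LK LH kg [E C0]]]]] := exists_disjoint_conic.
have dL := Kline_dim LK; have cL := card_points2 dL; have cg := card_rncurve kg.
set s := limg g; have ds : \dim s = 3%N := limg_dim kg.
have gs : rncurve g \subset points_of s := rncurve_limg kg.
have gKH : rncurve g \subset K :&: points_of H by rewrite E subsetUr.
have gK := subset_trans gKH (subsetIl _ _).
have gH := subset_trans gKH (subsetIr _ _).
have sH : (s <= H)%VS by apply: rncurve_span => //;
  rewrite (setIidPl gH) card_conic_gt2.
have gcs : (q.+1 <= Ksize s)%N by rewrite -cg; apply: sub_K_plane.
have noline M : Kline M -> ~~ (M <= s)%VS.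
  move=> MK; apply/negP=> Ms; have [dM MsubK] := KlineP _ MK.
  have := plane_extra_le1 MK ds Ms.
  have : (#|points_of M :|: rncurve g| <= Ksize s)%N.
    by apply: sub_K_plane; rewrite subUset ?MsubK // points_sub Ms.
  have := cardsUI (points_of M) (rncurve g); rewrite setIC [_ :|: _]setUC.
  have := card_conic_line kg dM; rewrite cg card_points2 // setUC.
  move: #|_| #|_| (Ksize s) => i j k; clear -q_gt2; lia.
have cut X M : \dim X = 4%N -> (s <= X)%VS -> (M <= X)%VS -> Kline M ->
    #|points_of M :&: points_of s| = 1%N.
  move=> dX sX MX MK.
  by rewrite -points_cap points1 ?cards1 // (dim_line_plane dX) ?noline //
    Kline_dim.
have gts : (q.+1 < Ksize s)%N.
  have : (#|rncurve g :|: points_of L :&: points_of s| <= Ksize s)%N.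
    apply: sub_K_plane; rewrite subUset ?gK ?gs ?subsetIr //=.
    by apply: subset_trans (subsetIl _ _) _; case/KlineP: LK.
  have := cardsUI (rncurve g) (points_of L :&: points_of s).
  rewrite (cut H) // cg setICA setIA.
  have -> : #|points_of L :&: rncurve g :&: points_of s| = 0%N.
    apply/eqP; rewrite -leqn0; apply: leq_trans (eq_leq C0).
    exact: subset_leq_card (subsetIl _ _).
  by move: #|_| (Ksize s) => x k; clear; lia.
have const X : X \in pencil s -> Ksize X = (Ksize s + q)%N.
  move=> XP; have [dX sX] := pencilP _ _ XP; rewrite ds in dX.
  have EX : K :&: points_of s = K :&: points_of X :&: points_of s.
    by rewrite -setIA -points_cap (capv_idPr sX).
  have [[M [MK MX sp]] | [f [kf lf Ef]]] := solid_cases dX; last first.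
    have : (Ksize s <= 3)%N.
      rewrite /Ksize EX Ef; apply: card_rncurve_cap => //.
      by rewrite lf; apply/negP=> /dimvS; rewrite dX ds.
    by move: gts; move: (Ksize s) => x; clear -q_gt2; lia.
  have M1 := cut X M dX sX MX MK.
  case: sp => [E' | N NK NX _ E' | N O NK OK NX OX _ E' | g' kg' ndg' E'].
  - have : Ksize s = 1%N by rewrite /Ksize EX E'.
    by move: gts => /[swap] ->; clear; lia.
  - have : (Ksize s <= 2)%N.
      rewrite /Ksize EX E' setIUl; apply: leq_trans (leq_card_setU _ _) _.
      by rewrite M1 (cut X).
    by move: gts; move: (Ksize s) => x; clear -q_gt2; lia.
  - have : (Ksize s <= 3)%N.
      rewrite /Ksize EX E' !setIUl; apply: leq_trans (leq_card_setU _ _) _.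
      rewrite (cut X O) // -[3%N]/(2 + 1)%N leq_add2r;
        apply: leq_trans (leq_card_setU _ _) _.
      by rewrite M1 (cut X).
    by move: gts; move: (Ksize s) => x; clear -q_gt2; lia.
  have [g's | g's] := boolP (limg g' <= s)%VS; last first.
    have : (Ksize s <= 3)%N.
      rewrite /Ksize EX E' setIUl; apply: leq_trans (leq_card_setU _ _) _.
      by rewrite M1 -[3%N]/(1 + 2)%N leq_add2l; apply: card_rncurve_cap.
    by move: gts; move: (Ksize s) => x; clear -q_gt2; lia.
  have sub : rncurve g' \subset points_of s.
    by apply: subset_trans (rncurve_limg kg') _; rewrite points_sub.
  have : Ksize s = #|(points_of M :&: points_of s) :|: rncurve g'|.
    by rewrite /Ksize EX E' setIUl (setIidPl sub).
  have := cardsUI (points_of M :&: points_of s) (rncurve g').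
  rewrite -setIA (setIidPr sub) M1.
  have := Ksize_setU E'; rewrite card_points2 ?Kline_dim // card_rncurve //.
  by move: #|_| #|_| (Ksize s) (Ksize X) => i j k l; clear; lia.
have := excess_sum ds; rewrite (eq_bigr (fun=> Ksize s + q - q.+1)%N) =>
  [|X XP]; last by rewrite const.
rewrite sum_nat_const card_pencil3 //; move: gts; case: (Ksize s) => // x.
by rewrite addSn subSS addnK mulSn mulnS; clear; lia.
Qed.

End Skew.

Implicit Types (a b d x y z n : {vspace V}).
(** ** Two lines of K that meet *)

Lemma meeting_pair : exists a b : {vspace V},
  [/\ Kline a, Kline b, a != b & meets a b].
Proof.
have [/existsP[a /existsP[b /and4P[? ? ? ?]]] | no] :=
  boolP [exists a, exists b, [&& Kline a, Kline b, a != b & @meets F V a b]].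
  by exists a, b.
case: skew_contradiction => a b aK bK ab; apply/eqP; apply: contraNT no => mab.
by apply/existsP; exists a; apply/existsP; exists b; rewrite aK bK ab.
Qed.

Lemma meetsC U W : meets U W = meets W U.
Proof. by rewrite /meets capvC. Qed.

Lemma lines_cap_dim a b : \dim a = 2%N -> \dim b = 2%N -> a != b -> meets a b ->
  \dim (a :&: b)%VS = 1%N.
Proof.
move=> da db ab mab; apply/eqP;
  rewrite eqn_leq lt0n dimv_eq0 -/(meets a b) mab andbT line_capP //.
by apply: contra ab => ab; apply/eqP/line_eq.
Qed.

Lemma meets_point U W Q : \dim Q = 1%N -> (Q <= U)%VS -> (Q <= W)%VS ->
  meets U W.
Proof.
move=> dQ QU QW; apply/negP=> /eqP UW0; have : (Q <= U :&: W)%VS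
  by rewrite subv_cap QU.
by rewrite UW0 subv0 -dimv_eq0 dQ.
Qed.

Lemma meetsP U W : meets U W -> exists Q,
  [/\ \dim Q = 1%N, (Q <= U)%VS & (Q <= W)%VS].
Proof.
rewrite /meets -vpick0 => v0; have := memv_pick (U :&: W)%VS; rewrite memv_cap
  => /andP[vU vW].
by exists <[vpick (U :&: W)]>%VS; rewrite dim_vline v0.
Qed.

Lemma line_span a P Q : \dim a = 2%N -> \dim P = 1%N -> \dim Q = 1%N ->
  P != Q ->
  (P <= a)%VS -> (Q <= a)%VS -> (P + Q)%VS = a.
Proof. by move=> da dP dQ PQ Pa Qa; apply: line_eq;
  rewrite ?dim_two_points // subv_add Pa. Qed.

Lemma Kline_point a P : Kline a -> \dim P = 1%N -> (P <= a)%VS -> P \in K.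
Proof. by move=> aK dP Pa; apply: (Kline_sub aK); rewrite inE dP Pa. Qed.

Section Pair.

Variables a b : {vspace V}.
Hypotheses (aK : Kline a) (bK : Kline b) (ab : a != b) (mab : meets a b).
Let da : \dim a = 2%N := Kline_dim aK.
Let db : \dim b = 2%N := Kline_dim bK.

Lemma pair_dim : \dim (a + b)%VS = 3%N.
Proof.
by have := dimv_sum_cap a b; rewrite lines_cap_dim // da db addn1 => -[].
Qed.

Lemma pair_card : #|points_of a :|: points_of b| = (2 * q).+1.
Proof.
have := cardsUI (points_of a) (points_of b).
rewrite -points_cap (points1 (lines_cap_dim da db ab mab)) cards1 !card_points2
  //.
by move: #|_|; clear; lia.
Qed.

Lemma pair_section H : H \in pencil (a + b)%VS ->
  K :&: points_of H = points_of a :|: points_of b \/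
  exists n, [/\ Kline n, n != a, n != b, (n <= H)%VS &
    K :&: points_of H = points_of a :|: points_of b :|: points_of n].
Proof.
case/pencilP; rewrite pair_dim subv_add => dH /andP[aH bH].
have bsub : points_of b \subset K :&: points_of H.
  by rewrite subsetI points_sub bH andbT; case/KlineP: bK.
case: (line_section dH aK aH) =>
  [E | M MK MH ML E | M N MK NK MH NH [ML NL MN] E | g kg ndg E].
- move: bsub; rewrite E points_sub => ba.
  by have := ab; rewrite (line_eq db da ba) eqxx.
- have dM := Kline_dim MK.
  have bsub' : points_of b \subset points_of a :|: points_of M :|: points_of M
    by rewrite -setUA setUid -E.
  have /or3P[] := line_in_union db da dM dM bsub'; first
    by rewrite eq_sym (negPf ab).
    by move/eqP=> bM; left; rewrite E bM.
  by move/eqP=> bM; left; rewrite E bM.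
- have dM := Kline_dim MK; have dN := Kline_dim NK; rewrite E in bsub.
  have /or3P[] := line_in_union db da dM dN bsub; first
    by rewrite eq_sym (negPf ab).
    by move/eqP=> bM; right; exists N; rewrite bM E; split=> //; rewrite eq_sym.
  by move/eqP=> bN; right; exists M; rewrite bN E; split=> //;
    rewrite -!setUA [points_of N :|: _]setUC.
by move: bsub; rewrite E => /(line_in_conic kg db da) ba; have := ab;
  rewrite ba eqxx.
Qed.

(** Suppose that the plane a + b contains a further point x of K.  Every section
    by a solid through it is a, b and a third line through x.  If the plane has
    only x as an extra point, all excesses are 2 q + 1; otherwise all the third
    lines lie in the plane.  Both contradict the sum of the excesses. *)
Lemma pair_plane : K :&: points_of (a + b)%VS = points_of a :|: points_of b.
Proof.
have dpi := pair_dim; set pi := (a + b)%VS in dpi *.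
have sub : points_of a :|: points_of b \subset K :&: points_of pi.
  rewrite subUset !subsetI !points_sub addvSl addvSr !andbT.
  by case/KlineP: aK => _ ->; case/KlineP: bK.
apply/eqP; rewrite eq_sym; apply: contraT; rewrite eqEsubset sub /= =>
  /subsetPn[x xK xab].
have [xK' xpi] := setIP xK; have [dx xpi'] := in_points xpi.
have gt : (2 * q.+1 <= Ksize pi)%N.
  have : (#|x |: (points_of a :|: points_of b)| <= Ksize pi)%N.
    by apply/subset_leq_card; rewrite subUset sub1set xK.
  by rewrite cardsU1 xab pair_card; move: (Ksize pi); clear; lia.
have each H : H \in pencil pi ->
  (Ksize pi = 2 * q.+1 /\ Ksize H = 3 * q + 2)%N \/ [/\ Ksize H = Ksize pi,
    3 * q <= Ksize pi & Ksize pi <= 3 * q.+1]%N.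
  move=> HP; have [dH piH] := pencilP _ _ HP; rewrite dpi in dH.
  have xH : x \in K :&: points_of H by rewrite inE xK' inE dx (subv_trans xpi').
  have [E | [n [nK na nb nH E]]] := pair_section HP; first
    by rewrite E (negPf xab) in xH.
  have dn := Kline_dim nK.
  have xn : x \in points_of n by move: xH; rewrite E inE (negPf xab).
  have Epi : K :&: points_of pi = (points_of a :|: points_of b) :|: (points_of n
    :&: points_of pi).
    rewrite -{1}(capv_idPr piH) points_cap setIA E setIUl; congr setU;
      apply/setIidPl.
    by apply: subset_trans sub (subsetIr _ _).
  have := cardsUI (points_of a :|: points_of b) (points_of n);
    rewrite -E -/(Ksize H) pair_card card_points2 //.
  have [npi | npi] := boolP (n <= pi)%VS.
    move=> e; right; have cHpi : Ksize H = Ksize pi.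
      by rewrite /Ksize Epi E (setIidPl _) // points_sub.
    rewrite -cHpi; have := card_lines_cap dn da na; have :=
      card_lines_cap dn db nb.
    have : (#|(points_of a :|: points_of b) :&: points_of n| <=
        #|points_of n :&: points_of a| + #|points_of n :&: points_of b|)%N.
      by rewrite setIC setIUr leq_card_setU.
    move: e; move: #|_| #|_| #|_| (Ksize H); clear => *; split=> //; lia.
  have npi1 : points_of n :&: points_of pi = [set x].
    rewrite -points_cap points1 ?(dim_line_plane dH) //; congr [set _];
      apply/esym/point_eq => //.
      exact: dim_line_plane dH _ _ _ _ _.
    by rewrite subv_cap xpi' andbT; case/in_points: xn.
  have -> : (points_of a :|: points_of b) :&: points_of n = set0.
    apply/setP=> y; rewrite in_set0; apply/negP=> /setIP[yab yn].
    have : y \in points_of n :&: points_of pi.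
      by rewrite inE yn; have := subsetP sub y yab; rewrite inE => /andP[].
    by rewrite npi1 => /set1P yx; rewrite yx (negPf xab) in yab.
  rewrite cards0 => e; left; split; last by move: e; clear; lia.
  have := cardsUI (points_of a :|: points_of b) (points_of n :&: points_of pi).
  rewrite -Epi -/(Ksize pi) pair_card npi1 cards1.
  have -> : (points_of a :|: points_of b) :&: [set x] = set0.
    by apply/eqP; rewrite setI_eq0 disjoint_sym disjoints1.
  by rewrite cards0; clear; lia.
have [e2 | ne2] := eqVneq (Ksize pi) (2 * q.+1)%N.
  have := excess_sum dpi; rewrite (eq_bigr (fun=> 2 * q + 1)%N) => [|H /each];
    last first.
    case=> [[_ ->]|[_ h _]]; first by clear; lia.
    by move: h; rewrite e2; clear -q_gt2; lia.
  by rewrite sum_nat_const card_pencil3 // e2; clear; nia.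
have each' H : H \in pencil pi -> Ksize H = Ksize pi /\
  (Ksize pi <= 3 * q.+1)%N.
  by case/each=> [[e _]|[]//]; rewrite e eqxx in ne2.
have [H HP] : exists H, H \in pencil pi by apply/card_gt0P;
  rewrite card_pencil3.
have [_ le3] := each' H HP.
have := excess_sum dpi; rewrite (eq_bigr (fun=> Ksize pi - q.+1)%N) =>
  [|H' /each'[-> _] //].
rewrite sum_nat_const card_pencil3 //; move: gt le3; move: (Ksize pi) => x';
  clear -q_gt2; nia.
Qed.

Lemma pair_point P : P \in K -> (P <= a + b)%VS -> (P <= a)%VS \/ (P <= b)%VS.
Proof.
move=> PK Pab; have : P \in K :&: points_of (a + b)%VS
  by rewrite inE PK point_in.
by rewrite pair_plane inE !point_in // => /orP.
Qed.

Lemma pair_coplanar x : Kline x -> (x <= a + b)%VS -> x = a \/ x = b.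
Proof.
move=> xK xab; have dx := Kline_dim xK.
have : points_of x \subset points_of a :|: points_of b :|: points_of b.
  by rewrite -setUA setUid -pair_plane subsetI points_sub xab andbT;
    case/KlineP: xK.
by case/(line_in_union dx da db db)/or3P => /eqP; [left | right | right].
Qed.

Lemma pair_count n H : H \in pencil (a + b)%VS -> Kline n -> (n <= H)%VS ->
  n != a -> n != b ->
  K :&: points_of H = points_of a :|: points_of b :|: points_of n.
Proof.
move=> HP nK nH na nb; have dn := Kline_dim nK.
have nsub : points_of n \subset K :&: points_of H.
  by rewrite subsetI points_sub nH andbT; case/KlineP: nK.
have [E | [n' [nK' na' nb' nH' E]]] := pair_section HP.
  move: nsub; rewrite E -[X in _ :|: X]setUid setUA => nsub.
  by have /or3P[] := line_in_union dn da db db nsub;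
    rewrite ?(negPf na) ?(negPf nb).
have dn' := Kline_dim nK'; rewrite E in nsub.
have /or3P[] := line_in_union dn da db dn' nsub;
  rewrite ?(negPf na) ?(negPf nb) //.
by move/eqP->.
Qed.

(** A line x of K skew to the plane a + b would have a point in each solid through
    that plane, so that each of them contained a third line of K; then all
    excesses would be 2 q, and their sum 2 q (q + 1) instead of q (2 q + 1). *)
Lemma pair_dominates x : Kline x -> meets x a || meets x b.
Proof.
move=> xK; have dx := Kline_dim xK.
have dpi := pair_dim; set pi := (a + b)%VS in dpi *.
have [/meetsP[Q [dQ Qx Qpi]] | nm] := boolP (meets x pi).
  have [Qa | Qb] := pair_point (Kline_point xK dQ Qx) Qpi.
    by rewrite (meets_point dQ Qx Qa).
  by rewrite (meets_point dQ Qx Qb) orbT.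
have cpi : Ksize pi = (2 * q).+1 by rewrite /Ksize pair_plane pair_card.
have := excess_sum dpi; rewrite (eq_bigr (fun=> 2 * q)%N) => [|H HP].
  by rewrite sum_nat_const card_pencil3 // cpi; clear -q_gt2; nia.
have [dH piH] := pencilP _ _ HP; rewrite dpi in dH.
have /meetsP[Q [dQ Qx QH]] : meets x H.
  have := dimv_sum_cap x H; have : (\dim (x + H) <= 5)%N
    by rewrite -dimV dimvS ?subvf.
  by rewrite /meets -dimv_eq0 dx dH; move: (\dim _) (\dim _); clear; lia.
have QK := Kline_point xK dQ Qx.
have Qpi : ~~ (Q <= pi)%VS by apply: contra nm; apply: meets_point.
have [E | [n [nK na nb nH E]]] := pair_section HP.
  have : Q \in K :&: points_of H by rewrite inE QK point_in.
  rewrite E -pair_plane inE QK point_in // (negPf Qpi) //.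
have npi : ~~ (n <= pi)%VS.
  by apply/negP=> /(pair_coplanar nK)[] e;
    [rewrite e eqxx in na | rewrite e eqxx in nb].
have dn := Kline_dim nK.
have := cardsUI (points_of a :|: points_of b) (points_of n);
  rewrite -E -/(Ksize H) pair_card card_points2 //.
suff -> : #|(points_of a :|: points_of b) :&: points_of n| = 1%N by clear; lia.
rewrite -pair_plane -setIA -points_cap capvC points1 ?(dim_line_plane dH) //.
rewrite (setIidPr _) ?cards1 // sub1set; apply: (Kline_point nK);
  rewrite ?capvSl //.
exact: dim_line_plane dH _ _ _ _ _.
Qed.

(** Outside the plane a + b the point Q would span with it a solid that contains
    the four lines a, b, x and y. *)
Lemma pair_extra x y Q : Kline x -> Kline y -> x != y -> x != a -> x != b ->
  y != a -> y != b ->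
  \dim Q = 1%N -> (Q <= x)%VS -> (Q <= y)%VS -> (Q <= a)%VS \/ (Q <= b)%VS.
Proof.
move=> xK yK xy xa xb ya yb dQ Qx Qy; apply: pair_point;
  first exact: Kline_point Qx.
apply/negPn/negP=> Qpi.
have HP := pencil_add dQ Qpi; set H := (_ + Q)%VS in HP.
have inH z : Kline z -> (Q <= z)%VS -> (z <= H)%VS.
  move=> zK Qz; have /meetsP[R [dR Rz Rpi]] : meets z (a + b)%VS.
    have /orP[] := pair_dominates zK; case/meetsP=> R [dR Rz Ra];
      apply: (meets_point dR Rz).
      by rewrite (subv_trans Ra) ?addvSl.
    by rewrite (subv_trans Ra) ?addvSr.
  rewrite -(line_span (Kline_dim zK) dR dQ _ Rz Qz) ?addvS //.
  by apply: contraNneq Qpi => <-.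
have Ex := pair_count HP xK (inH x xK Qx) xa xb.
have : points_of y \subset K :&: points_of H.
  by rewrite subsetI points_sub inH // andbT; case/KlineP: yK.
rewrite Ex => /(line_in_union (Kline_dim yK) da db (Kline_dim xK))/or3P.
by rewrite (negPf ya) (negPf yb) eq_sym (negPf xy) => -[].
Qed.

(** If x met a and b in different points it would lie in the plane a + b. *)
Lemma pair_both x : Kline x -> x != a -> x != b -> meets x a -> meets x b ->
  (a :&: b <= x)%VS.
Proof.
move=> xK xa xb /meetsP[Q [dQ Qx Qa]] /meetsP[R [dR Rx Rb]].
have [QR | QR] := eqVneq Q R.
  suff -> : (a :&: b)%VS = Q by [].
  by apply/esym/point_eq; rewrite ?lines_cap_dim // subv_cap Qa QR Rb.
have : (x <= a + b)%VS by rewrite -(line_span (Kline_dim xK) dQ dR) // addvS.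
by case/(pair_coplanar xK)=> e; [rewrite e eqxx in xa | rewrite e eqxx in xb].
Qed.

Lemma pair_cover P : P \in K -> exists2 x, Kline x & (P <= x)%VS.
Proof.
move=> PK; have [Pab | Pab] := boolP (P <= a + b)%VS.
  by have [Pa | Pb] := pair_point PK Pab; [exists a | exists b].
have HP := pencil_add (Kdim PK) Pab; set H := (_ + P)%VS in HP.
have PH : P \in K :&: points_of H by rewrite inE PK point_in ?addvSr.
have [E | [n [nK na nb nH E]]] := pair_section HP; rewrite E in PH; last first.
  move: PH; rewrite !inE Kdim //= -orbA => /or3P[Pa|Pb|Pn];
    [by exists a| by exists b | by exists n].
by move: PH; rewrite !inE Kdim //= => /orP[Pa|Pb]; [exists a | exists b].
Qed.

End Pair.

(** ** The line directrix *)

Lemma line_off_point L Q : \dim L = 2%N -> exists P,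
  [/\ \dim P = 1%N, (P <= L)%VS & P != Q].
Proof.
move=> dL; have [P PL PQ] : exists2 P, P \in points_of L & P \notin [set Q].
  by apply/subsetPn/negP=> /subset_leq_card; rewrite cards1 card_points2 //;
    clear -q_gt2; lia.
by exists P; have [dP PL'] := in_points PL; rewrite inE in PQ.
Qed.

Lemma point_unique L M P Q : \dim L = 2%N -> \dim M = 2%N -> L != M ->
  \dim P = 1%N -> \dim Q = 1%N ->
  (P <= L)%VS -> (P <= M)%VS -> (Q <= L)%VS -> (Q <= M)%VS -> P = Q.
Proof.
move=> dL dM LM dP dQ PL PM QL QM; apply/eqP; apply: contraNT LM => PQ;
  apply/eqP.
by rewrite -(line_span dL dP dQ) // -(line_span dM dP dQ).
Qed.

(** Three concurrent lines of K force all lines of K through their common point Q: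
    a line d off Q would meet exactly one line of each of the three pairs, which
    is impossible by parity.  Then K is a cone, and a plane t spanned by one
    further point on each of x, y, z leads to a contradiction: the solids through
    t that avoid Q contain no line of K and have excess 0, the remaining one has
    excess at most 2 q + 2, but the sum is at least 3 q. *)
Lemma no_concurrent x y z Q : Kline x -> Kline y -> Kline z -> x != y ->
  x != z -> y != z ->
  \dim Q = 1%N -> (Q <= x)%VS -> (Q <= y)%VS -> ~~ (Q <= z)%VS.
Proof.
move=> xK yK zK xy xz yz dQ Qx Qy; apply/negP=> Qz.
have [dx dy dz] : [/\ \dim x = 2%N, \dim y = 2%N & \dim z = 2%N] by split;
  apply: Kline_dim.
have mxy := meets_point dQ Qx Qy; have mxz := meets_point dQ Qx Qz; have myz :=
  meets_point dQ Qy Qz.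
have all_through d : Kline d -> (Q <= d)%VS.
  move=> dK; apply/negPn/negP=> Qd.
  have [dx' dy' dz'] : [/\ d != x, d != y & d != z].
    by split; apply: contraNneq Qd => ->.
  have ex u v : Kline u -> Kline v -> u != v -> (Q <= u)%VS -> (Q <= v)%VS ->
    d != u -> d != v ->
      meets d u = ~~ meets d v.
    move=> uK vK uv Qu Qv du dv; have muv := meets_point dQ Qu Qv.
    have := pair_dominates uK vK uv muv dK.
    have [mu | mu] := boolP (meets d u); have [mv | mv] := boolP (meets d v) =>
      // _.
    have := pair_both uK vK uv muv dK du dv mu mv; have: (Q <= u :&: v)%VS
      by rewrite subv_cap Qu.
    by move=> /subv_trans h /h; rewrite (negPf Qd).
  have := ex x y xK yK xy Qx Qy dx' dy'; have := ex x z xK zK xz Qx Qz dx' dz'.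
  have := ex y z yK zK yz Qy Qz dy' dz'.
  by case: (meets d x); case: (meets d y); case: (meets d z).
have [A [dA Ax AQ]] := line_off_point Q dx.
have [B [dB By BQ]] := line_off_point Q dy.
have [C [dC Cz CQ]] := line_off_point Q dz.
have AB : A != B by apply: contraNneq AQ => AB; apply/eqP/(point_unique dx dy);
  rewrite // AB.
have CAB : ~~ (C <= x + y)%VS.
  apply/negP=> Cxy; case: (pair_point xK yK xy mxy (Kline_point zK dC Cz) Cxy)
    => C'.
    by case/eqP: CQ; apply: (point_unique dx dz).
  by case/eqP: CQ; apply: (point_unique dy dz).
have dAB : \dim (A + B)%VS = 2%N by apply: dim_two_points.
have ABxy : (A + B <= x + y)%VS by apply: addvS.
pose t := (A + B + C)%VS.
have dt : \dim t = 3%N.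
  by rewrite dim_addv_point ?dAB //; apply: contra CAB => /subv_trans; apply.
have At : (A <= t)%VS by rewrite (subv_trans (addvSl A B)) ?addvSl.
have Bt : (B <= t)%VS by rewrite (subv_trans (addvSr A B)) ?addvSl.
have Ct : (C <= t)%VS by rewrite addvSr.
have Qt : ~~ (Q <= t)%VS.
  apply/negP=> Qt; have xyt : (x + y <= t)%VS.
    by rewrite -(line_span dx dA dQ) // -(line_span dy dB dQ) // !subv_add At Bt
      Qt.
  have : (x + y)%VS = t by apply/eqP; rewrite eqEdim xyt dt (pair_dim xK yK).
  by move=> e; rewrite e Ct in CAB.
have HP := pencil_add dQ Qt; set H := (t + Q)%VS in HP.
have QH : (Q <= H)%VS := addvSr _ _.
have dH := pencil_solid dt HP.
have tH : (t <= H)%VS := addvSl _ _.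
have cH : (Ksize H <= 3 * q.+1)%N.
  have HP' : H \in pencil (x + y)%VS.
    have xH : (x <= H)%VS by rewrite -(line_span dx dA dQ) // subv_add QH
      (subv_trans At).
    have yH : (y <= H)%VS by rewrite -(line_span dy dB dQ) // subv_add QH
      (subv_trans Bt).
    by apply/pencilP; rewrite (pair_dim xK yK) // dH subv_add xH yH.
  have [E | [n [nK _ _ _ E]]] := pair_section xK yK xy mxy HP';
    rewrite /Ksize E.
    by rewrite pair_card //; clear -q_gt2; lia.
  apply: leq_trans (leq_card_setU _ _) _.
  by rewrite pair_card // card_points2 ?Kline_dim //; clear -q_gt2; lia.
have := excess_sum dt; rewrite (bigD1 H) //= big1 => [|H' /andP[H'P H'H]];
  last first.
  have dH' := pencil_solid dt H'P.
  have [[L [LK LH _]] | [f [kf _ E]]] := solid_cases dH'; last first.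
    by rewrite /Ksize E card_rncurve // subnn.
  case/eqP: H'H; apply/esym/pencil_eq => //;
    exact: subv_trans (all_through L LK) LH.
have : (#|[set A; B; C]| <= Ksize t)%N.
  apply: sub_K_plane; apply/subsetP=> P; rewrite !inE => /orP[/orP[]|] /eqP->.
  - exact: Kline_point xK dA Ax.
  - exact: Kline_point yK dB By.
  - exact: Kline_point zK dC Cz.
  - by rewrite dA.
  - by rewrite dB.
  by rewrite dC.
have -> : #|[set A; B; C]| = 3.
  rewrite -setUA cardsU1 cards2 !inE negb_or AB.
  have -> : A != C by apply: contraNneq CAB => <-;
    rewrite (subv_trans Ax) ?addvSl.
  have -> // : B != C by apply: contraNneq CAB => <-;
    rewrite (subv_trans By) ?addvSr.
move: cH; move: (Ksize H) (Ksize t) => k j; clear -q_gt2; nia.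
Qed.

(** By [pair_both], lines that meet pairwise are concurrent. *)
Lemma no_triangle x y z : Kline x -> Kline y -> Kline z -> x != y -> x != z ->
  y != z ->
  meets x y -> meets x z -> ~~ meets y z.
Proof.
move=> xK yK zK xy xz yz mxy mxz; apply/negP=> myz.
have [Q [dQ Qx Qy]] := meetsP mxy.
have sub : (x :&: y <= z)%VS.
  by apply: (pair_both xK yK) => //; rewrite 1?eq_sym // meetsC.
have := no_concurrent xK yK zK xy xz yz dQ Qx Qy.
by rewrite (subv_trans _ sub) // subv_cap Qx.
Qed.

Definition directrix l := Kline l /\ (forall x, Kline x -> x != l -> meets x l).

(** Let a and b meet.  Every other line meets a or b; if one misses a and another
    one misses b, these two meet by [pair_dominates], at a point that is on a or
    b by [pair_extra]. *)
Lemma exists_directrix : exists l, directrix l.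
Proof.
have [a [b [aK bK ab mab]]] := meeting_pair.
have [/existsP[x /and4P[xK xa xb nxa]] | no_x] :=
  boolP [exists x, [&& Kline x, x != a, x != b & ~~ @meets F V x a]];
    last first.
  exists a; split=> // x xK xa; have [-> | xb] := eqVneq x b; first
    by rewrite meetsC.
  apply: contraNT no_x => nxa; apply/existsP; exists x; by rewrite xK xa xb.
have [/existsP[y /and4P[yK ya yb nyb]] | no_y] :=
  boolP [exists y, [&& Kline y, y != a, y != b & ~~ @meets F V y b]];
    last first.
  exists b; split=> // y yK yb; have [-> // | ya] := eqVneq y a.
  apply: contraNT no_y => nyb; apply/existsP; exists y; by rewrite yK ya yb.
have mxb : meets x b by have := pair_dominates aK bK ab mab xK;
  rewrite (negPf nxa).
have mya : meets y a by have := pair_dominates aK bK ab mab yK;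
  rewrite (negPf nyb) orbF.
have xy : x != y by apply: contraNneq nxa => ->.
have may : meets a y by rewrite meetsC.
have ay : a != y by rewrite eq_sym.
have mxy : meets x y by have := pair_dominates aK yK ay may xK;
  rewrite (negPf nxa).
have [Q [dQ Qx Qy]] := meetsP mxy.
have [Qa | Qb] := pair_extra aK bK ab mab xK yK xy xa xb ya yb dQ Qx Qy.
  by case/negP: nxa; apply: meets_point Qx Qa.
by case/negP: nyb; apply: meets_point Qy Qb.
Qed.

(** ** Generators and conic directrices *)

Section Directrix.

Variable l : {vspace V}.
Hypothesis l_directrix : directrix l.

Let lK : Kline l := proj1 l_directrix.
Let dl : \dim l = 2%N := Kline_dim lK.
Let meets_l x : Kline x -> x != l -> meets x l := proj2 l_directrix x.

Definition generator x := Kline x && (x != l).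

Lemma genP x : generator x -> [/\ Kline x, x != l, \dim x = 2%N & meets x l].
Proof. by case/andP=> xK xl; split=> //;
  [exact: Kline_dim | exact: meets_l]. Qed.

(** Otherwise x, y and the directrix are three lines of K that meet pairwise. *)
Lemma gen_skew x y P : generator x -> generator y -> \dim P = 1%N ->
  (P <= x)%VS -> (P <= y)%VS -> x = y.
Proof.
move=> /genP[xK xl dx mx] /genP[yK yl dy my] dP Px Py.
apply/eqP; apply: contraT => xy.
have := no_triangle lK xK yK; rewrite 2![l == _]eq_sym => /(_ xl yl xy).
by rewrite 2![meets l _]meetsC mx my (meets_point dP Px Py) => /(_ isT isT).
Qed.

Lemma gen_foot x : generator x -> \dim (x :&: l)%VS = 1%N.
Proof. by case/genP=> xK xl dx mx; apply: lines_cap_dim. Qed.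

Lemma gen_cover P : P \in K -> ~~ (P <= l)%VS -> exists2 x,
  generator x & (P <= x)%VS.
Proof.
move=> PK Pl; have [a [b [aK bK ab mab]]] := meeting_pair.
have [x xK Px] := pair_cover aK bK ab mab PK; exists x => //.
by rewrite /generator xK; apply: contraNneq Pl => <-.
Qed.

Lemma gen_span x U P : generator x -> (l <= U)%VS -> \dim P = 1%N ->
  (P <= x)%VS -> (P <= U)%VS ->
  ~~ (P <= l)%VS -> (x <= U)%VS.
Proof.
move=> xg lU dP Px PU Pl; have [xK xl dx mx] := genP xg.
rewrite -(line_span dx (gen_foot xg) dP _ (capvSl _ _) Px) ?subv_add ?PU.
  by rewrite (subv_trans (capvSr _ _)).
by apply: contraNneq Pl => <-; apply: capvSr.
Qed.

Lemma two_gens_span x y U : generator x -> generator y -> x != y ->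
  (x <= U)%VS -> (y <= U)%VS -> (l <= U)%VS.
Proof.
move=> xg yg xy xU yU.
rewrite -(line_span dl (gen_foot xg) (gen_foot yg) _ (capvSr _ _) (capvSr _ _)).
  by rewrite subv_add (subv_trans (capvSl x l)) // (subv_trans (capvSl y l)).
apply: contra xy => /eqP e; apply/eqP/(gen_skew xg yg (gen_foot xg));
  first exact: capvSl.
by rewrite e capvSl.
Qed.

(** A section has at most three lines, and one of them is the directrix. *)
Lemma three_gens x y z H : generator x -> generator y -> generator z ->
  x != y -> x != z -> y != z ->
  \dim H = 4%N -> (l <= H)%VS -> (x <= H)%VS -> (y <= H)%VS -> ~~ (z <= H)%VS.
Proof.
move=> /genP[xK xl dx mx] /genP[yK yl dy my] /genP[zK zl dz mz] xy xz yz dH lH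
  xH yH.
apply/negP=> zH.
have HP : H \in pencil (x + l)%VS.
  by apply/pencilP; rewrite (pair_dim xK lK) // dH subv_add xH lH.
have E := pair_count xK lK xl mx HP yK yH; rewrite eq_sym in xy.
have := E xy yl => {}E.
have : points_of z \subset K :&: points_of H.
  by rewrite subsetI points_sub zH andbT; case/KlineP: zK.
rewrite E => /(line_in_union dz dx dl dy).
by rewrite ![z == _]eq_sym (negPf xz) (negPf yz) eq_sym (negPf zl).
Qed.

(** The solids through a generator g0 but not through the directrix cut out the
    remaining directrices of K: conics. *)
Definition gen_section H g0 (g : 'Hom('rV[F]_3, V)) :=
  [/\ generator g0, \dim H = 4%N, (g0 <= H)%VS, ~~ (l <= H)%VS &
   lker g = 0%VS /\ K :&: points_of H = points_of g0 :|: rncurve g].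

(** A further line in H would be a generator, and two generators span the
    directrix.  The section is not g0 alone, since every other generator has a
    point in H and is skew to g0. *)
Lemma exists_gen_section H g0 : generator g0 -> \dim H = 4%N -> (g0 <= H)%VS ->
  ~~ (l <= H)%VS ->
  exists2 g, gen_section H g0 g & is_nondegenerate_conic (rncurve g).
Proof.
move=> gg dH gH lH; have [gK gl dg mg] := genP gg.
have notgen M : Kline M -> (M <= H)%VS -> M != g0 -> False.
  move=> MK MH Mg; have Ml : M != l by apply: contraNneq lH => <-.
  have Mgen : generator M by rewrite /generator MK.
  by case/negP: lH; apply: two_gens_span Mgen gg Mg MH gH.
case: (line_section dH gK gH) =>
  [E | M MK MH ML E | M N MK NK MH NH [ML NL MN] E | g kg ndg E].
- exfalso; have [P PK Plg] : exists2 P,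
  P \in K & P \notin points_of l :|: points_of g0.
    apply/subsetPn/negP=> /subset_leq_card; rewrite cardK.
    have := cardsUI (points_of l) (points_of g0); rewrite !card_points2 //.
    by move: #|_| #|_|; rewrite -mulnn; clear -q_gt2; nia.
  move: Plg; rewrite inE !point_in // negb_or => /andP[Pl Pg].
  have [x xg Px] := gen_cover PK Pl; have [xK xl dx mx] := genP xg.
  have /meetsP[R [dR Rx RH]] : meets x H.
    have := dimv_sum_cap x H; have : (\dim (x + H) <= 5)%N
      by rewrite -dimV dimvS ?subvf.
    by rewrite /meets -dimv_eq0 dx dH; move: (\dim _) (\dim _); clear; lia.
  have RK := Kline_point xK dR Rx.
  have : R \in K :&: points_of H by rewrite inE RK point_in.
  rewrite E point_in // => Rg; case/negP: Pg.
  by rewrite -(gen_skew xg gg dR Rx Rg).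
- by case: (notgen M).
- by case: (notgen M).
by exists g.
Qed.

Section GenSection.

Variables (H g0 : {vspace V}) (g : 'Hom('rV[F]_3, V)).
Hypothesis Hg : gen_section H g0 g.

Let gg : generator g0. Proof. by case: Hg. Qed.
Let dH : \dim H = 4%N. Proof. by case: Hg. Qed.
Let gH : (g0 <= H)%VS. Proof. by case: Hg. Qed.
Let lH : ~~ (l <= H)%VS. Proof. by case: Hg. Qed.
Let kg : lker g = 0%VS. Proof. by case: Hg => _ _ _ _ []. Qed.
Let EH : K :&: points_of H = points_of g0 :|: rncurve g. Proof. by case: Hg =>
  _ _ _ _ []. Qed.
Local Notation s := (limg g).

Lemma curve_KH P : P \in rncurve g ->
  [/\ P \in K, \dim P = 1%N, (P <= H)%VS & (P <= s)%VS].
Proof.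
move=> Pg; have : P \in K :&: points_of H by rewrite EH inE Pg orbT.
case/setIP=> PK /in_points[dP PH]; split=> //.
by case: (in_points (subsetP (rncurve_limg kg) P Pg)).
Qed.

Lemma dim_curve_span : \dim s = 3%N. Proof. exact: limg_dim. Qed.

Lemma span_H : (s <= H)%VS.
Proof.
apply: rncurve_span => //; rewrite (setIidPl _) ?card_conic_gt2 //.
apply/subsetP=> P /curve_KH[PK dP PH _]; by rewrite point_in.
Qed.

Lemma l_cap_H P : \dim P = 1%N -> (P <= l)%VS -> (P <= H)%VS -> (P <= g0)%VS.
Proof.
move=> dP Pl PH; have dR := gen_foot gg; have [Rg Rl] :=
  (capvSl g0 l, capvSr g0 l).
have [-> // | PR] := eqVneq P (g0 :&: l)%VS.
case/negP: lH; rewrite -(line_span dl dP dR PR Pl Rl) subv_add PH.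
exact: subv_trans Rg gH.
Qed.

Lemma curve_gen_inj P Q x : generator x -> x != g0 -> P \in rncurve g ->
  Q \in rncurve g ->
  (P <= x)%VS -> (Q <= x)%VS -> P = Q.
Proof.
move=> xg xg0 /curve_KH[PK dP PH _] /curve_KH[QK dQ QH _] Px Qx.
have [_ _ dx _] := genP xg.
apply/eqP; apply: contraT => PQ; case/negP: lH.
by apply: (two_gens_span xg gg xg0) => //;
  rewrite -(line_span dx dP dQ PQ) // subv_add PH.
Qed.

Definition genof P := odflt l [pick x | generator x && (P <= x)%VS].

Lemma genofP P : P \in K -> ~~ (P <= l)%VS -> generator (genof P) /\
  (P <= genof P)%VS.
Proof.
move=> PK Pl; rewrite /genof; case: pickP => [x /andP[] // | no].
by have [x xg Px] := gen_cover PK Pl; have := no x; rewrite xg Px.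
Qed.

(** If the plane s of the conic met the directrix, it would span with it a solid,
    or lie with it in one; that solid would contain the generators through the
    points of the conic off g0, which are pairwise distinct.  There are at
    least three of these, or at least two in addition to g0. *)
Lemma l_skew : (s :&: l = 0)%VS.
Proof.
apply/eqP; apply: contraT => /meetsP[R [dR Rs Rl]].
have [H2 sH2 dH2] : exists2 H2, (s + l <= H2)%VS & \dim H2 = 4%N.
  apply: exists_between; rewrite andbT.
  have := dimv_sum_cap s l; have := meets_point dR Rs Rl.
  rewrite /meets -dimv_eq0 -lt0n dim_curve_span dl; move: (\dim _) (\dim _);
    clear; lia.
move: sH2; rewrite subv_add => /andP[sH2 lH2].
have off P : P \in rncurve g :\: points_of g0 ->
  [/\ generator (genof P), (P <= genof P)%VS,
     genof P != g0 & (genof P <= H2)%VS].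
  case/setDP=> Pg; have [PK dP PH Ps] := curve_KH Pg; rewrite point_in // =>
    Pg0.
  have Pl : ~~ (P <= l)%VS by apply: contra Pg0 => Pl; apply: l_cap_H.
  have [xg Px] := genofP PK Pl; split=> //; first by apply: contraNneq Pg0 =>
    <-.
  by apply: (gen_span xg lH2 dP) => //; apply: subv_trans sH2.
have injg : {in rncurve g :\: points_of g0 &, injective genof}.
  move=> P Q PC QC e; have [xg Px xg0 _] := off P PC; have [_ Qx _ _] :=
    off Q QC.
  case/setDP: PC => PC _; case/setDP: QC => QC _; rewrite -e in Qx.
  exact: curve_gen_inj xg xg0 PC QC Px Qx.
have cC := cardsID (points_of g0) (rncurve g); rewrite card_rncurve // in cC.
have dg := let: And4 _ _ d _ := genP gg in d.
pose G := genof @: (rncurve g :\: points_of g0).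
have cG : #|G| = #|rncurve g :\: points_of g0| by rewrite card_in_imset.
have GP x : x \in G -> [/\ generator x, x != g0 & (x <= H2)%VS].
  by case/imsetP=> P /off[? ? ? ?] ->.
have [gs | gs] := boolP (g0 <= s)%VS.
  have : (1 < #|G|)%N.
    by rewrite cG; have := card_conic_line kg dg; move: cC; move: #|_| #|_|;
      clear -q_gt2; lia.
  case/card_gt1P=> x [y [/GP[xg xg0 xH] /GP[yg yg0 yH] xy]].
  have := three_gens xg yg gg xy xg0 yg0 dH2 lH2 xH yH.
  by rewrite (subv_trans gs).
have : (2 < #|G|)%N.
  rewrite cG; have := card_line_cap dg gs.
  have := subset_leq_card (setSI (points_of g0) (rncurve_limg kg));
    rewrite [points_of g0 :&: _]setIC.
  by move: cC; move: #|_| #|_| #|_|; clear -q_gt2; lia.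
case/card_gt2P=> x [y [z [[/GP[xg _ xH] /GP[yg _ yH] /GP[zg _ zH]] [xy yz
  zx]]]].
by have := three_gens xg yg zg xy _ yz dH2 lH2 xH yH; rewrite zH eq_sym =>
  /(_ zx).
Qed.

Lemma curve_off_l P : P \in rncurve g -> ~~ (P <= l)%VS.
Proof.
move=> /curve_KH[PK dP PH Ps]; apply/negP=> Pl; have : (P <= s :&: l)%VS
  by rewrite subv_cap Ps.
by rewrite l_skew subv0 -dimv_eq0 dP.
Qed.

Lemma curve_inj P Q x : generator x -> P \in rncurve g -> Q \in rncurve g ->
  (P <= x)%VS -> (Q <= x)%VS -> P = Q.
Proof.
move=> xg /curve_KH[PK dP PH Ps] /curve_KH[QK dQ QH Qs] Px Qx.
have [_ _ dx mx] := genP xg; apply/eqP; apply: contraT => PQ.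
have /capv_idPl xs : (x <= s)%VS
  by rewrite -(line_span dx dP dQ PQ) // subv_add Ps.
by move: mx; rewrite /meets -xs -capvA l_skew capv0 eqxx.
Qed.

(** Conic points, generators and points of the directrix: assigning to a conic
    point the generator through it and to a generator its point on the directrix
    gives two injections, between sets whose first and last have q + 1
    elements. *)
Lemma gens_bijection :
  (forall x, generator x -> exists2 P, P \in rncurve g & (P <= x)%VS) /\
  (forall P, P \in points_of l -> exists2 x, generator x & (P <= x)%VS).
Proof.
pose G := [set x | generator x].
have inG P : P \in rncurve g -> generator (genof P) /\ (P <= genof P)%VS.
  by move=> Pg; have [PK _ _ _] := curve_KH Pg; apply: genofP (curve_off_l Pg).
have sub1 : genof @: rncurve g \subset G.
  by apply/subsetP=> x /imsetP[P /inG[? _] ->]; rewrite inE.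
have c1 : #|genof @: rncurve g| = q.+1.
  rewrite card_in_imset ?card_rncurve // => P Q PC QC e.
  have [xg Px] := inG P PC; have [_ Qx] := inG Q QC; rewrite -e in Qx.
  exact: curve_inj xg PC QC Px Qx.
pose foot x := (x :&: l)%VS.
have sub2 : foot @: G \subset points_of l.
  by apply/subsetP=> P /imsetP[x]; rewrite inE => xg ->;
    rewrite inE (gen_foot xg) capvSr.
have c2 : #|foot @: G| = #|G|.
  apply: card_in_imset => x y; rewrite !inE => xg yg e.
  apply: (gen_skew xg yg (gen_foot xg)); first exact: capvSl.
  by rewrite -/(foot x) e capvSl.
have cG : #|G| = q.+1.
  have := subset_leq_card sub1; have := subset_leq_card sub2;
    rewrite c1 c2 card_points2 //.
  by move=> le1 le2; apply/eqP; rewrite eqn_leq le1.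
split=> [x xg | P Pl].
  have E : genof @: rncurve g = G by apply/eqP;
    rewrite eqEcard sub1 c1 cG leqnn.
  have : x \in G by rewrite inE.
  by rewrite -E => /imsetP[P PC ->]; exists P => //; case: (inG P PC).
have E : foot @: G = points_of l by apply/eqP;
  rewrite eqEcard sub2 c2 cG card_points2 ?leqnn.
by move: Pl; rewrite -E => /imsetP[x]; rewrite inE => xg ->; exists x => //;
  apply: capvSl.
Qed.

End GenSection.

Lemma exists_gen : exists x, generator x.
Proof.
have [P PK Pl] : exists2 P, P \in K & P \notin points_of l.
  apply/subsetPn/negP=> /subset_leq_card; rewrite cardK card_points2 // -mulnn.
  by clear -q_gt2; nia.
by rewrite point_in // in Pl; have [x xg _] := gen_cover PK Pl; exists x.
Qed.

Lemma exists_solid_avoiding U P : (\dim U <= 4)%N -> \dim P = 1%N ->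
  ~~ (P <= U)%VS ->
  exists H, [/\ \dim H = 4%N, (U <= H)%VS & ~~ (P <= H)%VS].
Proof.
move=> dU dP PU; pose W := (U + P)%VS; exists (U + W^C)%VS.
have dW : \dim W = (\dim U).+1 by apply: dim_addv_point.
have d4 : \dim (U + W^C)%VS = 4%N.
  rewrite dimv_disjoint_sum ?dimv_compl ?dimV ?dW; first by move: dU; clear;
    lia.
  by apply/eqP; rewrite -subv0 -(capv_compl W) capvS ?addvSl.
split; rewrite ?addvSl //; apply/negP=> PH.
have : ({:V} <= U + W^C)%VS.
  by rewrite -(addv_complf W) subv_add addvSr andbT subv_add addvSl.
by move/dimvS; rewrite dimV d4.
Qed.

(** The conic is parametrised so that its point at infinity P is off g0, and the
    second solid is another member of the pencil of g0 + P.  Thus the second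
    conic contains P but spans a different plane. *)
Lemma two_gen_sections : exists H g0 f H' f',
  [/\ gen_section H g0 f, gen_section H' g0 f',
    <[f (moment 2 None)]>%VS \in rncurve f' &
      ~~ (limg f <= H')%VS].
Proof.
have [g0 gg] := exists_gen; have [gK gl dg mg] := genP gg.
have [R [dR Rl Rne]] := line_off_point (g0 :&: l)%VS dl.
have Rg : ~~ (R <= g0)%VS.
  apply: contra Rne => Rg; apply/eqP.
  by apply: (point_unique dg dl) => //; rewrite ?gen_foot ?capvSl ?capvSr.
have [|H [dH gH RH]] := @exists_solid_avoiding g0 R _ dR Rg; first
  by rewrite dg.
have lH : ~~ (l <= H)%VS by apply: contra RH; apply: subv_trans.
have [g Hg ndg] := exists_gen_section gg dH gH lH.
have kg : lker g = 0%VS by case: Hg => _ _ _ _ [].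
have [P Pg Pg0] : exists2 P, P \in rncurve g & P \notin points_of g0.
  apply/subsetPn/negP=> /setIidPl e; have := card_conic_line kg dg.
  by rewrite e card_rncurve //; clear -q_gt2; lia.
have [f [kf Cf Pf]] := conic_rncurve ndg Pg.
have Hf : gen_section H g0 f by case: Hg => ? ? ? ? [_ E]; split=> //;
  rewrite -Cf.
have [PK dP PH Ps] := curve_KH Hg Pg.
rewrite point_in // in Pg0.
have dpi : \dim (g0 + P)%VS = 3%N by rewrite dim_addv_point ?dg.
have piH : (g0 + P <= H)%VS by rewrite subv_add gH.
have Rpi : ~~ (R <= g0 + P)%VS by apply: contra RH => /subv_trans; apply.
have [H' HP' ] : exists2 H',
  H' \in pencil (g0 + P)%VS & H' \notin [set H; (g0 + P + R)%VS].
  apply/subsetPn/negP=> /subset_leq_card; rewrite card_pencil3 // cards2.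
  by case: (_ != _); clear -q_gt2; lia.
rewrite !inE negb_or => /andP[H'H H'R].
have [dH' piH'] := pencilP _ _ HP'; rewrite dpi in dH'.
have gH' := subv_trans (addvSl _ _) piH'; have PH' :=
  subv_trans (addvSr _ _) piH'.
have lH' : ~~ (l <= H')%VS.
  apply: contra H'R => lH'; apply/eqP/esym/(pencil_eq HP') => //;
    exact: subv_trans lH'.
have [f' Hf' _] := exists_gen_section gg dH' gH' lH'.
exists H, g0, f, H', f'; split=> //.
  have : P \in K :&: points_of H' by rewrite inE PK point_in.
  by case: Hf' => _ _ _ _ [_ ->]; rewrite inE point_in // (negPf Pg0) /= -Pf.
apply: contra H'H => sH'; apply/eqP.
have d0 := gen_foot gg; set P0 := (g0 :&: l)%VS in d0.
have P0s : ~~ (P0 <= limg f)%VS.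
  apply/negP=> P0s; have : (P0 <= limg f :&: l)%VS
    by rewrite subv_cap P0s capvSr.
  by rewrite (l_skew Hf) subv0 -dimv_eq0 d0.
have P0g : (P0 <= g0)%VS := capvSl _ _.
have dsf : \dim (limg f) = 3%N := limg_dim kf.
transitivity (limg f + P0)%VS; last apply: pencil_eq.
- apply/esym/pencil_eq => //; last exact: subv_trans gH'.
  by apply/pencilP; rewrite dsf.
- by apply/pencilP; rewrite dsf dH (span_H Hf).
- by [].
- exact: subv_trans gH.
exact: P0s.
Qed.

Lemma daddv_pi_ker U W v : (U :&: W = 0)%VS -> v \in W -> daddv_pi U W v = 0.
Proof.
move=> UW vW; have vUW : v \in (U + W)%VS by rewrite (subvP (addvSr U W)).
have := daddv_pi_add UW vUW; rewrite (daddv_pi_id _ vW) 1?capvC //.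
by move/(canRL (addrK v)); rewrite subrr.
Qed.

(** A generator is spanned by its point on the directrix and its point on the
    conic; the projection along the plane of the conic fixes the former and
    kills the latter. *)
Lemma proj_gen H g0 f x v : gen_section H g0 f -> generator x -> v \in x ->
  daddv_pi l (limg f) v \in (x :&: l)%VS.
Proof.
move=> Hf xg vx; have [xK xl dx mx] := genP xg.
have ls : (l :&: limg f = 0)%VS by rewrite capvC (l_skew Hf).
have [P Pf Px] := proj1 (gens_bijection Hf) x xg.
have [PK dP PH Ps] := curve_KH Hf Pf.
have d0 := gen_foot xg; set p := (x :&: l)%VS in d0 *.
have pP : p != P.
  by apply: contraNneq (curve_off_l Hf Pf) => <-; apply: capvSr.
have xE := line_span dx d0 dP pP (capvSl _ _) Px.
move: vx; rewrite -xE => /memv_addP[v1 v1p [v2 v2P ->]].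
rewrite linearD /= (daddv_pi_ker ls (subvP Ps _ v2P)) addr0 daddv_pi_id //.
by move: v1p; apply/subvP; apply: capvSr.
Qed.

Lemma moment_conicE (f : 'Hom('rV[F]_3, V)) (a : F) :
  f (moment 2 (Some a)) = f (delta_mx 0 0) + a *: f (delta_mx 0 1) + a ^+ 2 *: f
    (delta_mx 0 ord_max).
Proof.
rewrite -!linearZ -!linearD /=; congr (f _); apply/rowP=> i; rewrite !mxE.
case: (unliftP 0 i) => [j|] ->; last by rewrite expr0 /= !mulr0 !addr0.
case: (unliftP 0 j) => [k|] ->; last
  by rewrite expr1 /= mulr0 mulr1 add0r addr0.
by rewrite ord1 /= mulr0 mulr1 !add0r.
Qed.

(** The projection A onto the directrix along the plane of the second conic maps
    the first conic f0 + t f1 + t^2 f2 to vectors h0 + t h1: the coefficient of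
    t^2 vanishes because both conics contain the point at infinity.  By
    [proj_gen] the vector h0 + t h1 lies on the generator through the point t of
    the conic.  So the correspondence between directrix and conic is a
    projectivity, provided that h0 and h1 are independent; they are because
    distinct generators meet the directrix in distinct points and q > 2. *)
Lemma normal_form : exists h0 h1 f0 f1 f2 : V, free [:: h0; h1; f0; f1; f2] /\
  forall v, v != 0 -> (<[v]>%VS \in K <-> exists a b s r : F,
    v = (s * a) *: h0 + (s * b) *: h1 + (r * a ^+ 2) *: f0 + (r * a * b) *: f1 +
      (r * b ^+ 2) *: f2).
Proof.
have [H [g0 [f [H' [f' [Hf Hf' Nf' fH']]]]]] := two_gen_sections.
have kf : lker f = 0%VS by case: Hf => _ _ _ _ [].
pose e (i : 'I_3) := f (delta_mx 0 i).
pose A := daddv_pi l (limg f').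
have ls : (l :&: limg f' = 0)%VS by rewrite capvC (l_skew Hf').
have Ae2 : A (e ord_max) = 0.
  apply: daddv_pi_ker => //; have [_ _ _] := curve_KH Hf' Nf'.
  by rewrite -memvE.
pose h0 := A (e 0); pose h1 := A (e 1).
have hl v : A v \in l by apply: memv_pi.
have At (a : F) : A (f (moment 2 (Some a))) = h0 + a *: h1.
  by rewrite moment_conicE !linearD !linearZ /= -/(e ord_max) Ae2 scaler0 addr0.
have gt t : exists x, [/\ generator x,
  <[f (moment 2 t)]>%VS \in rncurve f & (<[f (moment 2 t)]> <= x)%VS].
  have tf : <[f (moment 2 t)]>%VS \in rncurve f by apply: imset_f.
  have [PK dP PH Ps] := curve_KH Hf tf.
  by have [x xg Px] := gen_cover PK (curve_off_l Hf tf); exists x.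
have ginj x t u : generator x -> (<[f (moment 2 t)]> <= x)%VS ->
  (<[f (moment 2 u)]> <= x)%VS -> t = u.
  move=> xg tx ux; apply: (moment_line_inj kf).
  by apply: (curve_inj Hf xg) => //; apply: imset_f.
have hx x (a : F) : generator x -> (<[f (moment 2 (Some a))]> <= x)%VS ->
  h0 + a *: h1 \in (x :&: l)%VS.
  by move=> xg ax; rewrite -At; apply: (proj_gen Hf').
have sl : (limg f :&: l = 0)%VS := l_skew Hf.
(* If h0 + t h1 vanished for two values of t, the projection would kill the whole
   plane of the first conic, which is not the plane of the second one. *)
have zz (u w : F) : u != w -> h0 + u *: h1 = 0 -> h0 + w *: h1 != 0.
  move=> uw hu; apply/eqP=> hw; case/negP: fH'.
  have h10 : h1 = 0.
    have : (u - w) *: h1 = 0.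
      by rewrite scalerBl -[LHS]addr0 -[X in _ + X](subrr h0) addrACA [u *: _ +
        _]addrC hu -opprD [_ + h0]addrC hw subr0.
    by move/eqP; rewrite scaler_eq0 subr_eq0 (negPf uw) => /eqP.
  have h00 : h0 = 0 by rewrite -hu h10 scaler0 addr0.
  have Af (x : 'rV[F]_3) : A (f x) = 0.
    rewrite (row_sum_delta x) !linear_sum big1 // => i _;
      rewrite !linearZ /= -/(e i).
    suff -> : A (e i) = 0 by rewrite scaler0.
    case: (unliftP 0 i) => [j|] ->; last exact: h00.
    case: (unliftP 0 j) => [k|] ->; rewrite ?ord1.
      by rewrite (_ : lift 0 (lift 0 0) = ord_max) //; apply: val_inj.
    by rewrite (_ : lift 0 0 = 1) //; apply: val_inj.
  apply: subv_trans (span_H Hf'); apply/subvP=> v /memv_imgP[x _ ->].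
  have full : f x \in (l + limg f')%VS.
    suff -> : (l + limg f' = fullv)%VS by rewrite memvf.
    by apply/eqP; rewrite eqEdim subvf dimv_disjoint_sum // dimV dl
      (dim_curve_span Hf').
  by rewrite -(daddv_pi_add ls full) -/A Af add0r memv_pi.
(* Among three elements of F, at most one is a zero of h0 + t h1. *)
have [u [w [uw hu hw]]] : exists u w : F,
  [/\ u != w, h0 + u *: h1 != 0 & h0 + w *: h1 != 0].
  have /card_gt2P[u [w [k [_ [uw wk ku]]]]] : (2 < #|F|)%N by exact: q_gt2.
  have [hu | hu] := eqVneq (h0 + u *: h1) 0.
    by exists w, k; split=> //; apply: zz hu; rewrite // eq_sym.
  have [hw | hw] := eqVneq (h0 + w *: h1) 0; last by exists u, w.
  by exists u, k; split=> //; [rewrite eq_sym | apply: zz hw].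
have h0l : h0 \in l by apply: hl.
have h1l : h1 \in l by apply: hl.
have lD : <<[:: h0; h1]>>%VS = l.
  apply/eqP; rewrite eqEsubv; apply/andP; split.
    by apply/span_subvP=> v; rewrite !inE => /orP[]/eqP->.
  have [x [xg _ ux]] := gt (Some u); have [y [yg _ wy]] := gt (Some w).
  have ne : <[h0 + u *: h1]>%VS != <[h0 + w *: h1]>%VS.
    apply: contra uw => /eqP eq_uw; apply/eqP.
    suff xy : x = y by rewrite -xy in wy; have [] := ginj _ _ _ xg ux wy.
    apply: (gen_skew xg yg (P := <[h0 + u *: h1]>%VS)); first
      by rewrite dim_vline hu.
      by rewrite -memvE; have := hx _ _ xg ux; rewrite memv_cap => /andP[].
    by rewrite eq_uw -memvE; have := hx _ _ yg wy; rewrite memv_cap => /andP[].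
  rewrite -(line_span dl _ _ ne);
    rewrite ?dim_vline ?hu ?hw -?memvE ?memvD ?memvZ //.
  by rewrite subv_add -!memvE !memvD ?memvZ // memv_span // !inE eqxx ?orbT.
have freeh : free [:: h0; h1] by rewrite /free lD dl.
have freee : free [:: e 0; e 1; e ord_max].
  apply/(@freeP _ _ _ [tuple e 0; e 1; e ord_max]) => k;
    rewrite !big_ord_recl big_ord0 /= addr0 => k0 i.
  have injf : injective f by apply/lker0P/eqP.
  have : f (\row_i k i) = f 0.
    rewrite (row_sum_delta (\row_i k i)) linear_sum linear0 !big_ord_recl
      big_ord0 addr0 !linearZ !mxE /= -[RHS]k0.
    by congr (_ + (_ *: f (delta_mx 0 _) + _ *: f (delta_mx 0 _)));
      apply: val_inj.
  by move/injf/rowP/(_ i); rewrite !mxE.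
have free5 : free [:: h0; h1; e 0; e 1; e ord_max].
  have := cat_free [:: h0; h1] [:: e 0; e 1; e ord_max]; rewrite freeh freee /=
    => ->.
  apply/directv_addP; rewrite lD; apply/eqP; rewrite -subv0 -sl capvC capvS //.
  by apply/span_subvP=> v; rewrite !inE => /or3P[]/eqP->; apply: memv_img;
    apply: memvf.
(* The generator at infinity is the one through h1: a generator with a finite
   parameter would contain h0 as well, hence the whole directrix. *)
have [y [yg h1y e2y]] : exists y, [/\ generator y, h1 \in y & e ord_max \in y].
  have h10 : h1 != 0 by apply: (free_not0 freeh); rewrite !inE eqxx orbT.
  have [|y yg h1y] := proj2 (gens_bijection Hf) <[h1]>%VS; first
    by rewrite line_in_points.
  rewrite -memvE in h1y.
  have [P /imsetP[[a|] _ ->] Py] := proj1 (gens_bijection Hf) y yg; last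
    by exists y; rewrite memvE.
  have hay := hx _ _ yg Py.
  have h1yl : h1 \in (y :&: l)%VS by rewrite memv_cap h1y.
  have h0yl : h0 \in (y :&: l)%VS
    by rewrite -[h0](addrK (a *: h1)) rpredB // memvZ.
  have : (l <= y :&: l)%VS by rewrite -lD; apply/span_subvP=> v; rewrite !inE lD
    => /orP[]/eqP->.
  by move/dimvS; rewrite dl (gen_foot yg).
have spanx x (P Q : V) : generator x -> P != 0 -> Q != 0 -> P \in x ->
  P \in l -> Q \in x -> Q \notin l ->
   forall v, v \in x -> exists s r, v = s *: P + r *: Q.
  move=> xg P0 Q0 Px Pl Qx Ql v vx; have [xK xl dx mx] := genP xg.
  have PQ : <[P]>%VS != <[Q]>%VS.
    by apply: contraNneq Ql; rewrite memvE => <-; rewrite -memvE.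
  move: vx; rewrite -(line_span dx _ _ PQ) ?dim_vline ?P0 ?Q0 -?memvE //.
  by case/memv_addP=> _ /vlineP[s ->] [_ /vlineP[r ->] ->]; exists s, r.
have enotl t : f (moment 2 t) \notin l.
  by rewrite memvE (curve_off_l Hf) //; apply: imset_f.
have hnz (a b : F) : (a != 0) || (b != 0) -> a *: h0 + b *: h1 != 0.
  move=> ab; apply: contraL ab => /eqP hab; rewrite negb_or !negbK.
  move/(@freeP _ _ _ [tuple h0; h1])/(_ (fun i =>
    if i == 0 then a else b)): freeh.
  rewrite !big_ord_recl big_ord0 /= addr0 => /(_ hab) fr.
  by have := fr 0; have := fr 1; rewrite /= => -> ->; rewrite eqxx.
have fnz t : f (moment 2 t) != 0 by apply: moment_img_neq0.
exists h0, h1, (e 0), (e 1), (e ord_max); split=> // v v0; split.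
  move=> vK; have [vl | vl] := boolP (v \in l).
    have : v \in (<[h0]> + <[h1]>)%VS by rewrite -(span_seq1 h1) -span_cons lD.
    case/memv_addP=> _ /vlineP[a ->] [_ /vlineP[b ->] ->].
    by exists a, b, 1, 0; rewrite !mul1r !mul0r !scale0r !addr0.
  have [x xg vx] := gen_cover vK vl.
  have [P /imsetP[[a|] _ ->] Px] := proj1 (gens_bijection Hf) x xg.
    have := hx _ _ xg Px; rewrite memv_cap => /andP[hax hal].
    have ha0 : h0 + a *: h1 != 0 by have := hnz 1 a; rewrite scale1r oner_eq0;
      apply.
    have [s [r ->]] := spanx x _ _ xg ha0 (fnz (Some a)) hax hal Px (enotl _) v
      vx.
    exists 1, a, s, r; rewrite moment_conicE !scalerDr !scalerA !expr1n !mulr1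
      !addrA //.
  have xy : x = y.
    apply: (gen_skew xg yg _ Px); last by rewrite -memvE.
    by rewrite dim_vline fnz.
  rewrite -xy in h1y.
  have h10 : h1 != 0 by have := hnz 0 1;
    rewrite scale0r add0r scale1r oner_eq0 orbT; apply.
  have [s [r ->]] := spanx x _ _ xg h10 (fnz None) h1y h1l Px (enotl _) v vx.
  by exists 0, 1, s, r; rewrite !mulr0 mul0r expr0n expr1n !mulr0 !mulr1
    !scale0r !addr0 !add0r.
case=> a [b [s [r vE]]].
have [x xg vx] : exists2 x, generator x & v \in x.
  have [a0 | a0] := eqVneq a 0.
    exists y => //; rewrite vE a0 !mulr0 expr0n !mulr0 mul0r !scale0r add0r
      !addr0 memvD ?memvZ //.
  have [x [xg _ tx]] := gt (Some (b / a)); exists x => //.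
  have := hx _ _ xg tx; rewrite memv_cap => /andP[hx' _].
  rewrite -memvE moment_conicE in tx.
  have -> : v = (s * a) *: (h0 + (b / a) *: h1) + (r * a ^+ 2) *: (e 0 + (b / a)
    *: e 1 + (b / a) ^+ 2 *: e ord_max).
    rewrite vE !scalerDr !scalerA !addrA;
      congr (_ *: _ + _ *: _ + _ *: _ + _ *: _ + _ *: _); by field.
  by rewrite memvD ?memvZ.
have [xK _ _ _] := genP xg; apply: Kline_point xK _ _; first
  by rewrite dim_vline v0.
by rewrite -memvE.
Qed.

End Directrix.

End SolidSections.

(** * The quadratic extension *)

Section QuadraticExtension.

Variables (F E : finFieldType) (iota : {rmorphism F -> E}).
Hypothesis card_E : #|E| = (#|F| ^ 2)%N.

(** The number w' is the conjugate of w, obtained from the equation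
    w^2 = y w + x as y - w.  It differs from w: if 2 is invertible, w = y / 2
    would be in F, and in characteristic 2 one would have w^2 = x, which is the
    square of an element of F because squaring is injective on F. *)
Lemma quadratic_basis : exists w w' : E, exists T N : F,
  [/\ forall z, exists a b, z = iota a + iota b * w,
      forall a b, iota a + iota b * w = 0 -> a = 0 /\ b = 0,
      w + w' = iota T, w * w' = iota N & w != w'].
Proof.
have F1 : (1 < #|F|)%N := finNzRing_gt1 F.
have [w wF] : exists w, w \notin codom iota.
  apply/existsP; apply: contraTT F1; rewrite negb_exists => /forallP all_in.
  have : (#|E| <= #|F|)%N.
    rewrite -(size_codom iota) -cardsT; apply: leq_trans (card_size _).
    apply/subset_leq_card/subsetP=> z _; have := all_in z; by rewrite negbK.
  rewrite card_E; move: #|F| => n; clear; nia.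
have w_free a b : iota a + iota b * w = 0 -> a = 0 /\ b = 0.
  have [-> | b0] := eqVneq b 0.
    by rewrite rmorph0 mul0r addr0 => /eqP; rewrite fmorph_eq0 => /eqP.
  move=> e; case/negP: wF; apply/codomP; exists (- a / b).
  have ib : iota b != 0 by rewrite fmorph_eq0.
  by apply: (mulfI ib); rewrite fmorph_div rmorphN [RHS]mulrC divfK // (addr0_eq
    e).
pose phi (p : F * F) := iota p.1 + iota p.2 * w.
have phi_inj : injective phi.
  move=> [a b] [c d]; rewrite /phi /= => e.
  have /w_free[/subr0_eq-> /subr0_eq->] // :
    iota (a - c) + iota (b - d) * w = 0.
  by rewrite !rmorphB mulrBl addrACA e -opprD subrr.
have w_span z : exists a b, z = iota a + iota b * w.
  have := inj_card_onto phi_inj; rewrite card_prod card_E -mulnn leqnn =>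
    /(_ isT z).
  by move/codomP=> [[a b] ->]; exists a, b.
have [x [y w2]] := w_span (w * w).
exists w, (iota y - w), y, (- x); split=> //; first by rewrite addrC subrK.
  by rewrite mulrBr w2 rmorphN mulrC opprD addrCA subrr addr0.
apply/negP=> /eqP ww; have e : iota y = w *+ 2
  by rewrite mulr2n {2}ww addrC subrK.
have [two | two] := eqVneq (2%:R : F) 0; last first.
  case/negP: wF; apply/codomP; exists (y / 2%:R).
  have i2 : (2%:R : E) != 0 by rewrite -(rmorph_nat iota) fmorph_eq0.
  by apply: (mulIf i2); rewrite fmorph_div e rmorph_nat divfK // mulr_natr.
have two' : (2%:R : E) = 0 by rewrite -(rmorph_nat iota) two rmorph0.
have y0 : y = 0.
  by apply/eqP; rewrite -(fmorph_eq0 iota) e -mulr_natr two' mulr0.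
have sq_inj : injective (fun a : F => a ^+ 2).
  move=> a b ab; apply/eqP; rewrite -subr_eq0 -sqrf_eq0.
  have -> : (a - b) ^+ 2 = (a ^+ 2 - b ^+ 2) + 2%:R * (b ^+ 2 - a * b) by ring.
  by rewrite ab subrr two mul0r addr0.
have [n xn] : exists n, x = n ^+ 2.
  by have := inj_card_onto sq_inj (leqnn _) x; move/codomP=> [n ->]; exists n.
case/negP: wF; apply/codomP; exists n; apply/eqP; rewrite -subr_eq0 -sqrf_eq0.
have -> : (w - iota n) ^+ 2 = w * w - iota n ^+ 2 + 2%:R * (iota n ^+ 2 - w *
  iota n) by ring.
by rewrite two' mul0r addr0 w2 y0 rmorph0 mul0r addr0 xn rmorphXn subrr.
Qed.

End QuadraticExtension.

(** * A linear model of the Bruck-Bose correspondence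

    The map psi identifies the F-space V with the set of vectors of E^3 whose last
    coordinate is in F.  The E-span and the preimage under psi are then mutually
    inverse between points and lines of PG(2, E) and those of the Bruck-Bose
    plane. *)

Section BruckBose.

Variables (F E : finFieldType) (iota : {rmorphism F -> E}) (V : vectType F).
Variables (psi : V -> 'rV[E]_3) (w : E).
Hypothesis dimV : \dim {:V} = 5%N.
Hypothesis card_E : #|E| = (#|F| ^ 2)%N.
Hypothesis psiD : forall u v, psi (u + v) = psi u + psi v.
Hypothesis psiZ : forall k v, psi (k *: v) = iota k *: psi v.
Hypothesis psi_inj : injective psi.
Hypothesis psi_last : forall v, exists k, psi v 0 ord_max = iota k.
Hypothesis psi_onto : forall (u : 'rV[E]_3) k, u 0 ord_max = iota k -> exists v,
  psi v = u.
Hypothesis w_span : forall z, exists a b, z = iota a + iota b * w.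
Hypothesis w_free : forall a b, iota a + iota b * w = 0 -> a = 0 /\ b = 0.

Implicit Types (U L P : {vspace V}) (v : V) (W : {vspace 'rV[E]_3}) (u :
  'rV[E]_3).

Lemma psi0 : psi 0 = 0.
Proof. by rewrite -(scale0r (0 : V)) psiZ rmorph0 scale0r. Qed.

Lemma psi_eq0 v : (psi v == 0) = (v == 0).
Proof. by rewrite -psi0 (inj_eq psi_inj). Qed.

Lemma psiB (x y : V) : psi (x - y) = psi x - psi y.
Proof. by rewrite psiD -scaleN1r psiZ rmorphN rmorph1 scaleN1r. Qed.

Lemma psi_sum (I : finType) (A : pred I) (f : I -> V) :
  psi (\sum_(i | A i) f i) = \sum_(i | A i) psi (f i).
Proof. exact: (big_morph psi psiD psi0). Qed.

Definition Espan U : {vspace 'rV[E]_3} := <<[seq psi v | v <- vbasis U]>>%VS.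

Lemma mem_Espan U v : v \in U -> psi v \in Espan U.
Proof.
move=> /coord_vbasis ->; rewrite psi_sum; apply: rpred_sum => i _.
rewrite psiZ memvZ // memv_span // map_f // mem_nth // size_tuple //.
Qed.

Lemma Espan_subP U W : reflect (forall v, v \in U ->
  psi v \in W) (Espan U <= W)%VS.
Proof.
apply: (iffP idP) => [sub v vU | sub];
  first exact: (subvP sub _ (mem_Espan vU)).
by apply/span_subvP=> _ /mapP[v vU ->]; apply: sub; apply: vbasis_mem.
Qed.

(** The preimage of W under psi, as the largest subspace whose E-span is contained
    in W. *)
Definition psi_preim W : {vspace V} :=
  (\sum_(U : {vspace V} | (Espan U <= W)%VS) U)%VS.

Lemma mem_psi_preim W v : (v \in psi_preim W) = (psi v \in W).
Proof.
apply/idP/idP=> [/memv_sumP[vs vsU ->] | vW].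
  rewrite psi_sum; apply: rpred_sum => U UW.
  by move/Espan_subP: (UW); apply; apply: vsU.
rewrite memvE; apply: (sumv_sup <[v]>%VS) => //.
by apply/Espan_subP=> _ /vlineP[k ->]; rewrite psiZ memvZ.
Qed.

Lemma Espan_mono U1 U2 : (U1 <= U2)%VS -> (Espan U1 <= Espan U2)%VS.
Proof. by move=> /subvP sub; apply/Espan_subP=> v /sub/mem_Espan. Qed.

Lemma psi_normalise u : exists v z, u = z *: psi v /\
  (u 0 ord_max = 0 -> z = 1).
Proof.
have [uz | uz] := eqVneq (u 0 ord_max) 0.
  have [|v vu] := @psi_onto u 0; first by rewrite uz rmorph0.
  by exists v, 1; rewrite scale1r vu.
have [|v vu] := @psi_onto ((u 0 ord_max)^-1 *: u) 1.
  by rewrite mxE mulVf // rmorph1.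
exists v, (u 0 ord_max); split; last by move=> uz'; rewrite uz' eqxx in uz.
by rewrite vu scalerA divff // scale1r.
Qed.

(** W is spanned over E by its vectors in the image of psi.  This one identity
    makes both maps of the incidence isomorphism injective and surjective. *)
Lemma psi_preimK W : Espan (psi_preim W) = W.
Proof.
apply/eqP; rewrite eqEsubv; apply/andP; split.
  by apply/Espan_subP=> v; rewrite mem_psi_preim.
apply/subvP=> u uW; have [v [z [uE _]]] := psi_normalise u.
have [z0 | z0] := eqVneq z 0; first by rewrite uE z0 scale0r mem0v.
rewrite uE memvZ // mem_Espan // mem_psi_preim.
by rewrite -[psi v](scalerK z0) -uE memvZ.
Qed.

Lemma psi_preim_sub W1 W2 : (psi_preim W1 <= psi_preim W2)%VS = (W1 <= W2)%VS.
Proof.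
apply/idP/idP=> [/Espan_mono | /subvP sub]; first by rewrite !psi_preimK.
by apply/subvP=> v; rewrite !mem_psi_preim => /sub.
Qed.

Lemma psi_preim_inj : injective psi_preim.
Proof. exact: can_inj psi_preimK. Qed.

Definition line_at_infinity : {vspace 'rV[E]_3} :=
  <<[:: (delta_mx 0 0)%R; (delta_mx 0 1)%R]>>%VS.

Lemma mem_linf u : (u \in line_at_infinity) = (u 0 ord_max == 0).
Proof.
rewrite /line_at_infinity span_cons span_seq1; apply/idP/eqP.
  case/memv_addP=> _ /vlineP[a ->] [_ /vlineP[b ->] ->].
  by rewrite !mxE /= !mulr0 addr0.
move=> u0; have -> : u = u 0 0 *: delta_mx 0 0 + u 0 1 *: delta_mx 0 1.
  apply/rowP=> i; rewrite !mxE; case: (unliftP 0 i) => [j|] ->.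
    case: (unliftP 0 j) => [k|] ->; rewrite /= ?mulr0 ?mulr1 ?add0r.
      by rewrite -[RHS]u0; congr (u 0 _); apply: val_inj; rewrite ord1.
    by congr (u 0 _); apply: val_inj.
  by rewrite /= mulr1 mulr0 addr0.
by apply: memv_add; rewrite memvZ ?memv_line.
Qed.

Lemma dim_linf : \dim line_at_infinity = 2%N.
Proof.
rewrite /line_at_infinity span_cons span_seq1 addvC dim_addv_line ?dim_vline.
  suff -> : (delta_mx 0 1 : 'rV[E]_3) != 0 by [].
  by apply/negP=> /eqP/rowP/(_ 1)/eqP; rewrite !mxE /= oner_eq0.
by apply/negP=> /vlineP[k /rowP/(_ 0)/eqP]; rewrite !mxE /= mulr0 oner_eq0.
Qed.

Lemma dim3 : \dim {:'rV[E]_3} = 3%N.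
Proof. by rewrite dimvf dim_matrix. Qed.

Definition Sigma := psi_preim line_at_infinity.

Lemma dim_preim_affine W : ~~ (W <= line_at_infinity)%VS ->
  \dim (psi_preim W) = (\dim (psi_preim (W :&: line_at_infinity)%VS)).+1.
Proof.
case/subvPn=> u uW; rewrite mem_linf => uz.
have [|v vu] := @psi_onto ((u 0 ord_max)^-1 *: u) 1.
  by rewrite mxE mulVf // rmorph1.
have vz : psi v 0 ord_max = 1 by rewrite vu mxE mulVf.
have vW : v \in psi_preim W by rewrite mem_psi_preim vu memvZ.
rewrite -(@dim_addv_line _ _ _ v); last first.
  by rewrite mem_psi_preim memv_cap mem_linf vz oner_eq0 andbF.
congr (\dim _); apply/eqP;
  rewrite eqEsubv subv_add -memvE vW psi_preim_sub capvSl !andbT.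
apply/subvP=> x xW; have [k xk] := psi_last x.
rewrite -[x](subrK (k *: v)); apply: memv_add; last by rewrite memvZ ?memv_line.
rewrite mem_psi_preim memv_cap -mem_psi_preim rpredB ?memvZ //= mem_linf psiB
  psiZ !mxE vz xk mulr1.
by rewrite subrr.
Qed.

Lemma dim_Sigma : \dim Sigma = 4%N.
Proof.
have nle : ~~ ({:'rV[E]_3} <= line_at_infinity)%VS.
  by apply/negP=> /dimvS; rewrite dim3 dim_linf.
have := dim_preim_affine nle; rewrite capfv -/Sigma.
suff -> : psi_preim {:'rV[E]_3} = fullv by rewrite dimV => -[].
by apply/eqP; rewrite eqEsubv subvf; apply/subvP=> v _;
  rewrite mem_psi_preim memvf.
Qed.

Lemma dim_preim_inf u : u != 0 -> u \in line_at_infinity ->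
  \dim (psi_preim <[u]>%VS) = 2%N.
Proof.
move=> u0; rewrite mem_linf => /eqP uz.
have [|v1 e1] := @psi_onto u 0; first by rewrite uz rmorph0.
have [|v2 e2] := @psi_onto (w *: u) 0; first by rewrite mxE uz mulr0 rmorph0.
have -> : psi_preim <[u]>%VS = (<[v1]> + <[v2]>)%VS.
  apply/eqP; rewrite eqEsubv subv_add -!memvE !mem_psi_preim e1 e2 memvZ
    ?memv_line ?andbT //.
  apply/subvP=> v; rewrite mem_psi_preim => /vlineP[z vz]; have [a [b zE]] :=
    w_span z.
  have -> : v = a *: v1 + b *: v2.
    by apply: psi_inj; rewrite psiD !psiZ e1 e2 scalerA -scalerDl -zE.
  by apply: memv_add; rewrite memvZ ?memv_line.
rewrite dim_addv_line ?dim_vline; first by rewrite -psi_eq0 e1 u0.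
apply/negP=> /vlineP[k kE]; have : (iota (- k) + iota 1 * w) *: u = 0.
  by rewrite scalerDl rmorphN rmorph1 mul1r -e2 kE psiZ e1 scaleNr addNr.
move/eqP; rewrite scaler_eq0 (negPf u0) orbF => /eqP/w_free[_ /eqP].
by rewrite oner_eq0.
Qed.

(** The E-points of the line at infinity, considered as lines over F: the classical
    construction of a regular spread. *)
Definition spread : {set {vspace V}} := psi_preim @: points_of line_at_infinity.

Lemma spreadP L : L \in spread -> exists u,
  [/\ u != 0, u \in line_at_infinity & L = psi_preim <[u]>%VS].
Proof. by case/imsetP=> _ /points_pick[u [u0 -> ul]] ->; exists u. Qed.

Lemma mem_spread u : u != 0 -> u \in line_at_infinity ->
  psi_preim <[u]>%VS \in spread.
Proof. by move=> u0 ul; apply: imset_f; rewrite line_in_points. Qed.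

Lemma spread_line_spread : line_spread Sigma spread.
Proof.
split.
- move=> _ /spreadP[u [u0 ul ->]]; rewrite dim_preim_inf //; split=> //.
  by rewrite psi_preim_sub -memvE.
- rewrite card_imset; last exact: psi_preim_inj.
  by rewrite (card_points2 dim_linf) /field_order card_E addn1.
move=> P /points_pick[v [v0 -> vS]]; rewrite mem_psi_preim in vS.
exists (psi_preim <[psi v]>%VS); split.
  by split; [apply: mem_spread;
    rewrite ?psi_eq0 | rewrite -memvE mem_psi_preim memv_line].
move=> L [/spreadP[u [u0 ul ->]]]; rewrite -memvE mem_psi_preim => vu.
by congr psi_preim; apply: memv_line_sym; rewrite ?psi_eq0.
Qed.

Lemma vec_indep u1 u2 (z1 z2 : E) : u1 != 0 -> u2 \notin <[u1]>%VS ->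
  z1 *: u1 + z2 *: u2 = 0 ->
  z1 = 0 /\ z2 = 0.
Proof.
move=> u10 u12 e; have z20 : z2 = 0.
  apply/eqP; apply: contraNT u12 => z20; rewrite -[u2](scalerK z20) memvZ //.
  have -> : z2 *: u2 = - z1 *: u1 by rewrite scaleNr -(addr0_eq e).
  by rewrite memvZ ?memv_line.
move: e; rewrite z20 scale0r addr0 => /eqP.
by rewrite scaler_eq0 (negPf u10) orbF => /eqP.
Qed.

(** Any three points of a projective line are (1,0), (0,1), (1,1) in suitable
    coordinates. *)
Lemma spread_coordinates L1 L2 L3 : L1 \in spread -> L2 \in spread ->
  L3 \in spread ->
  L1 <> L2 -> L1 <> L3 -> L2 <> L3 ->
  exists a b : 'rV[E]_3, [/\ a \in line_at_infinity, b \in line_at_infinity,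
    a != 0, b \notin <[a]>%VS &
    [/\ L1 = psi_preim <[a]>%VS,
      L2 = psi_preim <[b]>%VS & L3 = psi_preim <[a + b]>%VS]].
Proof.
move=> /spreadP[u1 [u10 u1l ->]] /spreadP[u2 [u20 u2l ->]] /spreadP[u3 [u30 u3l
  ->]] n12 n13 n23.
have lineZ z (u : 'rV[E]_3) : z != 0 -> <[z *: u]>%VS = <[u]>%VS.
  move=> z0; apply/eqP; rewrite eqEsubv -!memvE memvZ ?memv_line //.
  by rewrite -[X in X \in _](scalerK z0) memvZ ?memv_line.
have notin (x y : 'rV[E]_3) : x != 0 ->
  psi_preim <[y]>%VS <> psi_preim <[x]>%VS -> x \notin <[y]>%VS.
  by move=> x0 ne; apply/negP=> /(memv_line_sym x0) e; apply: ne; rewrite e.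
have u21 : u2 \notin <[u1]>%VS by apply: notin.
have : u3 \in (<[u1]> + <[u2]>)%VS.
  suff -> : (<[u1]> + <[u2]>)%VS = line_at_infinity by [].
  apply/eqP; rewrite eqEdim subv_add -!memvE u1l u2l dim_linf.
  by rewrite dim_addv_line ?dim_vline ?u10.
case/memv_addP=> _ /vlineP[a ->] [_ /vlineP[b ->] u3E].
have a0 : a != 0.
  apply/negP=> /eqP a0; move: u3E; rewrite a0 scale0r add0r => u3E.
  by apply: n23; congr psi_preim; rewrite u3E lineZ //; apply: contraNneq u30 =>
    b0; rewrite u3E b0 scale0r.
have b0 : b != 0.
  apply/negP=> /eqP b0; move: u3E; rewrite b0 scale0r addr0 => u3E.
  by apply: n13; congr psi_preim; rewrite u3E lineZ.
exists (a *: u1), (b *: u2); rewrite -u3E !lineZ //.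
split=> //; try by rewrite memvZ.
  by rewrite scaler_eq0 negb_or a0.
by apply: contra u21 => bu; rewrite -[u2](scalerK b0) memvZ.
Qed.

(** Let the three lines be the E-lines of a, b and a + b.  For z in E the F-space
    spanned by z a and z b is a transversal of them.  A line L of the regulus
    meets those for z = 1, w and 1 + w, in vectors z (x a + y b) with x, y in F.
    The third is a combination of the first two, and comparing coefficients
    over the basis 1, w shows that the pairs (x, y) are proportional.  So L is the
    E-line of x a + y b. *)
Lemma spread_regular : regular_spread Sigma spread.
Proof.
split; first exact: spread_line_spread.
move=> L1 L2 L3 S1 S2 S3 n12 n13 n23.
have [a [b [al bl a0 ba [-> -> ->]]]] :=
  spread_coordinates S1 S2 S3 n12 n13 n23.
apply/subsetP=> L; rewrite inE => /andP[/eqP dL /forallP trans].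
have b0 : b != 0 by apply: contraNneq ba => ->; rewrite mem0v.
have indep := vec_indep a0 ba.
have pre u : u \in line_at_infinity -> exists v, psi v = u.
  by rewrite mem_linf => /eqP u0; apply: (@psi_onto u 0); rewrite u0 rmorph0.
have meet z : z != 0 -> exists v x y,
  [/\ v != 0, v \in L & psi v = (z * iota x) *: a + (z * iota y) *: b].
  move=> z0; have [p pE] := pre (z *: a) (memvZ _ al); have [q qE] :=
    pre (z *: b) (memvZ _ bl).
  have p0 : p != 0 by rewrite -psi_eq0 pE scaler_eq0 negb_or z0.
  have q0 : q != 0 by rewrite -psi_eq0 qE scaler_eq0 negb_or z0.
  have qp : q \notin <[p]>%VS.
    apply/negP=> /vlineP[k qk]; case/negP: ba; apply/vlineP; exists (iota k).
    by apply: (scalerI z0); rewrite -qE qk psiZ pE !scalerA mulrC.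
  have meets_at (U1 U2 : {vspace V}) v : v != 0 -> v \in U1 -> v \in U2 ->
    meets U1 U2.
    by move=> v0 v1 v2; apply: contraNneq v0 => e;
      rewrite -memv0 -e memv_cap v1.
  have pT : p \in (<[p]> + <[q]>)%VS by rewrite (subvP (addvSl _ _)) ?memv_line.
  have qT : q \in (<[p]> + <[q]>)%VS by rewrite (subvP (addvSr _ _)) ?memv_line.
  have pq0 : p + q != 0 by apply: contraNneq qp => /addr0_eq <-;
    rewrite memvN memv_line.
  have m1 : meets (<[p]> + <[q]>)%VS (psi_preim <[a]>%VS).
    by apply: (meets_at _ _ p); rewrite // mem_psi_preim pE memvZ ?memv_line.
  have m2 : meets (<[p]> + <[q]>)%VS (psi_preim <[b]>%VS).
    by apply: (meets_at _ _ q); rewrite // mem_psi_preim qE memvZ ?memv_line.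
  have m3 : meets (<[p]> + <[q]>)%VS (psi_preim <[a + b]>%VS).
    apply: (meets_at _ _ (p + q)) => //; first exact: memvD.
    rewrite mem_psi_preim psiD pE qE -scalerDr.
    by rewrite memvZ ?memv_line.
  have := trans (<[p]> + <[q]>)%VS.
  rewrite dim_addv_line // dim_vline p0 eqxx m1 m2 m3 /=.
  rewrite /meets -vpick0 => v0; have := memv_pick ((<[p]> + <[q]>) :&: L)%VS.
  rewrite memv_cap => /andP[/memv_addP[_ /vlineP[x ->] [_ /vlineP[y ->] vE]]
    vL].
  exists (vpick ((<[p]> + <[q]>) :&: L)%VS), x, y; split=> //.
  by rewrite vE psiD !psiZ pE qE !scalerA ![iota _ * _]mulrC.
have w0 : w != 0.
  by apply/negP=> /eqP w0; have [|_ /eqP] := @w_free 0 1;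
    rewrite ?rmorph0 ?w0 ?mulr0 ?add0r // oner_eq0.
have w1 : 1 + w != 0.
  apply/negP=> /eqP w1; have [|_ /eqP] := @w_free 1 1; last by rewrite oner_eq0.
  by rewrite !rmorph1 mul1r.
have [v1 [x1 [y1 [v10 v1L v1E]]]] := meet 1 (oner_neq0 _).
have [v2 [x2 [y2 [v20 v2L v2E]]]] := meet w w0.
have [v3 [x3 [y3 [v30 v3L v3E]]]] := meet (1 + w) w1.
rewrite !mul1r in v1E.
have cmp (z1 z2 z3 z4 : E) : z1 *: a + z2 *: b = z3 *: a + z4 *: b -> z1 = z3 /\
  z2 = z4.
  move=> e; have [|h1 h2] := indep (z1 - z3) (z2 - z4).
    by rewrite !scalerBl addrACA e -opprD subrr.
  by split; apply: subr0_eq.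
have split_iota (c d : F) : iota c = w * iota d -> c = 0 /\ d = 0.
  move=> e; have [|c0 d0] := @w_free c (- d); first
    by rewrite rmorphN mulNr [_ * w]mulrC e subrr.
  by split=> //; rewrite -[d]opprK d0 oppr0.
have v2v1 : v2 \notin <[v1]>%VS.
  apply/negP=> /vlineP[k kE]; have := v2E;
    rewrite {1}kE psiZ v1E scalerDr !scalerA -!rmorphM.
  case/cmp=> /split_iota[_ x20] /split_iota[_ y20].
  move: v2E; rewrite x20 y20 rmorph0 mulr0 !scale0r addr0 => /eqP.
  by rewrite psi_eq0 (negPf v20).
have LE : (<[v1]> + <[v2]>)%VS = L.
  by apply/eqP; rewrite eqEdim subv_add -!memvE v1L v2L dL dim_addv_line //
    dim_vline v10.
have /memv_addP[_ /vlineP[k ->] [_ /vlineP[m ->] v3k]] :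
  v3 \in (<[v1]> + <[v2]>)%VS by rewrite LE.
have := v3E; rewrite {1}v3k psiD !psiZ v1E v2E !scalerDr !scalerA addrACA
  -!scalerDl.
have solve x y z : iota k * iota x + iota m * (w * iota y) = (1 + w) * iota z ->
  z = k * x /\ z = m * y.
  move=> e; have [|h1 h2] := split_iota (k * x - z) (z - m * y).
    by rewrite !rmorphB !rmorphM mulrBr; apply/eqP;
      rewrite -subr_eq0 -(subrr ((1 + w) * iota z)) -{1}e; apply/eqP; ring.
  by split; [apply/esym/subr0_eq | apply: subr0_eq].
case/cmp=> /solve[x3k x3m] /solve[y3k y3m].
have xy3 : (x3 != 0) || (y3 != 0).
  apply: contraNT v30; rewrite negb_or !negbK => /andP[/eqP x30 /eqP y30].
  by rewrite -psi_eq0 v3E x30 y30 rmorph0 mulr0 !scale0r addr0.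
have m0 : m != 0.
  by apply: contraTneq xy3 => m0; rewrite x3m y3m m0 !mul0r eqxx.
have psi2 : psi v2 = (w * iota (k / m)) *: psi v1.
  rewrite v2E v1E scalerDr !scalerA -!mulrA -!rmorphM.
  by congr (_ * iota _ *: _ + _ * iota _ *: _); apply: (mulfI m0);
    rewrite -?x3m -?y3m ?x3k ?y3k; field.
have u0 : psi v1 != 0 by rewrite psi_eq0.
have ul : psi v1 \in line_at_infinity by rewrite v1E memvD // memvZ.
suff -> : L = psi_preim <[psi v1]>%VS by apply: mem_spread.
apply/eqP; rewrite eqEdim dL dim_preim_inf // andbT -LE subv_add -!memvE
  !mem_psi_preim psi2.
by rewrite memvZ memv_line.
Qed.

Lemma bb_pointsE : bb_points Sigma spread = psi_preim @: pg2_points E.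
Proof.
apply/setP=> P; apply/setUP/imsetP=>
  [[/setDP[]|] | [_ /points_pick[u [u0 -> _]] ->]].
- move=> /points_pick[v [v0 -> _]]; rewrite line_in_points // mem_psi_preim =>
  vl.
  exists <[psi v]>%VS; first by rewrite line_in_points ?psi_eq0 // memvf.
  apply/eqP; rewrite eqEdim -memvE mem_psi_preim memv_line dim_vline v0.
  rewrite dim_preim_affine -?memvE // capv_point ?dim_vline ?psi_eq0 ?v0 -?memvE
    //.
  rewrite (_ : psi_preim 0 = 0%VS) ?dimv0 //; apply/vspaceP=> x.
  by rewrite mem_psi_preim !memv0 psi_eq0.
- move=> /spreadP[u [u0 ul ->]]; exists <[u]>%VS => //.
  by rewrite line_in_points // memvf.
have [ul | ul] := boolP (u \in line_at_infinity); first by right;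
  apply: mem_spread.
left; apply/setDP; rewrite !inE subvf andbT psi_preim_sub -memvE (negPf ul)
  andbF; split=> //.
rewrite dim_preim_affine -?memvE // capv_point ?dim_vline ?u0 -?memvE //.
rewrite (_ : psi_preim 0 = 0%VS) ?dimv0 //; apply/vspaceP=> x.
by rewrite mem_psi_preim !memv0 psi_eq0.
Qed.

Lemma dim_affine_line W : \dim W = 2%N -> W != line_at_infinity ->
  exists u, [/\ u != 0, u \in line_at_infinity,
    (W :&: line_at_infinity)%VS = <[u]>%VS & ~~ (W <= line_at_infinity)%VS].
Proof.
move=> dW Wl; have nle : ~~ (W <= line_at_infinity)%VS.
  by apply: contra Wl => le; rewrite eqEdim le dW dim_linf.
have d1 : \dim (W :&: line_at_infinity)%VS = 1%N.
  apply/eqP; rewrite eqn_leq line_capP //=.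
  have := dimv_sum_cap W line_at_infinity; have :
    (\dim (W + line_at_infinity) <= 3)%N
    by apply: leq_trans (dimvS (subvf _)) _; rewrite dim3.
  by rewrite dW dim_linf; move: (\dim _) (\dim _); clear; lia.
have [u u0 uE] := pointP d1; exists u; split=> //.
by have : (<[u]> <= line_at_infinity)%VS by rewrite -uE capvSr.
Qed.

(** A plane that contains the spread line of u and an affine vector v has the same
    dimension as the preimage of the E-line spanned by u and psi v, which contains
    it. *)
Lemma bb_linesE : bb_lines Sigma spread = psi_preim @: pg2_lines E.
Proof.
apply/setP=> U; apply/setU1P/imsetP=> [[-> | ] | [W]].
- by exists line_at_infinity; rewrite // inE dim_linf.
- rewrite inE => /and3P[/eqP dU /subvPn[v vU vS] /existsP[L /andP[LS LU]]].
  have [u [u0 ul LE]] := spreadP LS.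
  rewrite mem_psi_preim in vS.
  have vu : psi v \notin <[u]>%VS by apply: contra vS => /vlineP[k ->];
    apply: memvZ.
  have dW : \dim (<[u]> + <[psi v]>)%VS = 2%N
    by rewrite dim_addv_line ?dim_vline ?u0.
  exists (<[u]> + <[psi v]>)%VS; first by rewrite inE dW.
  have nle : ~~ (<[u]> + <[psi v]> <= line_at_infinity)%VS
    by rewrite subv_add -!memvE (negPf vS) andbF.
  have [|u' [u'0 u'l u'E _]] := dim_affine_line dW; first
    by apply: contraNneq nle => ->.
  apply/eqP; rewrite eqEdim dU dim_preim_affine // u'E dim_preim_inf // andbT.
  have vL : v \notin L by rewrite LE mem_psi_preim.
  have -> : U = (L + <[v]>)%VS.
    apply/esym/eqP; rewrite eqEdim subv_add LU -memvE vU dim_addv_line // LE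
      dim_preim_inf // dU //.
  by rewrite subv_add LE psi_preim_sub addvSl -memvE mem_psi_preim (subvP
    (addvSr _ _)) ?memv_line.
rewrite inE => /eqP dW ->; have [-> | Wl] := eqVneq W line_at_infinity; first
  by left.
right; have [u [u0 ul uE nle]] := dim_affine_line dW Wl.
rewrite inE dim_preim_affine // uE dim_preim_inf // eqxx psi_preim_sub nle /=.
by apply/existsP; exists (psi_preim <[u]>%VS);
  rewrite mem_spread // psi_preim_sub -uE capvSl.
Qed.

Lemma bb_iso : incidence_iso (bb_points Sigma spread) (bb_lines Sigma spread)
  (pg2_points E) (pg2_lines E) Espan Espan.
Proof.
rewrite bb_pointsE bb_linesE.
have inj (A : {set {vspace 'rV[E]_3}}) :
  {in psi_preim @: A &, injective Espan} /\ Espan @: (psi_preim @: A) = A.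
  split=> [_ _ /imsetP[W _ ->] /imsetP[W' _ ->]|]; first by rewrite !psi_preimK
    => ->.
  rewrite -imset_comp -[RHS]imset_id; apply: eq_imset => W /=;
    exact: psi_preimK.
split; try exact: inj.
by move=> _ _ /imsetP[W _ ->] /imsetP[W' _ ->];
  rewrite !psi_preimK psi_preim_sub.
Qed.

End BruckBose.

(** * Ruled cubic surfaces as tangent Baer subplanes

    With t = a + b w and conjugate t', the point of K with parameters a, b, s, r
    receives the coordinates (s t, r t^2, r t t').  Over E this is proportional to
    (s, r t, r t'), and the vectors (s, t, t') with s in F and t in E form an
    F-subspace of dimension 3 that spans E^3: a Baer subplane.  The last
    coordinate vanishes only for t = 0, at the single point (1, 0, 0), whose spread
    line is the directrix. *)

Section RuledCubic.

Variables (F E : finFieldType) (iota : {rmorphism F -> E}) (V : vectType F).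
Variables (w w' : E) (T N : F).
Hypothesis dimV : \dim {:V} = 5%N.
Hypothesis card_E : #|E| = (#|F| ^ 2)%N.
Hypothesis w_span : forall z, exists a b, z = iota a + iota b * w.
Hypothesis w_free : forall a b, iota a + iota b * w = 0 -> a = 0 /\ b = 0.
Hypothesis wT : w + w' = iota T.
Hypothesis wN : w * w' = iota N.
Hypothesis w_neq : w != w'.

Variable X : 5.-tuple V.
Hypothesis X_free : free X.

Definition row3 (x y z : E) : 'rV[E]_3 := \row_i [:: x; y; z]`_i.

Lemma row3_eq x y z x' y' z' : x = x' -> y = y' -> z = z' ->
  row3 x y z = row3 x' y' z'.
Proof. by move=> -> -> ->. Qed.

Lemma row3_inj x y z x' y' z' : row3 x y z = row3 x' y' z' ->
  [/\ x = x', y = y' & z = z'].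
Proof.
by move/rowP=> e; have := e 0; have := e 1; have := e ord_max; rewrite !mxE /=.
Qed.

Lemma row3D x y z x' y' z' :
  row3 x y z + row3 x' y' z' = row3 (x + x') (y + y') (z + z').
Proof. by apply/rowP=> -[[|[|[|i]]] lt] //; rewrite !mxE. Qed.

Lemma row3Z k x y z : k *: row3 x y z = row3 (k * x) (k * y) (k * z).
Proof. by apply/rowP=> -[[|[|[|i]]] lt] //; rewrite !mxE. Qed.

Lemma row3_0 : row3 0 0 0 = 0.
Proof. by apply/rowP=> -[[|[|[|i]]] lt] //; rewrite !mxE. Qed.

Lemma row3_eta (u : 'rV[E]_3) : u = row3 (u 0 0) (u 0 1) (u 0 ord_max).
Proof. by apply/rowP=> -[[|[|[|i]]] lt] //; rewrite !mxE /=; congr (u 0 _);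
  apply: val_inj. Qed.

Notation x_ i v := (coord X (inord i) v).

(** With y = x3 + x4 w, the second coordinate equals x2 + 2 w x3 + w^2 x4, the
    F-linear function that takes the value t^2 at x2 = a^2, x3 = a b, x4 = b^2;
    the form z + (w - w') y makes it evident that psi is a bijection onto the
    vectors with last coordinate in F.  The last coordinate is similarly the
    linear function with value t t'. *)
Definition psi (v : V) : 'rV[E]_3 :=
  let z := iota (x_ 2 v + T * x_ 3 v + N * x_ 4 v) in
  row3 (iota (x_ 0 v) + iota (x_ 1 v) * w)
       (z + (w - w') * (iota (x_ 3 v) + iota (x_ 4 v) * w)) z.

Lemma psiD u v : psi (u + v) = psi u + psi v.
Proof. by rewrite row3D; apply: row3_eq;
  rewrite !linearD /= !(rmorphD, rmorphM); ring. Qed.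

Lemma psiZ k v : psi (k *: v) = iota k *: psi v.
Proof. by rewrite row3Z; apply: row3_eq;
  rewrite !linearZ /= !(rmorphD, rmorphM); ring. Qed.

Lemma X_full : <<X>>%VS = fullv.
Proof. by apply/eqP; rewrite eqEdim subvf dimV (eqP X_free) size_tuple. Qed.

Definition cvec (c : 'I_5 -> F) : V := \sum_i c i *: X`_i.
Definition vec5 (a b c d e : F) : V := cvec (fun i => [:: a; b; c; d; e]`_i).

Lemma x_vec5 a b c d e : [/\ x_ 0 (vec5 a b c d e) = a,
  x_ 1 (vec5 a b c d e) = b,
   x_ 2 (vec5 a b c d e) = c,
     x_ 3 (vec5 a b c d e) = d & x_ 4 (vec5 a b c d e) = e].
Proof. by split; rewrite coord_sum_free // inordK. Qed.

Lemma vec5_eta v : v = vec5 (x_ 0 v) (x_ 1 v) (x_ 2 v) (x_ 3 v) (x_ 4 v).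
Proof.
have vX : v \in <<X>>%VS by rewrite X_full memvf.
rewrite {1}(coord_span vX); apply: eq_bigr => -[[|[|[|[|[|i]]]]] lt] _ //=;
  by congr (coord _ _ _ *: _); apply: val_inj; rewrite /= inordK.
Qed.

Lemma w_diff : w - w' != 0.
Proof. by rewrite subr_eq0. Qed.

Lemma psi_inj : injective psi.
Proof.
move=> u v /eqP; rewrite -subr_eq0.
have -> : psi u - psi v = psi (u - v)
  by rewrite -[- v]scaleN1r psiD psiZ rmorphN rmorph1 scaleN1r.
move=> /eqP; rewrite -row3_0 => /row3_inj[/w_free[e0 e1] + e]; rewrite e add0r
  => /eqP.
rewrite mulf_eq0 (negPf w_diff) /= => /eqP/w_free[e3 e4].
move/eqP: e; rewrite fmorph_eq0 e3 e4 !mulr0 !addr0 => /eqP e2.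
apply: subr0_eq; rewrite [LHS]vec5_eta e0 e1 e2 e3 e4 /vec5 /cvec big1 // =>
  -[[|[|[|[|[|i]]]]] lt] _ //=;
  exact: scale0r.
Qed.

Lemma psi_last v : exists k, psi v 0 ord_max = iota k.
Proof. by eexists; rewrite mxE. Qed.

Lemma psi_onto (u : 'rV[E]_3) k : u 0 ord_max = iota k -> exists v, psi v = u.
Proof.
move=> uk; have [a [b ab]] := w_span (u 0 0).
have [p [r pr]] := w_span ((u 0 1 - iota k) / (w - w')).
have [e0 e1 e2 e3 e4] := x_vec5 a b (k - T * p - N * r) p r.
exists (vec5 a b (k - T * p - N * r) p r);
  rewrite [RHS]row3_eta /psi e0 e1 e2 e3 e4.
apply: row3_eq; rewrite ?ab ?uk // -?pr; last by congr (iota _); ring.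
rewrite [(w - w') * _]mulrC divfK ?w_diff // (_ :
  k - T * p - N * r + T * p + N * r = k); last by ring.
by rewrite addrC subrK.
Qed.

Lemma psi_cubic a b s r (t := iota a + iota b * w) (t' :=
  iota a + iota b * w') :
  psi (vec5 (s * a) (s * b) (r * a ^+ 2) (r * a * b) (r * b ^+ 2)) =
  row3 (iota s * t) (iota r * t * t) (iota r * t * t').
Proof.
have [e0 e1 e2 e3 e4] := x_vec5 (s * a) (s * b) (r * a ^+ 2) (r * a * b) (r * b
  ^+ 2).
rewrite /psi e0 e1 e2 e3 e4.
have zE : iota (r * a ^+ 2 + T * (r * a * b) + N * (r * b ^+ 2)) = iota r * t *
  t'.
  by rewrite !rmorphD !rmorphM ?rmorphXn /= -wT -wN /t /t'; ring.
by apply: row3_eq; rewrite ?zE /t /t' ?rmorphM ?rmorphXn; ring.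
Qed.

Definition bvec (s a b : F) : 'rV[E]_3 :=
  row3 (iota s) (iota a + iota b * w) (iota a + iota b * w').

(** Row vectors (s, a, b) over F are mapped to (s, t, t'). *)
Definition baer_mx : 'M[E]_3 :=
  \matrix_(i, j) (nth [::] [:: [:: 1; 0; 0]; [:: 0; 1; 1]; [:: 0; w; w']] i)`_j.

Lemma mul_baer_mx (u : 'rV[E]_3) :
  u *m baer_mx = row3 (u 0 0) (u 0 1 + u 0 ord_max * w) (u 0 1 + u 0 ord_max *
    w').
Proof.
apply/rowP=> j; rewrite !mxE !big_ord_recl big_ord0 !mxE /=.
have -> : lift ord0 ord0 = 1 :> 'I_3 by apply: val_inj.
have -> : lift ord0 (lift ord0 ord0) = ord_max :> 'I_3 by apply: val_inj.
by case: j => -[|[|[|j]]] lt //=; rewrite ?mulr0 ?mulr1 ?addr0 ?add0r.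
Qed.

Lemma baer_mx_unit : baer_mx \in unitmx.
Proof.
rewrite -row_free_unit; apply/inj_row_free => u.
rewrite mul_baer_mx -row3_0 => /row3_inj[u0 e1 e2].
have u2 : u 0 ord_max = 0.
  have : u 0 ord_max * (w - w') = 0.
    by rewrite mulrBr -[LHS]addr0 -[X in _ + X](subrr (u 0 1)) addrACA [_ + u 0
      1]addrC e1 add0r -opprD [_ + u 0 1]addrC e2 oppr0.
  by move/eqP; rewrite mulf_eq0 (negPf w_diff) orbF => /eqP.
by rewrite [u]row3_eta u0 u2; move: e1; rewrite u2 mul0r addr0 => ->.
Qed.

Lemma bvec_eq0 s a b : bvec s a b = 0 -> [/\ s = 0, a = 0 & b = 0].
Proof.
rewrite -row3_0 => /row3_inj[/eqP + /w_free[-> ->] _].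
by rewrite fmorph_eq0 => /eqP ->.
Qed.

Lemma bvec_last s a b : bvec s a b 0 ord_max = 0 -> a = 0 /\ b = 0.
Proof.
rewrite mxE /= => e; have [|e1 e2] := @w_free (a + b * T) (- b).
  rewrite rmorphD rmorphM -wT rmorphN -[RHS]e; ring.
by have b0 : b = 0 by [rewrite -[b]opprK e2 oppr0]; move: e1;
  rewrite b0 mul0r addr0.
Qed.

Definition baer : {set {vspace 'rV[E]_3}} :=
  [set <[(map_mx iota v *m baer_mx)%R]>%VS | v : 'rV[F]_3 & v != 0].

Lemma baerP W : reflect (exists s a b, bvec s a b != 0 /\
  W = <[bvec s a b]>%VS) (W \in baer).
Proof.
have bE (v : 'rV[F]_3) : map_mx iota v *m baer_mx = bvec (v 0 0) (v 0 1) (v 0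
  ord_max).
  by rewrite mul_baer_mx !mxE.
apply: (iffP imsetP) => [[v] | [s [a [b [nz ->]]]]].
  rewrite inE bE => v0 ->; exists (v 0 0), (v 0 1), (v 0 ord_max); split=> //.
  apply: contra v0 => /eqP/bvec_eq0[e0 e1 e2]; apply/eqP/rowP=>
    -[[|[|[|i]]] lt] //.
  - by rewrite mxE -[RHS]e0; congr (v 0 _); apply: val_inj.
  - by rewrite mxE -[RHS]e1; congr (v 0 _); apply: val_inj.
  by rewrite mxE -[RHS]e2; congr (v 0 _); apply: val_inj.
exists (\row_i [:: s; a; b]`_i); last by rewrite bE !mxE.
rewrite inE; apply: contra nz => /eqP/rowP e.
have := e 0; have := e 1; have := e ord_max; rewrite !mxE /= => -> -> ->.
by rewrite /bvec rmorph0 !mul0r addr0 row3_0.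
Qed.

Let line_at_infinity := line_at_infinity E.
Let psi_preim := psi_preim psi.
Let mem_psi_preim W v : (v \in psi_preim W) = (psi v \in W) :=
  mem_psi_preim psiD psiZ W v.

Lemma baer_points : baer \subset pg2_points E.
Proof.
apply/subsetP=> W /baerP[s [a [b [nz ->]]]].
by rewrite line_in_points ?memvf.
Qed.

Lemma baer_tangent : #|baer :&: points_of line_at_infinity| = 1%N.
Proof.
apply/eqP/cards1P; exists <[(bvec 1 0 0)%R]>%VS; apply/setP=> W; rewrite !inE.
have nz : bvec 1 0 0 != 0.
  by apply/negP=> /eqP/bvec_eq0[/eqP]; rewrite oner_eq0.
apply/andP/eqP=> [[/baerP[s [a [b [nz' ->]]]]] /andP[_] | ->].
  rewrite -memvE mem_linf => /eqP/bvec_last[a0 b0].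
  apply: memv_line_sym => //; apply/vlineP; exists (iota s).
  by rewrite a0 b0 row3Z; apply: row3_eq;
    rewrite ?rmorph1 ?rmorph0 ?mulr1 // !mul0r addr0 mulr0.
split; first by apply/baerP; exists 1, 0, 0.
by rewrite dim_vline nz -memvE mem_linf mxE /= !rmorph0 mul0r addr0.
Qed.

Variable K : {set {vspace V}}.
Hypothesis K_points : K \subset points_of fullv.
Hypothesis K_cubic : forall v, v != 0 -> (<[v]>%VS \in K <-> exists a b s r : F,
  v = vec5 (s * a) (s * b) (r * a ^+ 2) (r * a * b) (r * b ^+ 2)).

Lemma conj_neq0 a b : iota a + iota b * w != 0 -> iota a + iota b * w' != 0.
Proof.
apply: contra => /eqP e; have [|-> ->] := @bvec_last 0 a b; first
  by rewrite mxE.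
by rewrite rmorph0 mul0r addr0.
Qed.

(** One inclusion is the proportionality of (s t, r t^2, r t t') and (s, r t, r t').
    Conversely let psi v = z (s, t, t').  If t is nonzero, the last coordinate
    z t' is in F, so z is a multiple of t by the element z t' / (t t') of F, and
    psi v has the required form; if t = 0, the vector v is on the directrix. *)
Lemma bb_set_baer : bb_set (psi_preim @: baer) = K.
Proof.
apply/setP=> P; apply/bigcupP/idP=>
  [[_ /imsetP[W /baerP[s [a [b [nz ->]]]] ->] /points_pick[v [v0 -> vW]]] | PK].
  apply/(K_cubic v0); move: vW; rewrite mem_psi_preim.
  case/vlineP=> z; rewrite row3Z => vz.
  have [t0 | t0] := eqVneq (iota a + iota b * w) 0.
    have [c [d zE]] := w_span z; exists c, d, s, 0; apply: psi_inj.
    rewrite vz psi_cubic rmorph0 !mul0r -zE; have [-> ->] := w_free t0.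
    by apply: row3_eq; rewrite ?rmorph0 ?mul0r ?addr0 ?mulr0 // mulrC.
  have t'0 := conj_neq0 t0.
  have [k kE] := psi_last v; rewrite vz mxE /= in kE.
  set t := _ + _ in t0 vz; set t' := iota a + iota b * w' in t'0 vz kE.
  pose n := a ^+ 2 + T * (a * b) + N * b ^+ 2.
  have nE : iota n = t * t'.
    by rewrite !rmorphD !rmorphM ?rmorphXn /= -wT -wN /t /t'; ring.
  have zE : z = iota (k / n) * t.
    rewrite fmorph_div nE -kE; field; by rewrite t0 t'0.
  exists a, b, (k / n * s), (k / n); apply: psi_inj;
    rewrite vz psi_cubic -/t -/t' zE.
  by apply: row3_eq; rewrite ?rmorphM //; ring.
have [v [v0 PE _]] := points_pick (subsetP K_points P PK).
rewrite PE in PK *; have [a [b [s [r vE]]]] := proj1 (K_cubic v0) PK.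
have psi_v : psi v = (iota a + iota b * w) *: bvec s (r * a) (r * b).
  by rewrite vE psi_cubic row3Z; apply: row3_eq; rewrite ?rmorphM; ring.
exists (psi_preim <[(bvec s (r * a) (r * b))%R]>%VS).
  apply/imset_f/baerP; exists s, (r * a), (r * b); split=> //.
  apply: contraNneq v0 => b0; apply/eqP/psi_inj.
  by rewrite psi_v b0 scaler0 -(scale0r (0 : V)) psiZ rmorph0 scale0r.
rewrite line_in_points // mem_psi_preim.
by rewrite psi_v memvZ ?memv_line.
Qed.

Lemma ruled_cubic_baer : exists (Sigma : {vspace V}) (S : {set {vspace V}}),
    \dim Sigma = 4%N /\ regular_spread Sigma S /\
    exists X : {set {vspace V}},
      X \subset bb_points Sigma S /\ bb_set X = K /\
      exists f g : {vspace V} -> {vspace 'rV[E]_3},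
        incidence_iso (bb_points Sigma S) (bb_lines Sigma S)
                      (pg2_points E) (pg2_lines E) f g /\
        baer_subplane iota (f @: X) /\
        #|(f @: X) :&: points_of (g Sigma)| = 1%N.
Proof.
exists (Sigma psi), (spread psi).
split; first exact: (dim_Sigma dimV psiD psiZ psi_last psi_onto).
split; first exact: (spread_regular card_E psiD psiZ psi_inj psi_onto w_span
  w_free).
have pointsE := bb_pointsE psiD psiZ psi_inj psi_last psi_onto.
have resK := psi_preimK psiD psiZ psi_onto.
exists (psi_preim @: baer); split; first by rewrite pointsE imsetS ?baer_points.
split; first exact: bb_set_baer.
exists (Espan psi), (Espan psi).
split; first exact: (bb_iso psiD psiZ psi_inj psi_last psi_onto w_span w_free).
have -> : Espan psi @: (psi_preim @: baer) = baer.
  rewrite -imset_comp -[RHS]imset_id; apply: eq_imset => W /=; exact: resK.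
split; first by exists baer_mx; rewrite ?baer_mx_unit.
by rewrite resK baer_tangent.
Qed.

End RuledCubic.

Theorem corollary2 (q : nat) (F E : finFieldType) (iota : {rmorphism F -> E})
    (hq : (3 <= q)%N) (hF : #|F| = q) (hE : #|E| = (q ^ 2)%N)
    (K : {set {vspace 'rV[F]_5}})
    (hK : K \subset points_of fullv)
    (cardK : #|K| = (q ^ 2 + 2 * q + 1)%N)
    (hsolid : forall Pi : {vspace 'rV[F]_5}, \dim Pi = 4%N ->
       is_line (points_of Pi :&: K) \/
       is_two_lines (points_of Pi :&: K) \/
       is_three_lines (points_of Pi :&: K) \/
       is_line_and_conic (points_of Pi :&: K) \/
       is_twisted_cubic Pi (points_of Pi :&: K)) :
  exists (Sigma : {vspace 'rV[F]_5}) (S : {set {vspace 'rV[F]_5}}),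
    \dim Sigma = 4%N /\ regular_spread Sigma S /\
    exists X : {set {vspace 'rV[F]_5}},
      X \subset bb_points Sigma S /\ bb_set X = K /\
      exists f g : {vspace 'rV[F]_5} -> {vspace 'rV[E]_3},
        incidence_iso (bb_points Sigma S) (bb_lines Sigma S)
                      (pg2_points E) (pg2_lines E) f g /\
        baer_subplane iota (f @: X) /\
        #|(f @: X) :&: points_of (g Sigma)| = 1%N.
Proof.
have q_gt2 : (2 < field_order F)%N by rewrite /field_order hF.
have dimV : \dim {:'rV[F]_5} = 5%N by rewrite dimvf dim_matrix.
have card_K : #|K| = ((field_order F).+1 ^ 2)%N.
  by rewrite cardK /field_order hF; clear; lia.
have card_E : #|E| = (#|F| ^ 2)%N by rewrite hE hF.
have [l lK] := exists_directrix q_gt2 dimV hK card_K hsolid.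
have [h0 [h1 [f0 [f1 [f2 [free_h KE]]]]]] :=
  normal_form q_gt2 dimV hK card_K hsolid lK.
have [w [w' [T [N [w_span w_free wT wN w_neq]]]]] :=
  quadratic_basis iota card_E.
apply: (ruled_cubic_baer (X :=
  [tuple h0; h1; f0; f1; f2]) dimV card_E w_span w_free wT wN w_neq free_h hK).
move=> v v0; rewrite KE //; split=> -[a [b [s [r ->]]]]; exists a, b, s, r;
  by rewrite /vec5 /cvec !big_ord_recl big_ord0 /= addr0 !addrA.
Qed.
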